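(* Let $K$ be a finitely generated field of characteristic $p$ of positive transcendence degree over $\mathbb{F}_p$. Let $\phi:A\to K\{\tau\}$ be a Drinfeld module and assume there is a non-constant $t\in A$ with $\phi_t=\sum_{i=0}^r a_i\tau^i$ monic ($a_r=1$). Let $F$ be the algebraic closure of $\mathbb{F}_p$ in $K$, let $M_{K/F}$ be the coherent good set of valuations on $K$ constructed from a transcendence basis $\{x_1,\dots,x_n\}$ of $K/F$, and let $\hat h$, $\hat h_v$ be the global and local heights associated to $\phi$ with respect to $M_{K/F}$. Let $x\in K^{\mathrm{alg}}$, let $F_x$ be the algebraic closure of $\mathbb{F}_p$ in $K(x)$, let $M_{K(x)/F_x}$ be the set of valuations of $K(x)$ lying over valuations in $M_{K/F}$, and let $S_x$ be the set of $v\in M_{K(x)/F_x}$ at which $\phi$ has bad reduction. If $x$ is not a torsion point of $\phi$, then there exists $v\in M_{K(x)/F_x}$ such that $$\hat h_v(x)>q^{-r(2+(r^2+r)|S_x|)}d(v).$$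
   Context: Setting: $p$ prime, $q$ a power of $p$, $A$ the ring of functions on a nonsingular projective curve over $\mathbb{F}_q$ regular away from a fixed closed point $\infty$. $K\{\tau\}$ is the twisted polynomial ring with $\tau(x)=x^q$. A Drinfeld module is a ring morphism $\phi:A\to K\{\tau\}$ such that the $\tau^0$-coefficient of $\phi_a$ is $i(a)$ for a fixed ring morphism $i:A\to K$, and $\phi_a\ne i(a)\tau^0$ for some $a$. $\deg(\phi_a)$ is the degree of $\phi_a$ as a polynomial in $x$. $x$ is torsion if $\phi_a(x)=0$ for some nonzero $a\in A$. A valuation $v$ is of good reduction if for all nonzero $a\in A$ the coefficients of $\phi_a$ are $v$-integral and the leading one is a $v$-unit; otherwise bad reduction. Discrete valuations are normalized with value group $\mathbb{Z}$. Construction of $M_{K/F}$: on $F(x_1,\dots,x_n)$, for each irreducible $P\in F[x_1,\dots,x_n]$ take $v_P(Q_1/Q_2)=\mathrm{ord}_P Q_1-\mathrm{ord}_P Q_2$ with degree $d(v_P)=\deg P$ (total degree), and $v_\infty(Q_1/Q_2)=\deg Q_2-\deg Q_1$ with degree $1$. $M_{K/F}$ consists of all discrete valuations $w$ of $K$ extending these, with degree $d(w)=f(w|v)d(v)/[K:F(x_1,\dots,x_n)]$ ($f$ = residue degree). For a finite extension $L$ of $K$, the valuations $w$ of $L$ lying over $v\in M_{K/F}$ get degree $d(w)=f(w|v)d(v)/[L:K]$ (this is the degree used in the claim for $v\in M_{K(x)/F_x}$). Heights: for a valuation $w$ of a finite extension $L\supseteq K$ lying over $M_{K/F}$ and $y\in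 L$, $V_w(y)=\lim_n\min\{0,w(\phi_{a^n}(y))\}/\deg(\phi_{a^n})$ for any non-constant $a\in A$, $\hat h_w(y)=-d(w)V_w(y)$, and $\hat h(y)=\sum_w\hat h_w(y)$ over all $w$ of $L$ lying over $M_{K/F}$ (independent of $L$). *)

(* Defs.v *)
From HB Require Import structures.
From mathcomp Require Import all_boot all_order all_algebra.
From mathcomp Require Import all_classical all_reals all_analysis.
(* The notations of mpoly clash with those of the analysis library. *)
From mathcomp Require Import (canonicals, coercions) mpoly.

Set Implicit Arguments.
Unset Strict Implicit.
Unset Printing Implicit Defensive.

Import Order.TTheory GRing.Theory Num.Theory numFieldNormedType.Exports.
Local Open Scope classical_set_scope.
Local Open Scope ring_scope.

Definition subfield_set (L : fieldType) (E : set L) : Prop :=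
  [/\ E 1, forall x y, E x -> E y -> E (x - y)
         & forall x y, E x -> E y -> E (x / y)].

Definition generated (L : fieldType) (S : set L) : {pred L} :=
  fun y => `[< forall E : set L, subfield_set E -> S `<=` E -> E y >].

Lemma generated_divring (L : fieldType) (S : set L) :
  divring_closed (generated S).
Proof.
split=> [|x y|x y]; first by apply/asboolP=> E [].
- move=> /asboolP Sx /asboolP Sy; apply/asboolP=> E sE SE.
  by have [_ EB _] := sE; apply: EB; [exact: Sx | exact: Sy].
- move=> /asboolP Sx /asboolP Sy; apply/asboolP=> E sE SE.
  by have [_ _ EV] := sE; apply: EV; [exact: Sx | exact: Sy].
Qed.

HB.instance Definition _ (L : fieldType) (S : set L) :=
  GRing.isDivringClosed.Build L (generated S) (generated_divring S).

(* The least subfield of L containing S, as a field in its own right. *)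
Record subfield (L : fieldType) (S : set L) :=
  Subfield { sfval :> L; _ : sfval \in generated S }.

HB.instance Definition _ (L : fieldType) (S : set L) :=
  [isSub for @sfval L S].
HB.instance Definition _ (L : fieldType) (S : set L) :=
  [Choice of subfield S by <:].
HB.instance Definition _ (L : fieldType) (S : set L) :=
  [SubChoice_isSubIntegralDomain of subfield S by <:].
HB.instance Definition _ (L : fieldType) (S : set L) :=
  [SubIntegralDomain_isSubField of subfield S by <:].
HB.instance Definition _ (L : fieldType) (S : set L) :=
  GRing.RMorphism.copy (@sfval L S) (\val : subfield S -> L).

Lemma sub_generated (L : fieldType) (S : set L) y : S y -> y \in generated S.
Proof. by move=> Sy; apply/asboolP=> E _; apply. Qed.

Definition fin_generated (L : fieldType) (S : set L) : Prop :=
  exists s : seq L, forall y, y \in generated (S `|` [set` s]).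

(* K(x), inside an extension Omega of K. *)
Section Adjoin.
Variables (K Omega : fieldType) (iota : {rmorphism K -> Omega}) (x : Omega).

Definition adjoin_field := subfield (range iota `|` [set x]).

Lemma adjoin_base_subproof (c : K) :
  iota c \in generated (range iota `|` [set x]).
Proof. by apply: sub_generated; left; exists c. Qed.

Lemma adjoin_gen_subproof : x \in generated (range iota `|` [set x]).
Proof. by apply: sub_generated; right. Qed.

Definition adjoin_gen : adjoin_field := Subfield adjoin_gen_subproof.

Definition to_adjoin (c : K) : adjoin_field :=
  Subfield (adjoin_base_subproof c).

Lemma to_adjoin_zmod : zmod_morphism to_adjoin.
Proof. by move=> a b; apply: val_inj; rewrite rmorphB /= rmorphB. Qed.

Lemma to_adjoin_monoid : monoid_morphism to_adjoin.
Proof.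
by split=> [|a b]; apply: val_inj; rewrite ?rmorph1 ?rmorphM /= ?rmorph1 ?rmorphM.
Qed.

HB.instance Definition _ :=
  GRing.isZmodMorphism.Build K adjoin_field to_adjoin to_adjoin_zmod.
HB.instance Definition _ :=
  GRing.isMonoidMorphism.Build K adjoin_field to_adjoin to_adjoin_monoid.

End Adjoin.

Section TwistedPolynomials.
Variables (K : fieldType) (p q : nat).
Hypotheses (charK : p \in [pchar K]) (qp : p.-nat q).

Local Lemma pnat_pcharK j : [pchar K].-nat (q ^ j)%N.
Proof. by rewrite (eq_pnat _ (pcharf_eq charK)) pnatX qp. Qed.

Local Lemma frobD j : {morph (fun x : K => x ^+ (q ^ j)) : x y / x + y}.
Proof. by move=> x y; apply: exprDn_pchar; apply: pnat_pcharK. Qed.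

Local Lemma frob0 j : (0 : K) ^+ (q ^ j) = 0.
Proof.
by rewrite expr0n expn_eq0; case/andP: qp => /lt0n_neq0/negPf->.
Qed.

(* The carrier is {poly K}: f`_i is the coefficient of tau^i, and K{tau} is   *)
(* multiplied according to tau * c = c ^+ q * tau.                            *)
Definition twpoly of p \in [pchar K] & p.-nat q : Type := {poly K}.
Local Notation twp := (twpoly charK qp).

HB.instance Definition _ := GRing.Zmodule.copy twp {poly K}.

Definition tw_mul (f g : {poly K}) : {poly K} :=
  \poly_(i < (size f + size g).-1)
    (\sum_(j < i.+1) f`_j * g`_(i - j) ^+ (q ^ j)).

Local Lemma coef_tw_mul (f g : {poly K}) i :
  (tw_mul f g)`_i = \sum_(j < i.+1) f`_j * g`_(i - j) ^+ (q ^ j).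
Proof.
rewrite coef_poly ltn_predRL; case: leqP => // le_fg_i1.
rewrite big1 // => j _; have [lf_j|lt_j_f] := leqP (size f) j.
  by rewrite nth_default ?mul0r.
rewrite [g`__]nth_default ?frob0 ?mulr0 // leq_subRL -ltnS //.
by rewrite (leq_trans _ le_fg_i1) // ltn_add2r.
Qed.

Local Lemma tw_mulDl : left_distributive (tw_mul : twp -> twp -> twp) +%R.
Proof.
move=> f g h; apply/polyP=> i; rewrite coefD !coef_tw_mul -big_split /=.
by apply: eq_bigr => j _; rewrite coefD mulrDl.
Qed.

Local Lemma tw_mulDr : right_distributive (tw_mul : twp -> twp -> twp) +%R.
Proof.
move=> f g h; apply/polyP=> i; rewrite coefD !coef_tw_mul -big_split /=.
by apply: eq_bigr => j _; rewrite coefD frobD mulrDr.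
Qed.

Local Lemma tw_mul1l : left_id (1 : {poly K}) (tw_mul : twp -> twp -> twp).
Proof.
move=> f; apply/polyP=> i; rewrite coef_tw_mul big_ord_recl /= coef1 mul1r.
by rewrite subn0 expn0 expr1 big1 ?addr0 // => j _; rewrite coef1 mul0r.
Qed.

Local Lemma tw_mul1r : right_id (1 : {poly K}) (tw_mul : twp -> twp -> twp).
Proof.
move=> f; apply/polyP=> i; rewrite coef_tw_mul big_ord_recr /= coef1 subnn /=.
rewrite expr1n mulr1 big1 ?add0r // => j _.
by rewrite coef1 subn_eq0 leqNgt ltn_ord frob0 mulr0.
Qed.

Local Lemma tw_mulA : associative (tw_mul : twp -> twp -> twp).
Proof.
move=> f g h; apply/polyP=> i; rewrite !coef_tw_mul.
pose F j m := f`_j * (g`_(m - j) ^+ (q ^ j) * h`_(i - m) ^+ (q ^ m)).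
transitivity (\sum_(j < i.+1) \sum_(m < i.+1 | (j <= m)%N) F j m).
  apply: eq_bigr => j _; rewrite coef_tw_mul.
  rewrite (big_morph _ (frobD j) (frob0 j)) mulr_sumr.
  have le_ji : (j <= i)%N by rewrite -ltnS ltn_ord.
  rewrite -(big_mkord (fun m => (j <= m)%N) (F j)).
  rewrite -(big_mkord predT (fun k => f`_j *
     (g`_k * h`_(i - j - k) ^+ (q ^ k)) ^+ (q ^ j))).
  rewrite [RHS](big_cat_nat (n := j)) //=; last exact: ltnW.
  rewrite [X in _ = X + _]big_nat_cond [X in _ = X + _]big1 ?add0r; last first.
    by move=> m /andP[/andP[_ lt_mj]]; rewrite leqNgt lt_mj.
  rewrite [RHS](big_addn 0 i.+1 j) subSn //.
  apply: eq_big => [k|k _]; first by rewrite leq_addl.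
  by rewrite /F addnK exprMn -exprM -expnD subnDA subnAC addnC.
rewrite (exchange_big_dep predT) //=; apply: eq_bigr => m _.
rewrite coef_tw_mul mulr_suml.
rewrite (big_ord_narrow_leq (F := F^~ m) (leq_ord m)) /=.
by apply: eq_bigr => j _; rewrite /F mulrA.
Qed.

HB.instance Definition _ := GRing.Zmodule_isNzRing.Build twp
  tw_mulA tw_mul1l tw_mul1r tw_mulDl tw_mulDr (oner_neq0 {poly K}).

End TwistedPolynomials.

(* The polynomial in x given by f, tau acting as x |-> x ^ q. *)
Definition tw_poly (K : fieldType) (q : nat) (f : {poly K}) : {poly K} :=
  \sum_(i < size f) f`_i *: 'X^(q ^ i).

Definition tw_deg (K : fieldType) (q : nat) (f : {poly K}) : nat :=
  (size (tw_poly q f)).-1.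

Definition dvaluation_axiom (L : fieldType) (v : L -> \bar int) : Prop :=
  [/\ v 0 = +oo%E /\ forall x, x != 0 -> exists m : int, v x = m%:E,
      forall x y, v (x * y) = (v x + v y)%E,
      forall x y, (mine (v x) (v y) <= v (x + y)%R)%E
    & exists x, v x = 1%:E].

Record dvaluation (L : fieldType) :=
  DValuation { dval :> L -> \bar int; _ : dvaluation_axiom dval }.

HB.instance Definition _ (L : fieldType) := gen_eqMixin (dvaluation L).
HB.instance Definition _ (L : fieldType) := gen_choiceMixin (dvaluation L).

Lemma dvalM (L : fieldType) (v : dvaluation L) x y : v (x * y) = (v x + v y)%E.
Proof. by case: v => v []. Qed.

Lemma dvalD (L : fieldType) (v : dvaluation L) x y :
  (mine (v x) (v y) <= v (x + y)%R)%E.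
Proof. by case: v => v []. Qed.

Lemma dval1 (L : fieldType) (v : dvaluation L) : v 1 = 0%E.
Proof.
have := dvalM v 1 1; rewrite mulr1; case: v => v [[_ /(_ 1 (oner_neq0 L))]] /=.
by case=> m -> _ _ _ [] /(congr1 (+%R (- m))); rewrite addNr addKr => <-.
Qed.

Lemma dvalN1 (L : fieldType) (v : dvaluation L) : v (-1) = 0%E.
Proof.
have := dvalM v (-1) (-1); rewrite mulrNN mulr1 dval1.
case: v => v [[_ /(_ (-1))]] /=; rewrite oppr_eq0 oner_eq0.
case=> // m -> _ _ _ [] /esym/eqP; rewrite -mulr2n mulrn_eq0 /= => /eqP->.
by [].
Qed.

Section Extensions.
Variables (E L : fieldType) (iota : {rmorphism E -> L}).

(* [L : E]; 0 if L is not finite over E. *)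
Definition ext_degree : nat :=
  xget 0%N [set m | exists b : 'I_m -> L,
    forall z, exists! c : 'I_m -> E, z = \sum_(j < m) iota (c j) * b j].

(* The normalized valuation w restricts to a multiple of v, the factor e      *)
(* being the ramification index.                                              *)
Definition lies_over (w : dvaluation L) (v : dvaluation E) : Prop :=
  exists2 e : nat, (0 < e)%N & forall y, w (iota y) = (v y *+ e)%E.

(* The residues of b form a basis of the residue field of w over that of v.   *)
Definition residue_basis (w : dvaluation L) (v : dvaluation E)
    (m : nat) (b : 'I_m -> L) : Prop :=
  [/\ forall j, (0 <= w (b j))%E,
      forall c : 'I_m -> E, (forall j, 0 <= v (c j))%E ->
        (0 < w (\sum_(j < m) iota (c j) * b j)%R)%E ->
        forall j, (0 < v (c j))%E
    & forall z, (0 <= w z)%E -> exists2 c : 'I_m -> E,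
        (forall j, 0 <= v (c j))%E &
        (0 < w (z - \sum_(j < m) iota (c j) * b j)%R)%E].

(* f(w|v); 0 if the residue extension is not finite. *)
Definition residue_degree (w : dvaluation L) (v : dvaluation E) : nat :=
  xget 0%N [set m | exists b : 'I_m -> L, residue_basis w v b].

(* The valuations of L over a set M of valuations of E, and their degrees     *)
(* f(w|v) d(v) / [L : E], v being the (unique) valuation of E below w.        *)
Definition places_over (M : set (dvaluation E)) : set (dvaluation L) :=
  [set w | exists2 v, M v & lies_over w v].

Definition degree_over (M : set (dvaluation E)) (d : dvaluation E -> rat)
    (w : dvaluation L) : rat :=
  xget 0 [set delta : rat | exists v, [/\ M v, lies_over w v &
    delta = (residue_degree w v)%:R * d v / ext_degree%:R]].

End Extensions.

Section PolynomialPlaces.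
Variables (F K : fieldType) (jF : {rmorphism F -> K}).
Variables (n : nat) (X : 'I_n -> K).

Local Notation polyF := (mpoly.mpoly n F).
Local Notation ev := (mpoly.mmap jF X).

(* F(x_1, ..., x_n), as a subfield of K *)
Definition ratfield := subfield (range jF `|` range X).

Definition transcendence_basis : Prop :=
  (forall Q : polyF, ev Q = 0 -> Q = 0) /\
  (forall y : K, algebraicOver (@sfval _ _ : ratfield -> K) y).

Definition totdeg (Q : polyF) : nat := (mpoly.mmeasure mpoly.mdeg Q).-1.

Definition irreducible_mpoly (P : polyF) : Prop :=
  [/\ P != 0, P \isn't a GRing.unit &
      forall Q1 Q2, P = Q1 * Q2 ->
        Q1 \is a GRing.unit \/ Q2 \is a GRing.unit].

(* For Q != 0 and P not constant, P ^+ k divides Q only if k <= totdeg Q. *)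
Definition ord_mpoly (P Q : polyF) : nat :=
  \max_(k < (totdeg Q).+1 | `[< exists S, Q = P ^+ k * S >]) k.

Definition is_vP (P : polyF) (v : dvaluation ratfield) : Prop :=
  forall (Q1 Q2 : polyF) (y : ratfield), Q1 != 0 -> Q2 != 0 ->
    sfval y = ev Q1 / ev Q2 ->
    v y = ((ord_mpoly P Q1)%:Z - (ord_mpoly P Q2)%:Z)%:E.

Definition is_vinfty (v : dvaluation ratfield) : Prop :=
  forall (Q1 Q2 : polyF) (y : ratfield), Q1 != 0 -> Q2 != 0 ->
    sfval y = ev Q1 / ev Q2 ->
    v y = ((totdeg Q2)%:Z - (totdeg Q1)%:Z)%:E.

Definition base_places : set (dvaluation ratfield) :=
  [set v | (exists2 P, irreducible_mpoly P & is_vP P v) \/ is_vinfty v].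

Definition base_degree (v : dvaluation ratfield) : rat :=
  xget 0 [set delta : rat |
    (exists P, [/\ irreducible_mpoly P, is_vP P v & delta = (totdeg P)%:R]) \/
    (is_vinfty v /\ delta = 1)].

Definition places_KF : set (dvaluation K) :=
  places_over (@sfval _ _ : {rmorphism ratfield -> K}) base_places.

Definition degree_KF : dvaluation K -> rat :=
  degree_over (@sfval _ _ : {rmorphism ratfield -> K}) base_places base_degree.

End PolynomialPlaces.

(* jF identifies F with the algebraic closure of F_p in K. *)
Definition is_alg_closure_Fp (p : nat) (F K : fieldType)
    (jF : {rmorphism F -> K}) : Prop :=
  range jF = [set y | algebraicOver (fun c : 'F_p => (c : nat)%:R : K) y].

(* A nonsingular projective curve over Fq is given by its function field k,   *)
(* a finitely generated extension of Fq of transcendence degree 1; its closed *)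
(* points are the discrete valuations of k (all trivial on the finite Fq).    *)
Definition function_field (Fq k : fieldType) (cst : {rmorphism Fq -> k}) :=
  fin_generated (range cst) /\
  exists2 T : k, ~ algebraicOver cst T &
    forall y, algebraicOver (@sfval k (range cst `|` [set T])) y.

Section AffineRing.
Variables (k : fieldType) (oo : dvaluation k).

Definition regular_away : {pred k} :=
  fun f => `[< forall v : dvaluation k, v <> oo -> (0 <= v f)%E >].

Lemma regular_away_subring : subring_closed regular_away.
Proof.
split=> [|x y|x y]; first by apply/asboolP=> v _; rewrite dval1.
- move=> /asboolP rx /asboolP ry; apply/asboolP=> v voo.
  apply: le_trans (dvalD v _ _); rewrite le_min rx //= -mulN1r dvalM dvalN1.
  by rewrite add0e ry.
- move=> /asboolP rx /asboolP ry; apply/asboolP=> v voo.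
  by rewrite dvalM adde_ge0 ?rx ?ry.
Qed.

HB.instance Definition _ :=
  GRing.isSubringClosed.Build k regular_away regular_away_subring.

(* The functions regular away from the closed point oo. *)
Record affine_ring := AffineRing { afun :> k; _ : afun \in regular_away }.

HB.instance Definition _ := [isSub for afun].
HB.instance Definition _ := [Choice of affine_ring by <:].
HB.instance Definition _ := [SubChoice_isSubComNzRing of affine_ring by <:].

(* The constant functions are those algebraic over Fq; they are the elements  *)
(* of Fq when the curve is geometrically irreducible.                         *)
Definition nonconstant (Fq : fieldType) (cst : {rmorphism Fq -> k})
  (a : affine_ring) : Prop := ~ algebraicOver cst (afun a).

End AffineRing.

Section Drinfeld.
Variables (k : fieldType) (oo : dvaluation k).
Variables (K : fieldType) (p q : nat).
Variables (charK : p \in [pchar K]) (qp : p.-nat q).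
Local Notation A := (affine_ring oo).
Implicit Type phi : {rmorphism A -> twpoly charK qp}.

Definition drinfeld (i : {rmorphism A -> K}) phi : Prop :=
  (forall a, (phi a : {poly K})`_0 = i a) /\
  (exists a, (phi a : {poly K}) <> (i a)%:P).

Section Points.
Variables (L : fieldType) (iota : {rmorphism K -> L}).

Definition act phi (a : A) (y : L) : L :=
  (map_poly iota (tw_poly q (phi a))).[y].

Definition torsion phi (y : L) : Prop := exists2 a : A, a != 0 & act phi a y = 0.

Definition good_reduction phi (v : dvaluation L) : Prop :=
  forall a : A, a != 0 ->
    (forall j, 0 <= v (iota (phi a : {poly K})`_j)%R)%E /\
    v (iota (lead_coef (phi a : {poly K}))) = 0%E.

Section Heights.
Variable R : realType.

Definition local_V phi (w : dvaluation L) (a : A) (y : L) : R :=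
  lim ((fun m : nat =>
          (fine (mine 0 (w (act phi (a ^+ m)%R y)))%E)%:~R
            / (tw_deg q (phi (a ^+ m)))%:R : R) @ \oo).

Definition local_height phi (d : dvaluation L -> rat) (w : dvaluation L)
    (a : A) (y : L) : R :=
  - ratr (d w) * local_V phi w a y.

End Heights.
End Points.
End Drinfeld.

(* Main.v *)
Require Import Defs.
From HB Require Import structures.
From mathcomp Require Import all_boot all_order all_algebra.
From mathcomp Require Import all_classical all_reals all_analysis.
From mathcomp Require Import finmap.
From mathcomp Require Import ring lra zify finfield.
From mathcomp Require Import (canonicals, coercions) mpoly.

Set Implicit Arguments.
Unset Strict Implicit.
Unset Printing Implicit Defensive.

Import Order.TTheory GRing.Theory Num.Theory numFieldNormedType.Exports.
Local Open Scope classical_set_scope.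
Local Open Scope ring_scope.

(* Put N = 2 + (r ^ 2 + r) |S| and suppose that V_v(x) >= - q ^ (- r N) at    *)
(* every place v. For a polynomial h over Fq with at most N coefficients the  *)
(* point y = phi_(h(t)) (x) then has V_v(y) > -1 everywhere. If y lies below  *)
(* all nonzero roots of phi_t at v, then V_v(y) <= v(y) is at most -1, which  *)
(* excludes poles of y at the places of good reduction. At a place v of S,    *)
(* where phi_t has a root below 0, the same remark applied to phi_t(y) shows  *)
(* that y is congruent to a root of phi_t if h has at most N - 1 coefficients.*)
(* There are q ^ (N - 1) such h and fewer choices of a root at each place of  *)
(* S, so some h <> 0 gives a point that is integral everywhere and vanishes   *)
(* on S. Elements integral at all places are algebraic over F_p, hence        *)
(* nowhere vanishing, and S is not empty, as otherwise x and the coefficients *)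
(* of phi_t are algebraic over F_p and x is torsion.                          *)

(** * Unique factorization of polynomials *)

(** The proof plays a scaling law against an integrality gap. Applying phi_(h(t)) to [x] multiplies
    each V_v by the degree of phi_(h(t)) ([local_V_act]). On the other hand, a point y with negative
    value at v, below the values of all nonzero roots of phi_t, is scaled exactly by each
    application of phi_t, so V_v(y) is at most v(y), an integer, hence at most -1 ([local_V_small]).
    If all local heights of [x] are tiny, no point phi_(h(t))(x) with h of degree below N can be
    such a y. At places of good reduction this makes the points integral ([good_orbit_integral]); at
    bad places it makes them congruent to roots ([near_root]). There are more polynomials h than
    choices of a root at each bad place ([root_count]), so two points share all their choices, and
    their difference is nonzero, integral everywhere and of positive value at each bad place.

    The contradiction comes from the principle that a function without poles is constant, here
    [everywhere_integral_periodic]. On the rational function field it is unique factorization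
    ([base_integral]). It passes to K(x) because a nonintegral element has a pole at some extension
    of the valuation ([valuation_extension]), and because integrality of an element passes to its
    minimal polynomial by Gauss's lemma. A constant lies in a finite field, so a nonzero one has
    value 0 everywhere and cannot vanish at a bad place; a bad place exists by [bad_place_exists].

    Supporting facts: [finite_poles] makes the set of bad places finite, [good_reduction_generator]
    reads the reduction off the coefficients of phi_t, and [phi_neq0] with [nonconstant_size] gives
    the degrees at least 2 on which Tate's limit rests. The roots of phi_t live in an algebraic
    closure, to which valuations extend with rational values ([extend_to_algebraic]). *)

Section Divisibility.
Variable R : idomainType.
Implicit Types a b c : R.

Definition divides a b := exists c, b = a * c.

Definition prime_elt a :=
  [/\ a != 0, a \isn't a GRing.unit &
      forall b c, divides a (b * c) -> divides a b \/ divides a c].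

(** The factors are prime, not merely irreducible, so the existence of such a product already
    contains the uniqueness of the factorization. *)
Definition prime_product c := exists u s,
  [/\ u \is a GRing.unit, (forall a, a \in s -> prime_elt a) &
      c = u * \prod_(a <- s) a].

Definition unique_factorization := forall c, c != 0 -> prime_product c.

End Divisibility.

Section UniqueFactorization.
Variable R : idomainType.
Implicit Types (a b c : R) (f g h : {poly R}).

Lemma divides_trans a b c : divides a b -> divides b c -> divides a c.
Proof. by move=> [x ->] [y ->]; exists (x * y); rewrite mulrA. Qed.

Lemma prime_divides_prod a u (s : seq R) : prime_elt a ->
  u \is a GRing.unit -> divides a (u * \prod_(b <- s) b) ->
  exists2 b, b \in s & divides a b.
Proof.
move=> [a0 au pa] uu; elim: s => [|b s IH].
  rewrite big_nil mulr1 => -[c uE]; case/negP: au.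
  by move: uu; rewrite uE unitrM => /andP[].
rewrite big_cons mulrCA => /pa[ab|/IH[d ds ad]]; first by exists b;
  rewrite ?mem_head.
by exists d; rewrite // inE ds orbT.
Qed.

Lemma prime_divides_assoc a b : prime_elt a -> prime_elt b -> divides a b ->
  exists2 e, e \is a GRing.unit & b = a * e.
Proof.
move=> [a0 au pa] [b0 bu pb] [e bE]; exists e => //.
have [[x aE]|[x eE]] : divides b a \/ divides b e.
- by apply: pb; exists 1; rewrite mulr1.
- have : b * 1 = b * (x * e) by rewrite mulr1 {1}bE aE mulrA.
  move/(mulfI b0) => /esym xe1; apply/unitrP; exists x.
  by rewrite xe1 mulrC xe1.
- have : b * 1 = b * (a * x) by rewrite mulr1 {1}bE eE mulrCA.
  move/(mulfI b0) => /esym ax1; case/negP: au; apply/unitrP; exists x.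
  by rewrite ax1 mulrC ax1.
Qed.

Lemma divides_polyC a f : divides a%:P f <-> forall i, divides a f`_i.
Proof.
split=> [[g ->] i|/choice[F FE]]; first by exists g`_i; rewrite coefCM.
exists (\poly_(i < size f) F i); apply/polyP=> i.
rewrite coefCM coef_poly; case: ltnP => [_|le_fi]; first exact: FE.
by rewrite nth_default ?mulr0.
Qed.

(** If [a] divides neither [f] nor [g], let [i] and [j] be the indices of their first coefficients
    not divisible by [a]. In the coefficient [i + j] of [f * g] every other term is divisible by
    [a]. *)
Lemma prime_polyC a : prime_elt a -> prime_elt a%:P.
Proof.
move=> [a0 au pa]; split; first by rewrite polyC_eq0.
  by rewrite poly_unitE coefC eqxx (negPf au) andbF.
move=> f g; have [nf|] := pselect (divides a%:P f); first by left.
move=> nf; have [ng|] := pselect (divides a%:P g); first by right.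
move=> ng.
have min h : ~ divides a%:P h ->
    exists2 i, ~ divides a h`_i & forall j, (j < i)%N -> divides a h`_j.
  move=> nh; have ex : exists i, ~~ `[< divides a h`_i >].
    apply: contrapT => nex; apply: nh; apply/divides_polyC => i.
    by apply: contrapT => ni; apply: nex; exists i; apply/asboolPn.
  case: (ex_minnP ex) => i /asboolPn ni mi; exists i => // j ltji.
  by apply: contrapT => /asboolPn /mi; rewrite leqNgt ltji.
have [i ni mi] := min f nf; have [j nj mj] := min g ng.
move=> /divides_polyC /(_ (i + j)%N); rewrite coefM.
have lti : (i < (i + j).+1)%N by rewrite ltnS leq_addr.
rewrite (bigD1 (Ordinal lti)) //= addKn => -[c fgE].
suff [d sE] : divides a (\sum_(k < (i + j).+1 | k !=
  Ordinal lti) f`_k * g`_(i + j - k)).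
  have /pa[] // : divides a (f`_i * g`_j).
  by exists (c - d); rewrite mulrBr -fgE sE addrK.
apply: (big_ind (divides a)) => [|x y [x' ->] [y' ->]|k neq].
- by exists 0; rewrite mulr0.
- by exists (x' + y'); rewrite mulrDr.
have : (k : nat) != i by move: neq; rewrite -val_eqE.
rewrite neq_ltn => /orP[ltki|ltik].
  by have [x ->] := mi _ ltki; exists (x * g`_(i + j - k)); rewrite mulrA.
have [|x ->] := mj (i + j - k)%N;
  first by rewrite ltn_subLR ?ltn_add2r // -ltnS.
by exists (f`_k * x); rewrite mulrCA.
Qed.

Definition primitive_poly f := forall a, prime_elt a -> ~ divides a%:P f.

(** The primes of [c] are cancelled one at a time: each remains prime as a constant polynomial,
    divides [g * h], and cannot divide the primitive [g], so it can be taken out of [h]. *)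
Lemma primitive_divides c f g h : primitive_poly g -> c != 0 ->
  prime_product c -> c *: f = g * h -> divides g f.
Proof.
move=> pg c0 [u [s [uu ps cE]]]; elim: s => [|a s IH] in c c0 cE h ps *.
  rewrite big_nil mulr1 in cE; subst c => E; exists (u^-1 *: h).
  by rewrite -scalerAr -E scalerA mulVr ?scale1r.
rewrite big_cons mulrCA in cE => E.
have pa : prime_elt a by apply: ps; rewrite mem_head.
have [ag|[h' hE]] : divides a%:P g \/ divides a%:P h.
- have [_ _] := prime_polyC pa; apply; rewrite -E cE.
  by exists ((u * \prod_(j <- s) j) *: f); rewrite mul_polyC scalerA.
- by case: (pg a pa ag).
have a0 : a != 0 by case: pa.
apply: (IH _ _ erefl h') => [||].
- by move: c0; rewrite cE mulf_eq0 negb_or => /andP[].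
- by move=> b bs; apply: ps; rewrite inE bs orbT.
have aP0 : a%:P != 0 by rewrite polyC_eq0.
by apply: (mulfI aP0); rewrite mulrCA -hE -E cE !mul_polyC scalerA.
Qed.

(** Each prime constant taken out of [f] uses up one prime factor of the leading coefficient, so the
    extraction ends. *)
Lemma primitive_part f : unique_factorization R -> f != 0 ->
  exists c g, [/\ c != 0, primitive_poly g & f = c *: g].
Proof.
move=> ufd f0; have := ufd (lead_coef f); rewrite lead_coef_eq0 => /(_ f0).
move=> [u [s [uu ps]]]; move: {2}(size s) (erefl (size s)) => k.
elim: k => [|k IH] in f f0 u uu s ps *; move=> sk lE;
  have [pf|npf] := pselect (primitive_poly f);
  do ?[by exists 1, f; rewrite oner_neq0 scale1r].
all: have [a pa [g fE]] : exists2 a, prime_elt a & divides a%:P f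
  by apply: contrapT => nex; apply: npf => a pa da; apply: nex; exists a.
all: have lfE : lead_coef f =
  a * lead_coef g by rewrite fE lead_coefM lead_coefC.
all: have [b bs ab] : exists2 b, b \in s & divides a b
  by apply: (prime_divides_prod pa uu); rewrite -lE lfE; exists (lead_coef g).
  by move/size0nil: sk bs => ->.
have a0 : a != 0 by case: pa.
have [e eu bE] := prime_divides_assoc pa (ps _ bs) ab.
have g0 : g != 0 by apply: contra_neq f0 => g0; rewrite fE g0 mulr0.
have [||||c [h [c0 ph gE]]] := IH g g0 (u * e) _ (rem b s).
- by rewrite unitrM uu.
- by move=> d /mem_rem; apply: ps.
- by rewrite size_rem // sk.
- apply: (mulfI a0); rewrite -lfE lE (perm_big _ (perm_to_rem bs)) /= big_cons
    bE.
  by ring.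
exists (a * c), h; split=> //; first by rewrite mulf_neq0.
by rewrite fE gE mul_polyC scalerA.
Qed.

(* Over the fraction field the gcd of [h] and a factor is trivial; the        *)
(* denominators are removed because [h] is primitive.                         *)
Lemma primitive_prime h : unique_factorization R -> primitive_poly h ->
    (1 < size h)%N ->
    (forall g, (1 < size g)%N -> (g %| h)%R -> size g = size h) ->
  prime_elt h.
Proof.
move=> ufd ph sh minh; have h0 : h != 0 by rewrite -size_poly_gt0 ltnW.
have strip f : (h %| f)%R -> divides h f.
  move=> /Pdiv.Idomain.dvdpP[[c g] /= c0 E].
  by apply: (primitive_divides ph c0 (ufd _ c0)); rewrite E mulrC.
split=> // [|f g [w E]].
  by rewrite poly_unitE; apply/negP=> /andP[/eqP e]; rewrite e in sh.
have dfg : (h %| f * g)%R by rewrite E dvdp_mulIl.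
have [lt1|le1] := ltnP 1 (size (gcdp h f)).
  left; apply: strip; have dl := dvdp_gcdl h f.
  have : (gcdp h f %= h)%R by rewrite -dvdp_size_eqp // minh.
  by move=> /eqp_dvdl <-; apply: dvdp_gcdr.
have cop : coprimep h f.
  by rewrite /coprimep eqn_leq le1 lt0n size_poly_eq0 gcdp_eq0 (negPf h0).
by right; apply: strip; rewrite -(Gauss_dvdpr g cop).
Qed.

End UniqueFactorization.

(** A nonconstant divisor of least degree has a primitive part that is prime by [primitive_prime];
    splitting it off lowers the degree. Constants are factored in the base ring. *)
Lemma unique_factorization_poly (R : idomainType) :
  unique_factorization R -> unique_factorization {poly R}.
Proof.
move=> ufd f; move: {2}(size f) (leqnn (size f)) => n.
elim: n => [|n IH] in f *; first by rewrite leqn0 size_poly_eq0 => ->.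
have [le1 _ f0|gt1 lefn f0] := leqP (size f) 1.
  have fE := size1_polyC le1.
  have [u [s [uu ps cE]]] : prime_product f`_0.
    by apply: ufd; rewrite -polyC_eq0 -fE.
  exists u%:P, (map polyC s); split.
  - have u0 : u != 0 by apply: contraTneq uu => ->; rewrite unitr0.
    by rewrite poly_unitE coefC eqxx uu size_polyC u0.
  - by move=> _ /mapP[a /ps pa ->]; apply: prime_polyC.
  - by rewrite fE cE rmorphM rmorph_prod big_map.
have ex : exists m, `[< exists2 g : {poly R},
  (g %| f)%R & (1 < size g)%N /\ size g = m >].
  by exists (size f); apply/asboolP; exists f.
case: (ex_minnP ex) => m /asboolP[g gf [g1 gm]] mmin.
have g0 : g != 0 by rewrite -size_poly_gt0 ltnW.
have [c [h [c0 ph gE]]] := primitive_part ufd g0.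
have sg : size h = size g by rewrite gE size_scale.
have hf : (h %| f)%R by apply: dvdp_trans gf; rewrite gE dvdpZr.
have primeh : prime_elt h.
  apply: primitive_prime => //; first by rewrite sg.
  move=> g' g'1 g'h; apply/eqP; rewrite eqn_leq dvdp_leq //=; last first.
    by rewrite -size_poly_gt0 sg ltnW.
  rewrite sg gm; apply: mmin; apply/asboolP; exists g' => //.
  exact: dvdp_trans hf.
have /Pdiv.Idomain.dvdpP[[d w] /= d0 E] := hf.
have [k fE] : divides h f.
  by apply: (primitive_divides ph d0 (ufd _ d0)); rewrite E mulrC.
have k0 : k != 0 by apply: contra_neq f0 => k0; rewrite fE k0 mulr0.
have h0 : h != 0 by case: primeh.
have [|//|u [s [uu ps kE]]] := IH k.
  have k1 : (0 < size k)%N by rewrite size_poly_gt0.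
  by move: lefn; rewrite fE size_mul // sg; lia.
exists u, (h :: s); split=> //; last by rewrite fE kE big_cons mulrCA.
by move=> a; rewrite inE => /predU1P[->|/ps].
Qed.

Lemma unique_factorization_iso (R S : idomainType) (F : {rmorphism R -> S})
    (G : {rmorphism S -> R}) : cancel F G -> cancel G F ->
  unique_factorization R -> unique_factorization S.
Proof.
move=> FK GK ufd c c0; have [|u [s [uu ps cE]]] := ufd (G c).
  by apply: contra_neq c0 => /(congr1 F); rewrite GK rmorph0.
exists (F u), (map F s); split; first exact: rmorph_unit.
  move=> _ /mapP[a /ps[a0 au pa] ->]; split.
  - by apply: contra_neq a0 => /(congr1 G); rewrite FK rmorph0.
  - by apply: contra au => /(rmorph_unit G); rewrite FK.
  move=> b d [e bdE]; have [[x E]|[x E]] : divides a (G b) \/ divides a (G d).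
  - by apply: pa; exists (G e); rewrite -rmorphM bdE rmorphM FK.
  - by left; exists (F x); rewrite -rmorphM -E GK.
  - by right; exists (F x); rewrite -rmorphM -E GK.
by rewrite -[c]GK cE rmorphM rmorph_prod big_map.
Qed.

Section MPolyUniqueFactorization.
Variable F : fieldType.

Lemma muni_mpolyX n (m : mpoly.multinom n.+1) :
  mpoly.muni (mpoly.mpolyX F m) =
  mpoly.mpolyX F (mpoly.Multinom
    [tuple m (widen_ord (leqnSn n) i) | i < n]) *: 'X^(m ord_max).
Proof.
rewrite mpoly.muniE mpoly.msuppX big_seq1 mpoly.mcoeffX eqxx.
by rewrite scale1r.
Qed.

(** The inverse of [mpoly.muni]: coefficients are widened by one variable and the indeterminate
    becomes the last variable. *)
Definition multi n : {poly mpoly.mpoly n F} -> mpoly.mpoly n.+1 F :=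
  horner_eval (mpoly.mpolyX F (mpoly.mnm1 ord_max)) \o
  map_poly (@mpoly.mwiden n F).

HB.instance Definition _ n := GRing.RMorphism.on (@multi n).

Lemma multiC n c : multi c%:P = @mpoly.mwiden n F c.
Proof. by rewrite /multi /= /horner_eval map_polyC hornerC. Qed.

Lemma multiX n : @multi n 'X = mpoly.mpolyX F (mpoly.mnm1 ord_max).
Proof. by rewrite /multi /= /horner_eval map_polyX hornerX. Qed.

Lemma muniK n : cancel (@mpoly.muni n F) (@multi n).
Proof.
move=> Q; rewrite {2}[Q]mpoly.mpolyE mpoly.muniE rmorph_sum.
apply: eq_bigr => m _; rewrite -mul_polyC rmorphM rmorphXn /= multiC multiX.
rewrite mpoly.mwidenZ mpoly.mwidenX -scalerAl; congr (_ *: _).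
rewrite mpoly.mpolyXn -mpoly.mpolyXD; congr (mpoly.mpolyX _ _).
apply/mpoly.mnmP=> j; rewrite mpoly.mnmDE mpoly.mulmnE mpoly.mnm1E.
have [->|neq] := eqVneq j ord_max.
  by rewrite mpoly.mnmwiden_ordmax mul1n.
have ltj : (j < n)%N.
  by rewrite ltn_neqAle -ltnS ltn_ord andbT; apply: contra neq => /eqP jn;
    apply/eqP/val_inj.
have jE : j = widen_ord (leqnSn n) (Ordinal ltj) by apply: val_inj.
rewrite mul0n addn0 [in LHS]jE mpoly.mnmwiden_widen mpoly.mnmE.
by rewrite -jE.
Qed.

Lemma muni_widen n c : mpoly.muni (@mpoly.mwiden n F c) = c%:P.
Proof.
rewrite [c]mpoly.mpolyE.
apply: (big_ind (fun c => mpoly.muni (mpoly.mwiden c) = c%:P)) => [|x y|m _].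
- by rewrite !rmorph0.
- by rewrite !rmorphD /= => -> ->.
rewrite mpoly.mwidenZ mpoly.mwidenX mpoly.muniZ.
rewrite muni_mpolyX mpoly.mnmwiden_ordmax expr0 alg_polyC -mul_polyC -polyCM.
rewrite mpoly.mul_mpolyC; congr (_ *: _)%:P; congr mpoly.mpolyX.
by apply/mpoly.mnmP=> j; rewrite mpoly.mnmE mpoly.mnmwiden_widen.
Qed.

Lemma muni_Xmax n : mpoly.muni (mpoly.mpolyX F (mpoly.mnm1 (@ord_max n))) = 'X.
Proof.
rewrite muni_mpolyX mpoly.mnm1E eqxx expr1.
suff -> : mpoly.mpolyX F (mpoly.Multinom
    [tuple mpoly.mnm1 ord_max (widen_ord (leqnSn n) i) | i < n]) = 1.
  by rewrite scale1r.
rewrite -mpoly.mpolyX0; congr mpoly.mpolyX; apply/mpoly.mnmP=> j.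
by rewrite mpoly.mnmE mpoly.mnm1E mpoly.mnm0E -val_eqE /= gtn_eqF.
Qed.

Lemma multiK n : cancel (@multi n) (@mpoly.muni n F).
Proof.
elim/poly_ind => [|P c IH]; first by rewrite !rmorph0.
by rewrite !(rmorphD, rmorphM) /= IH multiX multiC muni_Xmax muni_widen.
Qed.

Theorem unique_factorization_mpoly n : unique_factorization (mpoly.mpoly n F).
Proof.
elim: n => [|n IH].
  move=> c c0; exists c, nil; rewrite big_nil mulr1; split=> //.
  rewrite (mpoly.nvar0_mpolyC c) in c0 *; apply: rmorph_unit.
  by rewrite unitfE -(mpoly.mpolyC_eq0 0).
apply: (@unique_factorization_iso _ _ (@multi n) (@mpoly.muni n F) (@multiK n)
  (@muniK n)).
exact: unique_factorization_poly.
Qed.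

(** In the prime factorization of an irreducible [P], all but one factor must be absorbed into the
    unit. Primality is what makes [ord_mpoly] additive. *)
Lemma irreducible_mpoly_prime n (P : mpoly.mpoly n F) :
  irreducible_mpoly P -> prime_elt P.
Proof.
move=> [P0 Pu irrP]; have [u [s [uu ps PE]]] := unique_factorization_mpoly P0.
case: s => [|a s] in ps PE *.
  by rewrite PE big_nil mulr1 uu in Pu.
have [a0 au pa] := ps _ (mem_head _ _).
have [v vu Pav] : exists2 v, v \is a GRing.unit & P = a * v.
  rewrite big_cons mulrCA in PE; case: (irrP _ _ PE) => [ua|];
    last by exists (u * \prod_(j <- s) j).
  by rewrite ua in au.
split=> // b c [d E]; have [|[x ->]|[x ->]] := pa b c.
- by exists (v * d); rewrite mulrA -Pav.
- by left; exists (v^-1 * x); rewrite Pav mulrA mulrK.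
- by right; exists (v^-1 * x); rewrite Pav mulrA mulrK.
Qed.

End MPolyUniqueFactorization.

(** * Total degree and multiplicity of an irreducible factor *)

Section TotalDegree.
Variables (F : fieldType) (n : nat).
Implicit Types P Q : mpoly.mpoly n F.

Lemma msize_gt0 Q : Q != 0 -> (0 < mpoly.mmeasure mpoly.mdeg Q)%N.
Proof. by rewrite lt0n mpoly.mmeasure_poly_eq0. Qed.

Lemma totdegM P Q : P != 0 -> Q != 0 ->
  totdeg (P * Q) = (totdeg P + totdeg Q)%N.
Proof.
move=> P0 Q0; rewrite /totdeg mpoly.msizeM //.
by move: (mpoly.mmeasure _ P) (mpoly.mmeasure _ Q) (msize_gt0 P0) (msize_gt0
  Q0); case=> // a [] //= b _ _; rewrite addnS.
Qed.

Lemma totdeg_unit P : P != 0 -> (P \is a GRing.unit) = (totdeg P == 0%N).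
Proof.
move=> P0; apply/idP/idP => [uP|].
  have := totdegM P0 (_ : P^-1 != 0); rewrite invr_eq0 => /(_ P0).
  by rewrite divrr // {1}/totdeg mpoly.msize1 /=; lia.
move=> dP; have /mpoly.msize1_polyC PE : (mpoly.mmeasure mpoly.mdeg P <= 1)%N.
  by move: dP; rewrite /totdeg; lia.
rewrite PE in P0 *; apply: rmorph_unit; rewrite unitfE.
by apply: contra_neq P0 => ->; rewrite rmorph0.
Qed.

Lemma totdeg_irreducible P : irreducible_mpoly P -> (0 < totdeg P)%N.
Proof. by move=> [P0 + _]; rewrite totdeg_unit // lt0n. Qed.

Lemma irreducible_factor Q : Q != 0 -> Q \isn't a GRing.unit ->
  exists2 P, irreducible_mpoly P & divides P Q.
Proof.
move: {2}(totdeg Q) (leqnn (totdeg Q)) => m; elim: m => [|m IH] in Q *.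
  by rewrite leqn0 => + Q0; rewrite totdeg_unit // => ->.
move=> lem Q0 Qu; have [irrQ|nirr] := pselect (irreducible_mpoly Q).
  by exists Q => //; exists 1; rewrite mulr1.
have [Q1 [Q2 [QE Q1u Q2u]]] : exists Q1 Q2,
    [/\ Q = Q1 * Q2, Q1 \isn't a GRing.unit & Q2 \isn't a GRing.unit].
  apply: contrapT => nex; apply: nirr; split=> // Q1 Q2 QE.
  have [?|u1] := boolP (Q1 \is a GRing.unit); first by left.
  have [?|u2] := boolP (Q2 \is a GRing.unit); first by right.
  by case: nex; exists Q1, Q2.
have Q10 : Q1 != 0 by apply: contra_neq Q0; rewrite QE => ->; rewrite mul0r.
have Q20 : Q2 != 0 by apply: contra_neq Q0; rewrite QE => ->; rewrite mulr0.
have [|//|//|P irrP PQ] := IH Q1.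
  by move: lem Q2u; rewrite QE totdegM // totdeg_unit //; lia.
by exists P => //; apply: divides_trans PQ _; exists Q2.
Qed.

Lemma divides_exp_totdeg P Q k : irreducible_mpoly P -> Q != 0 ->
  divides (P ^+ k) Q -> (k <= totdeg Q)%N.
Proof.
move=> irrP Q0 [S QE]; have P0 : P != 0 by case: irrP.
have S0 : S != 0 by apply: contra_neq Q0 => S0; rewrite QE S0 mulr0.
have : (k <= totdeg (P ^+ k))%N.
  elim: k {QE} => [//|k IH]; rewrite exprS totdegM ?expf_neq0 //.
  by have := totdeg_irreducible irrP; lia.
by rewrite QE totdegM ?expf_neq0 //; lia.
Qed.

(** [ord_mpoly] is a maximum over exponents up to the total degree of [Q]. By [divides_exp_totdeg]
    this range contains every exponent that can occur, so the maximum is the true multiplicity. *)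
Lemma ord_mpoly_eq P Q S k : irreducible_mpoly P -> Q != 0 ->
  Q = P ^+ k * S -> ~ divides P S -> ord_mpoly P Q = k.
Proof.
move=> irrP Q0 QE nPS; have P0 : P != 0 by case: irrP.
apply/eqP; rewrite eqn_leq; apply/andP; split.
  apply/bigmax_leqP => -[j _] /= /asboolP[S' QE']; rewrite leqNgt;
    apply/negP=> ltkj.
  apply: nPS; exists (P ^+ (j - k.+1) * S').
  apply: (mulfI (expf_neq0 k P0)); rewrite -QE QE' !mulrA -exprSr -exprD.
  by congr (_ ^+ _ * _); lia.
have ltk : (k < (totdeg Q).+1)%N.
  by rewrite ltnS (divides_exp_totdeg irrP) //; exists S.
by apply: (@leq_bigmax_cond _ _ (fun j => nat_of_ord j) (Ordinal ltk));
  apply/asboolP; exists S.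
Qed.

Lemma ord_mpolyP P Q : irreducible_mpoly P -> Q != 0 ->
  exists2 S, Q = P ^+ ord_mpoly P Q * S & ~ divides P S.
Proof.
move=> irrP Q0; have ex : exists k, `[< divides (P ^+ k) Q >].
  by exists 0%N; apply/asboolP; exists Q; rewrite expr0 mul1r.
have bnd k : `[< divides (P ^+ k) Q >] -> (k <= totdeg Q)%N.
  by move=> /asboolP; apply: divides_exp_totdeg.
case: (ex_maxnP ex bnd) => k /asboolP[S QE] kmax.
have nPS : ~ divides P S.
  move=> [S' SE]; have /kmax : `[< divides (P ^+ k.+1) Q >].
    by apply/asboolP; exists S'; rewrite exprSr -mulrA -SE.
  by rewrite ltnn.
by exists S => //; rewrite (ord_mpoly_eq irrP Q0 QE nPS).
Qed.

Lemma ord_mpolyM P Q1 Q2 : irreducible_mpoly P -> Q1 != 0 -> Q2 != 0 ->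
  ord_mpoly P (Q1 * Q2) = (ord_mpoly P Q1 + ord_mpoly P Q2)%N.
Proof.
move=> irrP Q10 Q20.
have [S1 E1 n1] := ord_mpolyP irrP Q10; have [S2 E2 n2] := ord_mpolyP irrP Q20.
apply: (@ord_mpoly_eq _ _ (S1 * S2)) => //; first by rewrite mulf_neq0.
  by rewrite {1}E1 {1}E2 exprD mulrACA.
by case: (irreducible_mpoly_prime irrP) => _ _ /[apply] -[].
Qed.

Lemma divides_ord P Q k : irreducible_mpoly P -> Q != 0 ->
  (k <= ord_mpoly P Q)%N <-> divides (P ^+ k) Q.
Proof.
move=> irrP Q0; have P0 : P != 0 by case: irrP.
have [S QE nPS] := ord_mpolyP irrP Q0; split=> [lek|[T QE']].
  by exists (P ^+ (ord_mpoly P Q - k) * S); rewrite mulrA -exprD subnKC.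
rewrite leqNgt; apply/negP => ltk; apply: nPS.
exists (P ^+ (k - (ord_mpoly P Q).+1) * T).
apply: (mulfI (expf_neq0 (ord_mpoly P Q) P0)).
rewrite -QE {1}QE' !mulrA -exprSr -exprD; congr (_ ^+ _ * _); lia.
Qed.

Lemma ord_mpolyD P Q1 Q2 : irreducible_mpoly P ->
    Q1 != 0 -> Q2 != 0 -> Q1 + Q2 != 0 ->
  (minn (ord_mpoly P Q1) (ord_mpoly P Q2) <= ord_mpoly P (Q1 + Q2)%R)%N.
Proof.
move=> irrP Q10 Q20 Q0; apply/(divides_ord _ irrP) => //.
have [S1 E1] := (divides_ord _ irrP Q10).1 (geq_minl _ (ord_mpoly P Q2)).
have [S2 E2] := (divides_ord _ irrP Q20).1 (geq_minr (ord_mpoly P Q1) _).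
by exists (S1 + S2); rewrite mulrDr -E1 -E2.
Qed.

Lemma ord_mpoly_gt0 P Q : irreducible_mpoly P -> Q != 0 ->
  (0 < ord_mpoly P Q)%N <-> divides P Q.
Proof. by move=> irrP Q0; rewrite (divides_ord _ irrP Q0) expr1. Qed.

Lemma ord_mpoly_self P : irreducible_mpoly P -> ord_mpoly P P = 1%N.
Proof.
move=> irrP; have [P0 Pu _] := irrP; apply: (@ord_mpoly_eq _ _ 1) => //.
  by rewrite expr1 mulr1.
by move=> [S /esym PS1]; case/negP: Pu; apply/unitrP; exists S;
  rewrite mulrC PS1.
Qed.

(** Associated irreducible polynomials define the same place, which matters when places are
    counted. *)
Lemma ord_mpoly_assoc P u Q : u \is a GRing.unit ->
  ord_mpoly (P * u) Q = ord_mpoly P Q.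
Proof.
move=> uu; apply: eq_bigl => -[k _] /=; apply/asbool_equiv_eq; split=> -[S ->].
  by exists (u ^+ k * S); rewrite exprMn mulrA.
by exists (u ^- k * S); rewrite exprMn mulrA mulrK // unitrX.
Qed.

End TotalDegree.

(** * Valuations *)

Lemma finite_set_bounded (T : choiceType) (A : set T) N :
  (forall s : seq T, uniq s -> (forall x, x \in s -> A x) -> (size s <= N)%N) ->
  finite_set A.
Proof.
move=> bnd; apply: contrapT => /(infinite_set_fset N.+1)[B BA].
by rewrite ltnNge bnd // => x xB; apply: BA.
Qed.

(** Rational values leave room for ramification, so that a valuation and its extensions agree
    without rescaling. The axioms concern nonzero arguments only, which avoids an infinite value. *)
Definition rval_axiom (L : fieldType) (w : L -> rat) : Prop :=
  (forall x y, x != 0 -> y != 0 -> w (x * y) = w x + w y) /\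
  (forall x y, x != 0 -> y != 0 -> x + y != 0 ->
     Num.min (w x) (w y) <= w (x + y)).

Section RatValued.
Variables (L : fieldType) (w : L -> rat).

(* The value of [w] at 0 is junk: 0 has infinite valuation. *)
Definition val_ge (c : rat) : {pred L} := fun x => (x == 0) || (c <= w x).
Definition val_gt (c : rat) : {pred L} := fun x => (x == 0) || (c < w x).

Hypothesis wP : rval_axiom w.

Lemma rvalM x y : x != 0 -> y != 0 -> w (x * y) = w x + w y.
Proof. by case: wP => + _; apply. Qed.

Lemma rval1 : w 1 = 0.
Proof.
have := rvalM (oner_neq0 L) (oner_neq0 L); rewrite mulr1.
by lra.
Qed.

Lemma rvalV x : x != 0 -> w x^-1 = - w x.
Proof.
move=> x0; apply/eqP; rewrite -addr_eq0 addrC -rvalM ?invr_eq0 //.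
by rewrite divff // rval1.
Qed.

Lemma rvalX x n : x != 0 -> w (x ^+ n) = w x *+ n.
Proof.
move=> x0; elim: n => [|n IH]; first by rewrite expr0 rval1.
by rewrite exprS rvalM ?expf_neq0 // IH mulrS.
Qed.

Lemma rvalN x : w (- x) = w x.
Proof.
have [->|x0] := eqVneq x 0; first by rewrite oppr0.
have n1 : -1 != 0 :> L by rewrite oppr_eq0 oner_eq0.
have : w (-1) + w (-1) = 0 by rewrite -rvalM // mulrNN mulr1 rval1.
by rewrite -(mulN1r x) (rvalM n1 x0) => ?; lra.
Qed.

Lemma val_geN c x : (- x \in val_ge c) = (x \in val_ge c).
Proof. by rewrite !unfold_in /val_ge oppr_eq0 rvalN. Qed.

Lemma val_gtN c x : (- x \in val_gt c) = (x \in val_gt c).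
Proof. by rewrite !unfold_in /val_gt oppr_eq0 rvalN. Qed.

Lemma val_ge0 c : 0 \in val_ge c. Proof. by rewrite unfold_in /val_ge eqxx. Qed.
Lemma val_gt0 c : 0 \in val_gt c. Proof. by rewrite unfold_in /val_gt eqxx. Qed.

Lemma valD_upper (Q : pred rat) x y : (forall a b, Q a -> a <= b -> Q b) ->
  (x == 0) || Q (w x) -> (y == 0) || Q (w y) -> (x + y == 0) || Q (w (x + y)).
Proof.
move=> Qle; have [->|x0] /= := eqVneq x 0; first by rewrite add0r.
have [->|y0] /= := eqVneq y 0; first by rewrite addr0 (negPf x0).
have [//|xy0] /= := eqVneq (x + y) 0 => Qx Qy.
case: wP => _ /(_ x y x0 y0 xy0); apply: Qle.
by rewrite /Num.min; case: ifP.
Qed.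

Lemma val_geD c x y : x \in val_ge c -> y \in val_ge c -> x + y \in val_ge c.
Proof. by apply: valD_upper => a b; apply: le_trans. Qed.

Lemma val_gtD c x y : x \in val_gt c -> y \in val_gt c -> x + y \in val_gt c.
Proof. by apply: valD_upper => a b; apply: lt_le_trans. Qed.

Lemma val_geM c d x y :
  x \in val_ge c -> y \in val_ge d -> x * y \in val_ge (c + d).
Proof.
rewrite !unfold_in /val_ge mulf_eq0.
have [|x0] /= := eqVneq x 0; first by [].
have [|y0] /= := eqVneq y 0; first by [].
by rewrite rvalM //; apply: lerD.
Qed.

Lemma val_gtM c d x y :
  x \in val_gt c -> y \in val_ge d -> x * y \in val_gt (c + d).
Proof.
rewrite !unfold_in /val_ge /val_gt mulf_eq0.
have [|x0] /= := eqVneq x 0; first by [].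
have [|y0] /= := eqVneq y 0; first by [].
by rewrite rvalM //; apply: ltr_leD.
Qed.

Lemma val_gtW c x : x \in val_gt c -> x \in val_ge c.
Proof. by rewrite !unfold_in => /orP[->//|/ltW cx];
  rewrite /val_ge cx orbT. Qed.

Lemma val_ge1 : 1 \in val_ge 0.
Proof. by rewrite unfold_in /val_ge rval1 lexx orbT. Qed.

Lemma val_ge_sum c I (r : seq I) (P : pred I) (f : I -> L) :
  (forall i, P i -> f i \in val_ge c) -> \sum_(i <- r | P i) f i \in val_ge c.
Proof.
by move=> H; elim/big_ind: _ => //; [apply: val_ge0 | apply: val_geD].
Qed.

Lemma val_gt_sum c I (r : seq I) (P : pred I) (f : I -> L) :
  (forall i, P i -> f i \in val_gt c) -> \sum_(i <- r | P i) f i \in val_gt c.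
Proof.
by move=> H; elim/big_ind: _ => //; [apply: val_gt0 | apply: val_gtD].
Qed.

Lemma val_ge0M x y : x \in val_ge 0 -> y \in val_ge 0 -> x * y \in val_ge 0.
Proof. by move=> hx hy; have := val_geM hx hy; rewrite addr0. Qed.

Lemma val_gt0M x y : x \in val_gt 0 -> y \in val_ge 0 -> x * y \in val_gt 0.
Proof. by move=> hx hy; have := val_gtM hx hy; rewrite addr0. Qed.

Lemma val_geX x n : x \in val_ge 0 -> x ^+ n \in val_ge 0.
Proof.
by move=> hx; elim: n => [|n IH]; rewrite ?expr0 ?val_ge1 // exprS val_ge0M.
Qed.

Lemma val_ge_le c d x : d <= c -> x \in val_ge c -> x \in val_ge d.
Proof.
by rewrite !unfold_in => dc /orP[->//|/(le_trans dc) h]; rewrite /val_ge h orbT.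
Qed.

Lemma val_geE c x : x != 0 -> (x \in val_ge c) = (c <= w x).
Proof. by rewrite unfold_in /val_ge => /negPf->. Qed.

Lemma val_gtE c x : x != 0 -> (x \in val_gt c) = (c < w x).
Proof. by rewrite unfold_in /val_gt => /negPf->. Qed.

Lemma rval_dominant x y : x != 0 -> y \in val_gt (w x) ->
  x + y != 0 /\ w (x + y) = w x.
Proof.
move=> x0 hy; have xge : x \in val_ge (w x) by rewrite val_geE.
have h : x + y != 0.
  rewrite addr_eq0; apply/eqP => xE; move: hy.
  by rewrite -val_gtN -xE val_gtE // ltxx.
split=> //; apply/le_anti/andP; split; last first.
  by rewrite -val_geE // val_geD // val_gtW.
rewrite leNgt -val_gtE //; apply/negP => hxy.
have : x \in val_gt (w x).
  have hNy : - y \in val_gt (w x) by rewrite val_gtN.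
  by have := val_gtD hxy hNy; rewrite addrK.
by rewrite val_gtE // ltxx.
Qed.

(** If [z] had negative value, its top power would lie strictly below all other terms of the
    equation. *)
Lemma rval_monic_root (f : {poly L}) z : f \is monic ->
  (forall i, f`_i \in val_ge 0) -> root f z -> z \in val_ge 0.
Proof.
move=> mf fge /rootP; rewrite horner_coef.
have sf : (0 < size f)%N by rewrite size_poly_gt0 monic_neq0.
case sE : (size f) sf => [//|n] _; rewrite big_ord_recr /=.
have -> : f`_n = 1 by move/monicP: mf; rewrite /lead_coef sE.
rewrite mul1r => /eqP; rewrite addrC addr_eq0 => /eqP yn.
have [->|z0] := eqVneq z 0; first exact: val_ge0.
rewrite val_geE // leNgt; apply/negP => wz.
have : z ^+ n \in val_gt (w (z ^+ n)); last first.
  by rewrite val_gtE ?expf_neq0 // ltxx.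
rewrite {1}yn val_gtN val_gt_sum // => i _.
rewrite -[X in val_gt X]add0r mulrC addrC; apply: val_gtM => //.
by rewrite val_gtE ?expf_neq0 // !rvalX // ltr_nMn2l.
Qed.

End RatValued.

Section DiscreteValued.
Variable L : fieldType.
Implicit Types v : dvaluation L.

(** [fine] turns the infinite value at 0 into 0; [val_ge] and [val_gt] treat the argument 0
    apart. *)
Definition rv v (x : L) : rat := (fine (v x))%:~R.

Lemma dval0 v : v 0 = +oo%E.
Proof. by case: v => v [[]]. Qed.

Lemma dval_fine v x : x != 0 -> v x = (fine (v x))%:E.
Proof. by case: v => v [[_ vx] _ _ _] x0 /=; have [m ->] := vx x x0. Qed.

Lemma dvaln0 v x m : v x = m%:E -> x != 0.
Proof. by apply: contra_eq_neq => ->; rewrite dval0. Qed.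

Lemma dval_uniformizer v : exists2 c, c != 0 & v c = 1%:E.
Proof.
have [c vc] : exists c, v c = 1%:E by case: v => ? [].
by exists c => //; apply: dvaln0 vc.
Qed.

Lemma rv_axiom v : rval_axiom (rv v).
Proof.
split=> x y x0 y0.
  rewrite /rv dvalM (dval_fine v x0) (dval_fine v y0) /=.
  by rewrite -intrD.
move=> xy0; have := dvalD v x y.
rewrite (dval_fine v x0) (dval_fine v y0) (dval_fine v xy0) /rv /=.
by rewrite -EFin_min lee_fin !ge_min !ler_int.
Qed.

Lemma rv_ge0 v x : (x \in val_ge (rv v) 0) = (0 <= v x)%E.
Proof.
have [->|x0] := eqVneq x 0; first by rewrite dval0 val_ge0 leey.
by rewrite val_geE // (dval_fine v x0) lee_fin ler0z.
Qed.

Lemma rv_gt0 v x : (x \in val_gt (rv v) 0) = (0 < v x)%E.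
Proof.
have [->|x0] := eqVneq x 0; first by rewrite dval0 val_gt0 lt0y.
by rewrite val_gtE // (dval_fine v x0) lte_fin ltr0z.
Qed.

Lemma dvaluation_of_int (f : L -> int) :
  (forall x y, x != 0 -> y != 0 -> f (x * y) = f x + f y) ->
  (forall x y, x != 0 -> y != 0 -> x + y != 0 ->
     Num.min (f x) (f y) <= f (x + y)) ->
  (exists2 x, x != 0 & f x = 1) ->
  exists v : dvaluation L, forall x, x != 0 -> v x = (f x)%:E.
Proof.
move=> fM fD [z z0 fz]; pose v x := if x == 0 then +oo%E else (f x)%:E.
have vP : dvaluation_axiom v.
  split; rewrite /v.
  - by split=> [|x /negPf->]; [rewrite eqxx | exists (f x)].
  - move=> x y; rewrite mulf_eq0.
    have [|x0] := eqVneq x 0; have [|y0] //= := eqVneq y 0.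
    by rewrite fM.
  - move=> x y; have [->|x0] := eqVneq x 0;
      first by rewrite add0r ge_min lexx orbT.
    have [->|y0] := eqVneq y 0; first by rewrite addr0 (negPf x0) ge_min lexx.
    have [_|xy0] := eqVneq (x + y) 0; first by rewrite leey.
    by rewrite -EFin_min lee_fin fD.
  - by exists z; rewrite (negPf z0) fz.
by exists (DValuation vP) => x /negPf /= x0; rewrite /v x0.
Qed.

Lemma dvaluation_eq v v' : (forall x, x != 0 -> v x = v' x) -> v = v'.
Proof.
move=> h; have : dval v = dval v'.
  apply/funext => x; have [->|x0] := eqVneq x 0; last exact: h.
  by rewrite !dval0.
by case: v v' {h} => v vP [v' v'P] /= e; case: _ / e v'P => v'P;
  rewrite (Prop_irrelevance vP v'P).
Qed.

End DiscreteValued.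

(** * Places of the rational function field *)

Section BasePlaces.
Variables (F K : fieldType) (jF : {rmorphism F -> K}) (n : nat) (X : 'I_n -> K).
Local Notation polyF := (mpoly.mpoly n F).
Local Notation ev := (mpoly.mmap jF X).
Local Notation E := (ratfield jF X).
Implicit Types (P Q : polyF) (v : dvaluation E).

Hypothesis ev_inj : forall Q, ev Q = 0 -> Q = 0.

Lemma ev_neq0 Q : Q != 0 -> ev Q != 0.
Proof. by apply: contra_neq => /ev_inj. Qed.

Lemma evC c : ev (mpoly.mpolyC n c) = jF c.
Proof. exact: mpoly.mmapC. Qed.

Lemma evX i : ev (mpoly.mpolyX F (mpoly.mnm1 i)) = X i.
Proof. by rewrite mpoly.mmapX mpoly.mmap1U. Qed.

Lemma ratfield_ev Q : ev Q \in generated (range jF `|` range X).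
Proof.
rewrite [Q]mpoly.mpolyE rmorph_sum; apply: rpred_sum => m _.
rewrite /= mpoly.mmapZ mpoly.mmapX rpredM //.
  by apply: sub_generated; left; exists (mpoly.mcoeff m Q).
rewrite /mpoly.mmap1 rpred_prod // => i _; apply: rpredX.
by apply: sub_generated; right; exists i.
Qed.

Definition frac_ev Q1 Q2 : E :=
  Subfield (rpred_div (ratfield_ev Q1) (ratfield_ev Q2)).

Lemma ratfield_frac (y : E) : exists Q1 Q2, Q2 != 0 /\ sfval y = ev Q1 / ev Q2.
Proof.
have /asboolP gy := valP y.
pose S := [set z : K | exists Q1 Q2, Q2 != 0 /\ z = ev Q1 / ev Q2].
have sub1 Q : S (ev Q).
  by exists Q, 1; rewrite oner_neq0 rmorph1 divr1.
suff : S (\val y) by [].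
apply: gy => [|z].
  split; first by rewrite -[1](rmorph1 ev); apply: sub1.
  - move=> _ _ [P1 [P2 [P20 ->]]] [Q1 [Q2 [Q20 ->]]].
    exists (P1 * Q2 - Q1 * P2), (P2 * Q2); rewrite mulf_neq0 //; split=> //.
    rewrite rmorphB !rmorphM /=; have := ev_neq0 P20; have := ev_neq0 Q20.
    by move=> ? ?; field; apply/andP.
  - move=> _ _ [P1 [P2 [P20 ->]]] [Q1 [Q2 [Q20 ->]]].
    have [->|Q10] := eqVneq Q1 0.
      exists 0, 1; rewrite oner_neq0 !rmorph0 mul0r invr0 mulr0 mul0r.
      by split.
    exists (P1 * Q2), (P2 * Q1); rewrite mulf_neq0 //; split=> //.
    rewrite !rmorphM /=; have := ev_neq0 P20; have := ev_neq0 Q20.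
    by have := ev_neq0 Q10 => ? ? ?; field; apply/and3P.
move=> [[c _ <-]|[i _ <-]]; first by rewrite -evC.
by rewrite -evX.
Qed.

Lemma ratfield_frac_neq0 (y : E) : y != 0 -> exists Q1 Q2,
  [/\ Q1 != 0, Q2 != 0 & sfval y = ev Q1 / ev Q2].
Proof.
move=> y0; have [Q1 [Q2 [Q20 yQ]]] := ratfield_frac y.
exists Q1, Q2; split=> //; apply: contra_neq y0 => Q10; apply: val_inj.
by rewrite /= yQ Q10 rmorph0 mul0r.
Qed.

(** An order on polynomials passes to fractions; it is well defined by cross-multiplication, since
    [ev] is injective. The multiplicity of an irreducible polynomial and the negated total degree
    are the two instances. *)
Lemma ratfield_valuation (o : polyF -> int) :
  (forall Q1 Q2, Q1 != 0 -> Q2 != 0 -> o (Q1 * Q2) = o Q1 + o Q2) ->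
  (forall Q1 Q2, Q1 != 0 -> Q2 != 0 -> Q1 + Q2 != 0 ->
     Num.min (o Q1) (o Q2) <= o (Q1 + Q2)) ->
  (exists Q1 Q2, [/\ Q1 != 0, Q2 != 0 & o Q1 - o Q2 = 1]) ->
  exists v, forall Q1 Q2 (y : E), Q1 != 0 -> Q2 != 0 ->
    sfval y = ev Q1 / ev Q2 -> v y = (o Q1 - o Q2)%:E.
Proof.
move=> oM oD [U1 [U2 [U10 U20 oU]]].
have [f fP] : exists f : E -> int, forall y Q1 Q2, Q1 != 0 -> Q2 != 0 ->
    sfval y = ev Q1 / ev Q2 -> f y = o Q1 - o Q2.
  pose p (y : E) (m : int) := forall Q1 Q2, Q1 != 0 -> Q2 != 0 ->
    sfval y = ev Q1 / ev Q2 -> m = o Q1 - o Q2.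
  suff /choice[f fP] : forall y, exists m, p y m by exists f.
  move=> y; have [P1 [P2 [P20 yP]]] := ratfield_frac y.
  exists (o P1 - o P2) => Q1 Q2 Q10 Q20 yQ.
  have P10 : P1 != 0.
    apply: contra_neq (ev_neq0 Q10) => P10;
      apply: (mulIf (invr_neq0 (ev_neq0 Q20))).
    by rewrite -yQ yP P10 rmorph0 !mul0r.
  have : P1 * Q2 = Q1 * P2.
    apply/eqP; rewrite -subr_eq0; apply/eqP/ev_inj/eqP.
    rewrite rmorphB !rmorphM /= subr_eq0 -eqr_div ?ev_neq0 //.
    by rewrite -yQ -yP.
  by move=> /(congr1 o); rewrite !oM //; lia.
have [||| v vf] := @dvaluation_of_int E f.
- move=> x y /ratfield_frac_neq0[P1 [P2 [P10 P20 xP]]] /ratfield_frac_neq0[Q1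
    [Q2 [Q10 Q20 yQ]]].
  rewrite (fP _ _ _ P10 P20 xP) (fP _ _ _ Q10 Q20 yQ).
  rewrite (fP _ (P1 * Q1) (P2 * Q2)) ?mulf_neq0 //; first by rewrite !oM //;
    lia.
  by rewrite rmorphM /= xP yQ !rmorphM /= invfM mulrACA.
- move=> x y /ratfield_frac_neq0[P1 [P2 [P10 P20 xP]]] /ratfield_frac_neq0[Q1
    [Q2 [Q10 Q20 yQ]]] xy0.
  rewrite (fP _ _ _ P10 P20 xP) (fP _ _ _ Q10 Q20 yQ).
  have xyE : sfval (x + y) = ev (P1 * Q2 + Q1 * P2) / ev (P2 * Q2).
    rewrite rmorphD /= xP yQ rmorphD !rmorphM /=.
    have := ev_neq0 P20; have := ev_neq0 Q20.
    by move=> ? ?; field; apply/andP.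
  have n0 : P1 * Q2 + Q1 * P2 != 0.
    apply: contra_neq xy0 => z; apply: val_inj.
    by rewrite [LHS]xyE z rmorph0 mul0r.
  rewrite (fP _ _ _ n0 (mulf_neq0 P20 Q20) xyE).
  have := oD _ _ (mulf_neq0 P10 Q20) (mulf_neq0 Q10 P20) n0.
  rewrite !oM // !ge_min; move: (o (_ + _)) (o P1) (o P2) (o Q1) (o Q2).
  by move=> c a1 a2 b1 b2 /orP[?|?]; apply/orP; [left|right]; lia.
- exists (frac_ev U1 U2); last by rewrite (fP (frac_ev U1 U2) _ _ U10 U20).
  rewrite -(inj_eq val_inj) /= mulf_neq0 ?invr_neq0 ?ev_neq0 //.
exists v => Q1 Q2 y Q10 Q20 yQ; rewrite vf ?(fP _ _ _ Q10 Q20 yQ) //.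
by rewrite -(inj_eq val_inj) /= yQ mulf_neq0 ?invr_neq0 ?ev_neq0 //.
Qed.

Lemma vP_exists P : irreducible_mpoly P -> exists v, @is_vP F K jF n X P v.
Proof.
move=> irrP; have P0 : P != 0 by case: irrP.
have [|||v vE] := @ratfield_valuation (fun Q => (ord_mpoly P Q)%:Z).
- by move=> Q1 Q2 Q10 Q20; rewrite ord_mpolyM // PoszD.
- move=> Q1 Q2 Q10 Q20 Q0; have := ord_mpolyD irrP Q10 Q20 Q0.
  by rewrite ge_min !lez_nat geq_min.
- exists P, 1; rewrite P0 oner_neq0 ord_mpoly_self //; split=> //.
  rewrite (@ord_mpoly_eq _ _ P 1 1 0) ?oner_neq0 ?mulr1 ?expr0 //.
  move=> [S /esym PS]; case: irrP => _ /negP + _; apply; apply/unitrP.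
  by exists S; rewrite mulrC PS.
by exists v.
Qed.

Lemma vinfty_exists : (0 < n)%N -> exists v, @is_vinfty F K jF n X v.
Proof.
move=> n0; have [|||v vE] := @ratfield_valuation (fun Q => - (totdeg Q)%:Z).
- by move=> Q1 Q2 Q10 Q20; rewrite totdegM // PoszD opprD.
- move=> Q1 Q2 Q10 Q20 Q0; have := mpoly.mmeasureD_le mpoly.mdeg Q1 Q2.
  rewrite ge_min /totdeg; move: (mpoly.mmeasure _ _) (mpoly.mmeasure _ _).
  by move=> a b; move: (mpoly.mmeasure _ _) => c; lia.
(* The inverse of a variable has value 1; this is where [n] must be positive. *)
- exists 1, (mpoly.mpolyX F (mpoly.mnm1 (Ordinal n0))).
  rewrite oner_neq0 /totdeg mpoly.msize1 mpoly.msizeX mpoly.mdeg1; split=> //.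
  by rewrite -(mpoly.mmeasure_poly_eq0 mpoly.mdeg) mpoly.msizeX.
by exists v => Q1 Q2 y Q10 Q20 yQ; rewrite (vE _ _ _ Q10 Q20 yQ) addrC opprK.
Qed.

(** Write [y] with a denominator of least degree. An irreducible factor of the denominator would
    divide the numerator too, because [y] has no pole there, and could be cancelled. So the
    denominator is constant, and integrality at infinity makes the numerator constant. *)
Lemma base_integral (y : E) : (0 < n)%N ->
  (forall v, base_places v -> (0 <= v y)%E) -> exists c, sfval y = jF c.
Proof.
move=> n0 hv; have [->|y0] := eqVneq y 0; first by exists 0; rewrite rmorph0.
have ex : exists m, `[< exists Q1 Q2, [/\ Q1 != 0, Q2 != 0,
    sfval y = ev Q1 / ev Q2 & totdeg Q2 = m] >].
  have [Q1 [Q2 [Q10 Q20 yQ]]] := ratfield_frac_neq0 y0.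
  by exists (totdeg Q2); apply/asboolP; exists Q1, Q2.
case: (ex_minnP ex) => m /asboolP[Q1 [Q2 [Q10 Q20 yQ mE]]] mmin.
have u2 : Q2 \is a GRing.unit.
  apply: contrapT => /negP nu;
    have [P irrP [S2 Q2E]] := irreducible_factor Q20 nu.
  have P0 : P != 0 by case: irrP.
  have [v vP] := vP_exists irrP.
  have := hv v (or_introl (ex_intro2 _ _ P irrP vP)).
  rewrite (vP _ _ _ Q10 Q20 yQ) lee_fin subr_ge0 lez_nat => le21.
  have /(ord_mpoly_gt0 irrP Q10)[S1 Q1E] : (0 < ord_mpoly P Q1)%N.
    by apply: leq_trans le21; apply/(ord_mpoly_gt0 irrP Q20); exists S2.
  have S10 : S1 != 0 by apply: contra_neq Q10; rewrite Q1E => ->; rewrite mulr0.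
  have S20 : S2 != 0 by apply: contra_neq Q20; rewrite Q2E => ->; rewrite mulr0.
  have : (m <= totdeg S2)%N.
    apply: mmin; apply/asboolP; exists S1, S2; split=> //.
    by rewrite yQ Q1E Q2E !rmorphM /= -mulf_div divff ?ev_neq0 // mul1r.
  rewrite -mE Q2E totdegM //; have := totdeg_irreducible irrP; lia.
have d2 : totdeg Q2 = 0%N by move: u2; rewrite totdeg_unit // => /eqP.
have [v vP] := vinfty_exists n0; have := hv v (or_intror vP).
rewrite (vP _ _ _ Q10 Q20 yQ) lee_fin subr_ge0 lez_nat d2 leqn0 => /eqP d1.
have const (Q : polyF) : totdeg Q = 0%N ->
  Q = mpoly.mpolyC n (mpoly.mcoeff mpoly.mnm0 Q).
  by move=> d; apply: mpoly.msize1_polyC; move: d; rewrite /totdeg;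
    case: (mpoly.mmeasure _ _) => [|[|]].
exists (mpoly.mcoeff mpoly.mnm0 Q1 / mpoly.mcoeff mpoly.mnm0 Q2).
by rewrite yQ (const _ d1) (const _ d2) !evC fmorph_div !mpoly.mcoeffC eqxx
  !mulr1.
Qed.

(** Distinct places come from non-associated irreducible polynomials, so their polynomials divide
    [Q] jointly and are at most [totdeg Q] in number. *)
Lemma finite_dividing_places Q : Q != 0 -> finite_set
  [set v | exists P, [/\ irreducible_mpoly P,
    @is_vP F K jF n X P v & divides P Q]].
Proof.
move=> Q0; apply: (@finite_set_bounded _ _ (totdeg Q)) => s.
elim: s Q Q0 => [//|v s IH] Q Q0 /= /andP[vs us] sP.
have [P [irrP vP [S QE]]] := sP v (mem_head _ _).
have P0 : P != 0 by case: irrP.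
have S0 : S != 0 by apply: contra_neq Q0 => S0; rewrite QE S0 mulr0.
rewrite QE totdegM //.
suff /(IH _ S0 us) : forall v', v' \in s ->
    exists P, [/\ irreducible_mpoly P, is_vP P v' & divides P S].
  move=> les; have := totdeg_irreducible irrP; move: les.
  by move: (totdeg P) (totdeg S) (size s) => a b c; lia.
move=> v' v's; have [|P' [irrP' vP' P'Q]] := sP v';
  first by rewrite inE v's orbT.
exists P'; split=> //; have [_ _ pP'] := irreducible_mpoly_prime irrP'.
have [[u PE]|//] : divides P' P \/ divides P' S by apply: pP'; rewrite -QE.
have uu : u \is a GRing.unit.
  by case: irrP => _ _ /(_ _ _ PE)[|//]; case: irrP' => _ /negP.
case/negP: vs; suff -> : v = v' by [].
apply: dvaluation_eq => y y0.
have [Q1 [Q2 [Q10 Q20 yQ]]] := ratfield_frac_neq0 y0.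
by rewrite (vP _ _ _ Q10 Q20 yQ) (vP' _ _ _ Q10 Q20 yQ) PE !ord_mpoly_assoc.
Qed.

Lemma finite_base_poles (y : E) :
  finite_set [set v | base_places v /\ (v y < 0)%E].
Proof.
have [->|y0] := eqVneq y 0.
  rewrite (_ : [set v | _] = set0) //.
  by apply/seteqP; split=> // v [_]; rewrite dval0.
have [Q1 [Q2 [Q10 Q20 yQ]]] := ratfield_frac_neq0 y0.
have fin : finite_set [set v | @is_vinfty F K jF n X v].
  apply: (@finite_set_bounded _ _ 1) => -[|v1 [|v2 s]] //= /andP[+ _] sP.
  rewrite inE negb_or => /andP[/negP[]]; apply/eqP.
  apply: dvaluation_eq => z z0.
  have [P1 [P2 [P10 P20 zP]]] := ratfield_frac_neq0 z0.
  have v1P := sP v1 (mem_head _ _).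
  have v2P : is_vinfty v2 by apply: sP; rewrite !inE eqxx orbT.
  by rewrite (v1P _ _ _ P10 P20 zP) (v2P _ _ _ P10 P20 zP).
have : finite_set ([set v | @is_vinfty F K jF n X v] `|`
  [set v | exists P, [/\ irreducible_mpoly P,
    @is_vP F K jF n X P v & divides P Q2]]).
  by rewrite finite_setU; split=> //; apply: finite_dividing_places.
apply: sub_finite_set => v [[[P irrP vP]|?] vy]; last by left.
right; exists P; split=> //; apply/ord_mpoly_gt0 => //.
by move: vy; rewrite (vP _ _ _ Q10 Q20 yQ) lte_fin; lia.
Qed.

(** Every candidate for the chosen value is positive, and a base place has a candidate, so the
    default 0 is not taken. *)
Lemma base_degree_gt0 v : base_places v -> 0 < base_degree v.
Proof.
rewrite /base_degree => bv; case: xgetP => [d _|].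
  by move=> [[P [irrP _ ->]]|[_ ->] //]; rewrite ltr0n totdeg_irreducible.
move=> /= no; exfalso; case: bv => [[P irrP vP]|vi].
  by apply: (no (totdeg P)%:R); left; exists P.
by apply: (no 1); right.
Qed.

End BasePlaces.

(** * Extension of valuations to algebraic extensions *)

Definition integral_at (E L : fieldType) (iota : {rmorphism E -> L})
    (v : dvaluation E) (y : L) : Prop :=
  exists g : {poly E}, [/\ g \is monic, forall i, g`_i \in val_ge (rv v) 0 &
    root (map_poly iota g) y].

Section ExtensionOfValuations.
Variables (E L : fieldType) (iota : {rmorphism E -> L}) (v : dvaluation E).
Hypothesis algL : forall y, algebraicOver iota y.
Variable y0 : L.
Hypothesis nint : ~ integral_at iota v y0.

Definition subring_set (B : set L) :=
  [/\ B 1, forall x y, B x -> B y -> B (x - y) &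
      forall x y, B x -> B y -> B (x * y)].

(** In such a ring [y0^-1] is a nonunit. A maximal one turns out to be a valuation ring, and its
    valuation has a pole at [y0]; this is Chevalley's construction. *)
Definition avoiding (B : set L) :=
  [/\ subring_set B, forall c, c \in val_ge (rv v) 0 -> B (iota c),
      B y0^-1 & ~ B y0].

Lemma subring0 B : subring_set B -> B 0.
Proof. by case=> B1 BB _; rewrite -(subrr 1); apply: BB. Qed.

Lemma subringN B x : subring_set B -> B x -> B (- x).
Proof.
by move=> sB Bx; rewrite -sub0r; case: (sB) => _ + _; apply=> //;
  apply: subring0.
Qed.

Lemma subringD B x y : subring_set B -> B x -> B y -> B (x + y).
Proof.
move=> sB Bx By; rewrite -[y]opprK; case: (sB) => _ + _; apply=> //.
exact: subringN.
Qed.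

Lemma subringX B x n : subring_set B -> B x -> B (x ^+ n).
Proof.
move=> [B1 _ BM] Bx; elim: n => [|n IH]; first by rewrite expr0.
by rewrite exprS; apply: BM.
Qed.

Lemma subring_sum B I (r : seq I) (P : pred I) (f : I -> L) : subring_set B ->
  (forall i, P i -> B (f i)) -> B (\sum_(i <- r | P i) f i).
Proof.
move=> sB h; elim/big_ind: _ => //; first exact: subring0.
by move=> x y; apply: subringD.
Qed.

Definition adjoin (B : set L) (u : L) : set L :=
  [set z | exists2 h : {poly L}, forall i, B h`_i & z = h.[u]].

Lemma adjoin_subring B u : subring_set B -> subring_set (adjoin B u).
Proof.
move=> sB; have [B1 BB BM] := sB; split.
- exists 1; last by rewrite hornerC.
  by move=> i; rewrite coef1; case: eqP => _ //; apply: subring0.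
- move=> _ _ [h Bh ->] [g Bg ->]; exists (h - g);
    last by rewrite hornerD hornerN.
  by move=> i; rewrite coefB; apply: BB.
- move=> _ _ [h Bh ->] [g Bg ->]; exists (h * g); last by rewrite hornerM.
  by move=> i; rewrite coefM; apply: subring_sum => // j _; apply: BM.
Qed.

Lemma adjoin_sub B u x : subring_set B -> B x -> adjoin B u x.
Proof.
move=> sB Bx; exists x%:P; last by rewrite hornerC.
by move=> i; rewrite coefC; case: eqP => _ //; apply: subring0.
Qed.

Lemma adjoin_mem B u : subring_set B -> adjoin B u u.
Proof.
move=> sB; exists 'X; last by rewrite hornerX.
by move=> i; rewrite coefX; case: eqP => _; [case: sB | apply: subring0].
Qed.

Lemma y0_neq0 : y0 != 0.
Proof.
apply: contra_notN nint => /eqP ->; exists 'X; split.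
- exact: monicX.
- move=> i; rewrite coefX; case: eqP => _; first exact: val_ge1 (rv_axiom v).
  exact: val_ge0.
- by rewrite map_polyX rootX.
Qed.

Lemma subring_integers : subring_set (iota @` [set c | c \in val_ge (rv v) 0]).
Proof.
have vP := rv_axiom v; split.
- by exists 1; rewrite ?rmorph1 //; apply: val_ge1.
- move=> _ _ [a a0 <-] [b b0 <-]; exists (a - b); rewrite ?rmorphB //=.
  by rewrite val_geD // val_geN.
- move=> _ _ [a a0 <-] [b b0 <-]; exists (a * b); rewrite ?rmorphM //=.
  exact: val_ge0M.
Qed.

(** If [y0] were a polynomial in [y0^-1] with integral coefficients, multiplication by a power of
    [y0] would give a monic equation with the same coefficients in reverse order, and [y0] would be
    integral. *)
Lemma avoiding_adjoin :
  avoiding (adjoin (iota @` [set c | c \in val_ge (rv v) 0]) y0^-1).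
Proof.
have sO := subring_integers; have vP := rv_axiom v; split.
- exact: adjoin_subring.
- by move=> c c0; apply: adjoin_sub => //; exists c.
- exact: adjoin_mem.
move=> [h Oh y0E]; apply: nint.
have /choice[c cP] : forall i, exists c, c \in val_ge (rv v) 0 /\ iota c = h`_i.
  by move=> i; have [c] := Oh i; exists c.
pose n := size h.
pose g : {poly E} := 'X^(n.+1) - \poly_(i < n.+1) c (n - i)%N.
have sg : (size (\poly_(i < n.+1) c (n - i)%N) < size ('X^(n.+1) : {poly E}))%N.
  by rewrite size_polyXn ltnS size_poly.
exists g; split.
- by rewrite monicE /g lead_coefDl ?size_polyN // lead_coefXn.
- move=> i; rewrite /g coefB coefXn coef_poly val_geD //.
    by case: eqP => _; [apply: val_ge1 | apply: val_ge0].
  rewrite val_geN //; case: ltnP => _; last exact: val_ge0.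
  by case: (cP (n - i)%N).
rewrite /root /g rmorphB /= map_polyXn hornerD hornerN hornerXn subr_eq0.
rewrite (horner_coef_wide (n := n.+1)); last first.
  by rewrite size_map_poly size_poly.
rewrite exprS {1}y0E (horner_coef_wide _ (leqnSn n)) mulr_suml.
rewrite (reindex_inj rev_ord_inj) /=; apply/eqP; apply: eq_bigr => i _.
rewrite coef_map coef_poly ltn_ord /= subSS; case: (cP (n - i)%N) => _ ->.
rewrite -mulrA; congr (_ * _); rewrite exprVn.
have lei : (i <= n)%N by rewrite -ltnS.
by rewrite -{2}(subKn lei) [in RHS]expfB_cond ?(negPf y0_neq0) ?leq_subr //=
  mulrC.
Qed.

Lemma exists_maximal_avoiding : exists2 A, avoiding A &
  forall B, avoiding B -> A `<=` B -> B `<=` A.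
Proof.
have [|A [PA maxA]] := @Zorn_bigcup L (fun B => B = set0 \/ avoiding B).
  move=> C CP Ctot; have [allset0|] := pselect (forall B, C B -> B = set0).
    by left; apply/seteqP; split=> // x [B /allset0 ->].
  move=> /existsNP[B0 /not_implyP[CB0 B0n]]; right.
  have av B x : C B -> B x -> avoiding B.
    by move=> CB Bx; case: (CP B CB) => // B0'; rewrite B0' in Bx.
  have avB0 : avoiding B0 by case: (CP B0 CB0).
  have two x y : (\bigcup_(B in C) B) x -> (\bigcup_(B in C) B) y ->
      exists B, [/\ C B, avoiding B, B x & B y].
    move=> [B1 C1 B1x] [B2 C2 B2y]; have [s12|s21] := Ctot _ _ C1 C2.
      by exists B2; split=> //; [apply: av C2 B2y | apply: s12].
    by exists B1; split=> //; [apply: av C1 B1x | apply: s21].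
  case: (avB0) => -[B01 _ _] O0 z0 _; split.
  - split; first by exists B0.
    + move=> x y /two /[apply] -[B [CB [[_ BB _] _ _ _] Bx By]].
      by exists B => //; apply: BB.
    + move=> x y /two /[apply] -[B [CB [[_ _ BM] _ _ _] Bx By]].
      by exists B => //; apply: BM.
  - by move=> c c0; exists B0 => //; apply: O0.
  - by exists B0.
  - by move=> [B CB By0]; have [_ _ _] := av _ _ CB By0; apply.
have avA : avoiding A.
  case: PA => // A0; exfalso; apply: (maxA _ _ (or_intror avoiding_adjoin)).
  rewrite A0; split=> // h; have [[h1 _ _] _ _ _] := avoiding_adjoin.
  exact: h h1.
exists A => // B avB AB; apply: contrapT => nBA.
by apply: (maxA B) (or_intror avB).
Qed.

Section MaximalRing.
Variable A : set L.
Hypotheses (avA : avoiding A)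
  (maxA : forall B, avoiding B -> A `<=` B -> B `<=` A).

Let sA : subring_set A. Proof. by case: avA. Qed.
Let A1 : A 1. Proof. by case: sA. Qed.
Let AB x y : A x -> A y -> A (x - y). Proof. by case: sA => _ + _; apply. Qed.
Let AM x y : A x -> A y -> A (x * y). Proof. by case: sA => _ _; apply. Qed.
Let Az : A y0^-1. Proof. by case: avA. Qed.
Let Ny0 : ~ A y0. Proof. by case: avA. Qed.

Lemma maximal_adjoin u : ~ A u -> adjoin A u y0.
Proof.
move=> nAu; apply: contrapT => ny; apply: nAu.
have : adjoin A u `<=` A; last by apply; apply: adjoin_mem.
apply: maxA; last by move=> x; apply: adjoin_sub.
split=> //; first exact: adjoin_subring.
- by move=> c c0; apply: adjoin_sub => //; case: avA => _ + _ _; apply.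
- exact: adjoin_sub.
Qed.

(** Let e be the element to invert. If its inverse is outside [A], then [y0] is a polynomial in that
    inverse; multiplied by a power of e this lies in [A]. That power of e is itself 1 minus a
    multiple of [y0^-1], so [y0] would lie in [A]. *)
Lemma maximal_unit a : A a -> A (1 - y0^-1 * a)^-1.
Proof.
move=> Aa; apply: contrapT => /maximal_adjoin[h Ah y0E].
have y00 := y0_neq0.
have e0 : 1 - y0^-1 * a != 0.
  apply/negP => /eqP/subr0_eq E1; apply: Ny0.
  by rewrite -[y0]mulr1 E1 mulrA divff // mul1r.
set e := 1 - y0^-1 * a in e0 y0E.
have Ae : A e by apply: AB => //; apply: AM.
have [b Ab eb] : exists2 b, A b & e ^+ size h = 1 - y0^-1 * b.
  elim: (size h) => [|n [b Ab bE]].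
    by exists 0; [apply: subring0 | rewrite mulr0 subr0].
  exists (a + b - y0^-1 * a * b).
    by apply: AB; [apply: subringD | do ?apply: AM].
  by rewrite exprS bE /e; ring.
apply: Ny0; have -> : y0 = y0 * e ^+ size h + b.
  by rewrite eb mulrBr mulr1 mulrA divff // mul1r subrK.
apply: subringD => //; rewrite {1}y0E horner_coef mulr_suml.
apply: subring_sum => // i _; rewrite -mulrA; apply: AM => //.
have : (i <= size h)%N by apply: ltnW.
move: (size h) (nat_of_ord i) => n {i}i lei.
rewrite exprVn -(subnK lei) exprD mulrCA mulVf ?expf_neq0 // mulr1.
exact: subringX.
Qed.

Definition representable u n := exists2 h : nat -> L,
  forall i, A (h i) & y0 = \sum_(i < n) h i * u ^+ i.

(** By [maximal_unit] the constant term can be removed from the expression of [y0] in [u^-1]. The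
    resulting relation rewrites the top term of the expression in [u] through lower powers. *)
Lemma representable_reduce u n m : u != 0 -> representable u n.+1 ->
  representable u^-1 m -> (m <= n.+1)%N -> representable u n.
Proof.
move=> u0 [h Ah hE] [k Ak kE] lemn; have y00 := y0_neq0.
case: m => [|m] in kE lemn *.
  by rewrite big_ord0 in kE; rewrite kE eqxx in y00.
pose e := (1 - y0^-1 * k 0%N)^-1; have Ae : A e by apply: maximal_unit.
have e0 : 1 - y0^-1 * k 0%N != 0.
  apply/negP => /eqP/subr0_eq E1; apply: Ny0.
  by rewrite -[y0]mulr1 E1 mulrA divff // mul1r.
have y0E : y0 = \sum_(i < m) e * k i.+1 * u ^- i.+1.
  have : y0 * (1 - y0^-1 * k 0%N) = \sum_(i < m) k i.+1 * u ^- i.+1.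
    rewrite mulrBr mulr1 mulrA divff // mul1r {1}kE big_ord_recl expr0 mulr1.
    by rewrite addrC addKr; apply: eq_bigr => i _; rewrite exprVn.
  move/(canRL (mulfK e0)) ->; rewrite mulrC mulr_sumr.
  by apply: eq_bigr => i _; rewrite mulrA.
(* The top term is multiplied by [y0^-1 * y0], and the second factor is expanded in negative powers
   of [u]; only exponents from 0 to [n - 1] remain, because [m] is at most [n] here. *)
have top : h n * u ^+ n = \sum_(i < m) y0^-1 * h n * e * k i.+1 * u ^+ (n -
  i.+1).
  transitivity (y0^-1 * (h n * u ^+ n) * y0).
    by rewrite mulrAC mulVf // mul1r.
  rewrite {2}y0E mulr_sumr; apply: eq_bigr => i _.
  have : (i.+1 <= n)%N by apply: leq_trans (ltn_ord i) _.
  move: (nat_of_ord i) => {i}i lei.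
  have -> : u ^+ n = u ^+ (n - i.+1) * u ^+ i.+1 by rewrite -exprD subnK.
  have ui0 : u ^+ i.+1 != 0 by rewrite expf_neq0.
  move: (u ^+ i.+1) (u ^+ (n - i.+1)) ui0 => a b a0.
  by field; rewrite ?a0 ?y00.
pose c (j : nat) := h j + \sum_(i < m | (n - i.+1)%N == j) y0^-1 * h n * e * k
  i.+1.
exists c.
  move=> j; apply: subringD => //; apply: subring_sum => // i _.
  by do ?apply: AM.
rewrite hE big_ord_recr /= top.
have -> : \sum_(i < n) c i * u ^+ i = \sum_(i < n) h i * u ^+ i +
   \sum_(i < n) \sum_(j < m | (n - j.+1)%N == i) y0^-1 * h n * e * k j.+1 * u ^+
     i.
  by rewrite -big_split /=; apply: eq_bigr => i _; rewrite mulrDl mulr_suml.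
congr (_ + _); rewrite (exchange_big_dep predT) //=; apply: eq_bigr => j _.
have ltj : (n - j.+1 < n)%N.
  have := ltn_ord j; have := lemn; lia.
by rewrite (big_pred1 (Ordinal ltj)) //= => i; rewrite -val_eqE eq_sym.
Qed.

(** Descent on the total length: the longer of the two expressions is shortened, with [u] and [u^-1]
    in symmetric roles. *)
Lemma not_representable u n m : u != 0 -> representable u n ->
  representable u^-1 m -> False.
Proof.
move: {2}(n + m)%N (leqnn (n + m)) => N.
elim: N u n m => [|N IH] u n m.
  rewrite leqn0 addn_eq0 => /andP[/eqP-> _] _ [h _]; rewrite big_ord0 => y00.
  by have := y0_neq0; rewrite y00 eqxx.
move=> le u0 rn rm; have u0' : u^-1 != 0 by rewrite invr_eq0.
have [lemn|ltnm] := leqP m n.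
  case: n => [|n] in le rn lemn *.
    case: rn => h _; rewrite big_ord0 => y00.
    by have := y0_neq0; rewrite y00 eqxx.
  by apply: (IH u n m) => //; apply: representable_reduce rm _.
case: m => [//|m] in le rm ltnm *.
apply: (IH u n m) => //; first by rewrite -ltnS -addnS.
by apply: (@representable_reduce u^-1 m n) => //; [rewrite invrK | apply: ltnW].
Qed.

Lemma maximal_valuation_ring u : u != 0 -> A u \/ A u^-1.
Proof.
move=> u0; have [|nu] := pselect (A u); first by left.
have [|nv] := pselect (A u^-1); first by right.
have rep z : adjoin A z y0 -> exists n, representable z n.
  move=> [h Ah y0E]; exists (size h), (fun i => h`_i) => //.
  by rewrite {1}y0E horner_coef.
have [n rn] := rep _ (maximal_adjoin nu);
  have [m rm] := rep _ (maximal_adjoin nv).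
by case: (not_representable u0 rn rm).
Qed.

End MaximalRing.
End ExtensionOfValuations.

(** A monic equation of [u^-1], multiplied by a power of [u], expresses [u^-1] as a polynomial in
    [u] over the base field. *)
Lemma subring_inv (E L : fieldType) (iota : {rmorphism E -> L}) (B : set L) u :
  subring_set B -> (forall c,
    B (iota c)) -> B u -> algebraicOver iota u -> B u^-1.
Proof.
move=> sB BE Bu /algebraic_inv/integral_algebraic[f mf /rootP].
have [->|u0] := eqVneq u 0; first by rewrite invr0 => _; apply: subring0.
have [_ _ BM] := sB; rewrite horner_coef size_map_poly.
have sf : (0 < size f)%N by rewrite size_poly_gt0 monic_neq0.
case sE : (size f) sf => [//|n] _; rewrite big_ord_recr /= coef_map /=.
have -> : f`_n = 1 by move/monicP: mf; rewrite /lead_coef sE.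
rewrite rmorph1 mul1r => /eqP; rewrite addrC addr_eq0 => /eqP yn.
case: n => [|n] in sE yn *.
  by rewrite big_ord0 oppr0 expr0 in yn; move/eqP: yn; rewrite oner_eq0.
have -> : u^-1 = u^-1 ^+ n.+1 * u ^+ n.
  by rewrite exprVn exprS invfM -mulrA mulVf ?expf_neq0 // mulr1.
rewrite yn mulNr; apply: subringN => //; rewrite mulr_suml.
apply: subring_sum => // i _; rewrite coef_map /= -mulrA; apply: BM => //.
have : (i <= n)%N by rewrite -ltnS.
move: (nat_of_ord i) => {i}i lei; rewrite exprVn -(subnK lei) exprD.
by rewrite mulrCA mulVf ?expf_neq0 // mulr1; apply: subringX.
Qed.

(** * From a valuation ring to a rational-valued valuation *)

Section ValuationOfRing.
Variables (E L : fieldType) (iota : {rmorphism E -> L}) (v : dvaluation E).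
Hypothesis algL : forall y, algebraicOver iota y.
Variable y0 : L.
Hypothesis y00 : y0 != 0.
Variable A : set L.
Hypotheses (avA : avoiding iota v y0 A)
  (valA : forall u, u != 0 -> A u \/ A u^-1).

Let sA : subring_set A. Proof. by case: avA. Qed.
Let A1 : A 1. Proof. by case: sA. Qed.
Let AB x y : A x -> A y -> A (x - y). Proof. by case: sA => _ + _; apply. Qed.
Let AM x y : A x -> A y -> A (x * y). Proof. by case: sA => _ _; apply. Qed.
Let AX x n : A x -> A (x ^+ n). Proof. exact: subringX. Qed.
Let Az : A y0^-1. Proof. by case: avA. Qed.
Let Ny0 : ~ A y0. Proof. by case: avA. Qed.
Let AO c : c \in val_ge (rv v) 0 -> A (iota c).
Proof. by case: avA => _ + _ _; apply. Qed.
Let vP := rv_axiom v.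

Definition ring_unit x := x != 0 /\ A x /\ A x^-1.

Lemma ring_unit1 : ring_unit 1.
Proof. by rewrite /ring_unit invr1 oner_neq0. Qed.

Lemma ring_unitM x y : ring_unit x -> ring_unit y -> ring_unit (x * y).
Proof.
move=> [x0 [Ax Ax']] [yn0 [Ay Ay']]; split; first by rewrite mulf_neq0.
by rewrite invfM; split; apply: AM.
Qed.

Lemma ring_unitV x : ring_unit x -> ring_unit x^-1.
Proof. by move=> [x0 [Ax Ax']]; rewrite /ring_unit invrK invr_eq0. Qed.

Lemma ring_unitX x n : ring_unit x -> ring_unit (x ^+ n).
Proof.
move=> ux; elim: n => [|n IH]; first by rewrite expr0; apply: ring_unit1.
by rewrite exprS; apply: ring_unitM.
Qed.

Lemma ring_unitXz x (n : int) : ring_unit x -> ring_unit (x ^ n).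
Proof.
by move=> ux; case: n => n; [|apply: ring_unitV]; apply: ring_unitX.
Qed.

Variable c0 : E.
Hypotheses (c00 : c0 != 0) (vc0 : v c0 = 1%:E).
Local Notation pi := (iota c0).

Let pi0 : pi != 0. Proof. by rewrite fmorph_eq0. Qed.

Let rvc0 : rv v c0 = 1. Proof. by rewrite /rv vc0. Qed.

Lemma rvXz (c : E) (n : int) : c != 0 -> rv v (c ^ n) = rv v c * n%:~R.
Proof.
move=> c_0; case: n => n.
  by rewrite -exprnP rvalX // -mulr_natr.
rewrite NegzE -exprnN rvalV ?expf_neq0 // rvalX //.
by rewrite -mulr_natr mulrNz mulrN.
Qed.

Lemma unit_times_uniformizer (c : E) : c != 0 ->
  ring_unit (iota c / pi ^ (fine (v c))).
Proof.
move=> c_0; have n0 : c / c0 ^ fine (v c) !=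
  0 by rewrite mulf_neq0 ?invr_neq0 ?expfz_neq0.
have val0 : rv v (c / c0 ^ fine (v c)) = 0.
  by rewrite rvalM ?invr_neq0 ?expfz_neq0 // rvalV ?expfz_neq0 // rvXz // rvc0
    mul1r subrr.
rewrite -rmorphXz ?unitfE //= -fmorph_div; split; first by rewrite fmorph_eq0.
split; first by apply: AO; rewrite val_geE // val0.
by rewrite -fmorphV; apply: AO;
  rewrite val_geE ?invr_neq0 // rvalV // val0 oppr0.
Qed.

(** Otherwise [A] contains the whole base field, hence the inverse of each of its algebraic
    elements, and in particular [y0]. *)
Lemma uniformizer_nonunit : ~ A pi^-1.
Proof.
move=> Api'; have Api : A pi by apply: AO; rewrite val_geE // rvc0.
have upi : ring_unit pi by [].
have AE c : A (iota c).
  have [->|c_0] := eqVneq c 0; first by rewrite rmorph0; apply: subring0.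
  rewrite -[iota c](divfK (expfz_neq0 (fine (v c)) pi0)).
  have [_ [? _]] := unit_times_uniformizer c_0.
  by have [_ [? _]] := ring_unitXz (fine (v c)) upi; apply: AM.
apply: Ny0; rewrite -[y0]invrK; apply: (subring_inv sA AE Az).
exact: algebraic_inv.
Qed.

Lemma unit_uniformizerXz (k : int) : A (pi ^ k) -> 0 <= k.
Proof.
case: k => [//|k]; rewrite NegzE -exprnN => h; case: uniformizer_nonunit.
have Api : A pi by apply: AO; rewrite val_geE // rvc0.
have -> : pi^-1 = (pi ^+ k.+1)^-1 * pi ^+ k.
  by rewrite exprS invfM -mulrA mulVf ?expf_neq0 // mulr1.
by apply: AM => //; apply: AX.
Qed.

(** Expresses that the value of [x] is [k / m] times that of the uniformizer, before any value group
    is available. *)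
Definition commensurable x (m : nat) (k : int) :=
  (0 < m)%N /\ ring_unit (x ^+ m / pi ^ k).

Lemma commensurable_unique x m k m' k' : x != 0 ->
  commensurable x m k -> commensurable x m' k' ->
  k%:~R / m%:R = k'%:~R / m'%:R :> rat.
Proof.
move=> x0 [m0 um] [m0' um'].
have m1 : (m%:R : rat) != 0 by rewrite pnatr_eq0 -lt0n.
have m1' : (m'%:R : rat) != 0 by rewrite pnatr_eq0 -lt0n.
have [_ [h1 h2]] : ring_unit (pi ^ (k' * m%:Z - k * m'%:Z)).
  have -> : pi ^ (k' * m%:Z - k * m'%:Z) =
      (x ^+ m / pi ^ k) ^+ m' / (x ^+ m' / pi ^ k') ^+ m.
    have -> : (x ^+ m / pi ^ k) ^+ m' = x ^+ (m * m') / pi ^ (k * m'%:Z).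
      by rewrite exprMn exprVn -exprM -exprz_exp.
    have -> : (x ^+ m' / pi ^ k') ^+ m = x ^+ (m * m') / pi ^ (k' * m%:Z).
      by rewrite exprMn exprVn -exprM mulnC -exprz_exp.
    rewrite expfzDr // -invr_expz.
    have := expf_neq0 (m * m') x0; have := expfz_neq0 (k * m'%:Z) pi0.
    have := expfz_neq0 (k' * m%:Z) pi0.
    move: (x ^+ (m * m')) (pi ^ (k * m'%:Z)) (pi ^ (k' * m%:Z)) => a b c *.
    by field; apply/and3P.
  by apply: ring_unitM; [|apply: ring_unitV]; apply: ring_unitX.
have := unit_uniformizerXz h1; rewrite invr_expz in h2.
have := unit_uniformizerXz h2 => a b.
have kE : k * m'%:Z = k' * m%:Z by lia.
by apply/eqP; rewrite eqr_div // -!(intrM _ _ m'%:Z) ?pmulrn -!intrM kE.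
Qed.

Lemma nonunit_1D u : A u -> ~ ring_unit u -> ring_unit (1 + u).
Proof.
move=> Au nu; have [->|u0] := eqVneq u 0; first by rewrite addr0;
  apply: ring_unit1.
have nu' : ~ A u^-1 by move=> Au'; apply: nu.
have Au1 : A (1 + u) by apply: subringD.
have u10 : 1 + u != 0.
  apply: contra_notN nu' => /eqP/(canRL (addKr 1)); rewrite addr0 => ->.
  by rewrite invrN invr1; apply: subringN.
do 2!split=> //.
have q0 : u / (1 + u) != 0 by rewrite mulf_neq0 ?invr_eq0.
have [h|h] := valA q0.
  have -> : (1 + u)^-1 = 1 - u / (1 + u) by field; rewrite u10.
  exact: AB.
case: nu'; have -> : u^-1 = (u / (1 + u))^-1 - 1 by field; rewrite u0 u10.
exact: AB.
Qed.

(** The rule that a sum of terms with distinct values has the value of one of them, phrased with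
    units of the ring because no valuation exists yet. *)
Lemma unit_sum (g : nat -> L) n :
    (forall i j, (i < j < n)%N -> g i != 0 -> g j != 0 ->
      ~ ring_unit (g i / g j)) ->
  (forall i, (i < n)%N -> g i = 0) \/
  (exists i, [/\ (i < n)%N, g i != 0 & ring_unit (\sum_(j < n) g j / g i)]).
Proof.
elim: n => [|n IH] H; first by left.
have [|all0|[i [ltin gi0 us]]] := IH.
- move=> i j /andP[ltij ltjn]; apply: H; rewrite ltij /=; exact: leqW.
- have [gn0|gn0] := eqVneq (g n) 0.
    by left=> i; rewrite ltnS leq_eqVlt => /predU1P[->|/all0].
  right; exists n; split=> //; rewrite big_ord_recr /= divff // big1.
    by rewrite add0r; apply: ring_unit1.
  by move=> i _; rewrite all0 ?mul0r.
right; rewrite -mulr_suml in us; have s0 : \sum_(j < n) g j != 0.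
  by case: us => + _; rewrite mulf_eq0 negb_or => /andP[].
have [gn0|gn0] := eqVneq (g n) 0.
  exists i; rewrite big_ord_recr /= gn0 mul0r addr0 -mulr_suml; split=> //.
  exact: leqW.
have nu : ~ ring_unit (g i / g n) by apply: H => //; rewrite ltin /=.
have e0 : g i / g n != 0 by rewrite mulf_neq0 ?invr_eq0.
have [An|An] := valA e0.
  exists n; split=> //; rewrite big_ord_recr /= divff // -mulr_suml addrC.
  apply: nonunit_1D.
    have -> : (\sum_(j < n) g j) / g n = (\sum_(j < n) g j) / g i * (g i / g n).
      by rewrite mulrA divfK.
    by case: us => _ [As _]; apply: AM.
  move=> u2; apply: nu.
  have -> : g i / g n = (\sum_(j < n) g j / g n) / (\sum_(j < n) g j / g i).
    by rewrite -!mulr_suml; field; rewrite gi0 gn0 s0.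
  by apply: ring_unitM; [rewrite -mulr_suml | rewrite -mulr_suml;
    apply: ring_unitV].
exists i; split=> //; first exact: leqW.
rewrite big_ord_recr /= -mulr_suml.
have -> : (\sum_(j < n) g j) / g i + g n / g i =
    (\sum_(j < n) g j) / g i * (1 + g n / g i / ((\sum_(j < n) g j) / g i)).
  by field; rewrite gi0 s0.
apply: ring_unitM => //; apply: nonunit_1D.
  by case: us => _ [_ As]; apply: AM => //; rewrite -invf_div.
move=> u2; apply: nu; have := ring_unitV (ring_unitM u2 us).
by rewrite divfK ?invf_div //; case: us.
Qed.

(** The terms of an algebraic equation of [x] add up to 0, so by [unit_sum] two of them differ by a
    unit. This compares a power of [x] with an element of the base field, hence with a power of the
    uniformizer. *)
Lemma commensurable_exists x : x != 0 -> exists m k, commensurable x m k.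
Proof.
move=> x0; have [f f0 /rootP fx] := algL x.
have [i [j [ltij fi0 fj0 u]]] : exists i j, [/\ (i < j)%N, f`_i != 0,
  f`_j != 0 &
    ring_unit (iota f`_i * x ^+ i / (iota f`_j * x ^+ j))].
  apply: contrapT => nex; pose g i := iota f`_i * x ^+ i.
  have g0 i : (g i == 0) = (f`_i == 0).
    by rewrite mulf_eq0 fmorph_eq0 expf_eq0 (negPf x0) andbF orbF.
  have [|all0|[i [lti gi0]]] := @unit_sum g (size f).
  - move=> i j /andP[ltij _]; rewrite !g0 => fi0 fj0 u.
    by apply: nex; exists i, j.
  - have sf : ((size f).-1 < size f)%N by rewrite ltn_predL size_poly_gt0.
    by move/eqP: (all0 _ sf); rewrite g0 -/(lead_coef f) lead_coef_eq0 (negPf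
      f0).
  rewrite -mulr_suml (_ : \sum_(j < size f) g j = 0);
    first by rewrite mul0r => -[/eqP].
  rewrite -[RHS]fx horner_coef size_map_poly; apply: eq_bigr => k _.
  by rewrite coef_map.
pose c := f`_j / f`_i; have c_0 : c != 0 by rewrite mulf_neq0 ?invr_eq0.
exists (j - i)%N, (- fine (v c)); split; first by rewrite subn_gt0.
have := ring_unitV (ring_unitM u (unit_times_uniformizer c_0)).
congr ring_unit; rewrite /c fmorph_div -invr_expz invrK.
have -> : x ^+ j = x ^+ (j - i) * x ^+ i by rewrite -exprD subnK // ltnW.
have := expf_neq0 i x0; have := expf_neq0 (j - i) x0.
have fi1 : iota f`_i != 0 by rewrite fmorph_eq0.
have fj1 : iota f`_j != 0 by rewrite fmorph_eq0.
have := expfz_neq0 (fine (v (f`_j / f`_i))) pi0.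
move: (pi ^ _) (x ^+ _) (x ^+ _) => a b d a0 b0 d0.
by field; rewrite a0 b0 d0 fi1 fj1 oner_neq0.
Qed.

Lemma valuation_of_ring : exists w : L -> rat, [/\ rval_axiom w,
  forall c, c != 0 -> w (iota c) = rv v c & forall x,
    x != 0 -> 0 <= w x -> A x].
Proof.
have [w wP] : exists w : L -> rat, forall x, x != 0 ->
    forall m k, commensurable x m k -> w x = k%:~R / m%:R.
  pose p (x : L) (a : rat) := x != 0 -> forall m k,
    commensurable x m k -> a = k%:~R / m%:R.
  suff /choice[w wp] : forall x, exists a, p x a by exists w.
  move=> x; have [x0|x0] := eqVneq x 0; first by exists 0; rewrite /p x0 eqxx.
  have [m [k mk]] := commensurable_exists x0;
    exists (k%:~R / m%:R) => _ m' k' mk'.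
  exact: commensurable_unique mk mk'.
have nat0 (m : nat) : (0 < m)%N -> (m%:R : rat) != 0 by rewrite pnatr_eq0 lt0n.
have wge x : x != 0 -> 0 <= w x <-> A x.
  move=> x0; have [m [k [m0 um]]] := commensurable_exists x0.
  rewrite (wP x x0 m k) // pmulr_lge0 ?invr_gt0 ?ltr0n // ler0z.
  have [xm0 [Am Am']] := um; split=> [k0|Ax].
    have [//|Ax'] := valA x0.
    have -> : x = (x ^+ m / pi ^ k) * pi ^ k * x^-1 ^+ m.-1.
      have xm : x ^+ m = x * x ^+ m.-1 by rewrite -exprS prednK.
      by rewrite divfK ?expfz_neq0 // xm exprVn mulfK ?expf_neq0.
    apply: AM; last exact: AX.
    apply: AM => //; case: k k0 {um xm0 Am Am'} => // k _; apply: AX; apply: AO.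
    by rewrite val_geE // rvc0.
  apply: unit_uniformizerXz.
  have -> : pi ^ k = (x ^+ m / pi ^ k)^-1 * x ^+ m.
    by rewrite invf_div divfK ?expf_neq0.
  by apply: AM => //; apply: AX.
have wM x y : x != 0 -> y != 0 -> w (x * y) = w x + w y.
  move=> x0 yn0; have [m [k cx]] := commensurable_exists x0.
  have [m' [k' cy]] := commensurable_exists yn0.
  rewrite (wP x x0 _ _ cx) (wP y yn0 _ _ cy).
  have [[m0 ux] [m0' uy]] := (cx, cy).
  rewrite (wP _ (mulf_neq0 x0 yn0) (m * m')%N (k * m'%:Z + k' * m%:Z)).
    rewrite intrD !intrM natrM -!pmulrn.
    by field; rewrite !nat0.
  split; first by rewrite muln_gt0 m0.
  have := ring_unitM (ring_unitX m' ux) (ring_unitX m uy); congr ring_unit.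
  rewrite expfzDr // !exprMn !exprVn !exprnP -!exprz_exp !exprz_exp invfM
    mulrACA.
  by rewrite PoszM (mulrC m'%:Z m%:Z).
exists w; split; last 2 first.
- move=> c c_0; have c1 : iota c != 0 by rewrite fmorph_eq0.
  rewrite (wP _ c1 1%N (fine (v c))) ?divr1 //; split=> //.
  by rewrite expr1; apply: unit_times_uniformizer.
- by move=> x x0 /(wge x x0).
split=> // x y x0 yn0 xy0; wlog le : x y x0 yn0 xy0 / w x <= w y.
  move=> H; have /orP[le|le] := le_total (w x) (w y); first exact: H.
  by rewrite minC addrC; apply: H => //; rewrite addrC.
rewrite ge_min; apply/orP; left.
have yx0 : y / x != 0 by rewrite mulf_neq0 ?invr_eq0.
have wyx : w y = w (y / x) + w x by rewrite -wM // divfK.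
have /(wge _ yx0) Ayx : 0 <= w (y / x) by move: le; rewrite wyx; lra.
have xyE : x + y = (1 + y / x) * x by rewrite mulrDl mul1r divfK.
have n0 : 1 + y / x != 0 by apply: contra_neq xy0; rewrite xyE => ->;
  rewrite mul0r.
have /(wge _ n0) : A (1 + y / x) by apply: subringD.
by rewrite xyE wM //; lra.
Qed.

End ValuationOfRing.

(** The nonintegral [y] is kept outside a maximal ring and so becomes a pole. In contrapositive
    form: an element without poles above [v] is integral at [v]. *)
Theorem valuation_extension (E L : fieldType) (iota : {rmorphism E -> L})
    (v : dvaluation E) (y : L) :
    (forall z, algebraicOver iota z) -> ~ integral_at iota v y ->
  exists w : L -> rat, [/\ rval_axiom w,
    forall c, c != 0 -> w (iota c) = rv v c, y != 0 & w y < 0].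
Proof.
move=> algL nint; have y0 := y0_neq0 nint.
have [A avA maxA] := exists_maximal_avoiding nint.
have valA := maximal_valuation_ring nint avA maxA.
have [c c0 vc] := dval_uniformizer v.
have [w [wP wE wA]] := valuation_of_ring algL y0 avA valA c0 vc.
exists w; split=> //; rewrite ltNge; apply/negP => /(wA y y0).
by case: avA.
Qed.

(** * Finite extensions *)

(** An upper bound on the dimension, stated by the dependence of any [N + 1] elements so that no
    basis has to be chosen. *)
Definition fin_dim (E L : fieldType) (iota : {rmorphism E -> L}) (N : nat) :=
  forall f : 'I_N.+1 -> L, exists c : 'I_N.+1 -> E,
    (exists i, c i != 0) /\ \sum_i iota (c i) * f i = 0.

Section FiniteDimension.
Variables (E L : fieldType) (iota : {rmorphism E -> L}).

Definition spanned (b : seq L) : set L :=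
  [set z | exists c : nat -> E, z = \sum_(i < size b) iota (c i) * b`_i].

Lemma spannedD b x y : spanned b x -> spanned b y -> spanned b (x + y).
Proof.
move=> [c ->] [d ->]; exists (fun i => c i + d i).
by rewrite -big_split; apply: eq_bigr => i _; rewrite rmorphD mulrDl.
Qed.

Lemma spanned_mem b c x : x \in b -> spanned b (iota c * x).
Proof.
move=> xb; exists (fun i => if i == index x b then c else 0).
have ltx : (index x b < size b)%N by rewrite index_mem.
rewrite (bigD1 (Ordinal ltx)) //= eqxx nth_index // big1 ?addr0 // => i.
by rewrite -val_eqE /= => /negPf->; rewrite rmorph0 mul0r.
Qed.

Lemma spanned_sum b I (r : seq I) (P : pred I) (f : I -> L) :
  (forall i, P i -> spanned b (f i)) -> spanned b (\sum_(i <- r | P i) f i).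
Proof.
move=> h; elim/big_ind: _ => //; last by move=> x y; apply: spannedD.
by exists (fun=> 0); rewrite big1 // => i _; rewrite rmorph0 mul0r.
Qed.

(** Division by a monic equation [f] of [z] keeps the coefficients in [V], so powers of [z] below
    [size f] suffice. *)
Lemma spanned_adjoin (V : set L) (b : seq L) z : subring_set V ->
    (forall c, V (iota c)) -> V `<=` spanned b -> algebraicOver iota z ->
  exists b', adjoin V z `<=` spanned b'.
Proof.
move=> sV VE Vb /integral_algebraic[f mf /rootP fz].
have [_ VB VM] := sV.
exists [seq u * z ^+ j | u <- b, j <- seq.iota 0 (size f)] => _ [h Vh ->].
move: {2}(size h) (leqnn (size h)) => n; elim: n => [|n IH] in h Vh *.
  rewrite leqn0 size_poly_eq0 => /eqP->; rewrite horner0.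
  exists (fun=> 0); rewrite big1 // => i _; rewrite rmorph0 mul0r //.
move=> leh; have [le|lt] := leqP (size h) (size f).
  rewrite (horner_coef_wide _ le); apply: spanned_sum => j _.
  have [c ->] := Vb _ (Vh j); rewrite mulr_suml; apply: spanned_sum => i _.
  rewrite -mulrA; apply: spanned_mem; apply: allpairs_f; first exact: mem_nth.
  by rewrite mem_iota /=.
have f0 : f != 0 by apply: monic_neq0.
have h0 : h != 0 by rewrite -size_poly_gt0; apply: leq_ltn_trans lt.
pose g := lead_coef h *: 'X^(size h - size f) * map_poly iota f.
have mf' : map_poly iota f \is monic by rewrite map_monic.
have lh0 : lead_coef h != 0 by rewrite lead_coef_eq0.
have sg : size g = size h.
  rewrite /g -scalerAl size_scale // size_Mmonic ?monic_neq0 ?monicXn //.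
  by rewrite size_polyXn size_map_poly; move: (size h) (size f) lt => k l; lia.
have lg : lead_coef g = lead_coef h.
  by rewrite /g -scalerAl lead_coefZ lead_coef_Mmonic // lead_coefXn mulr1.
have -> : h.[z] = (h - g).[z].
  by rewrite hornerD hornerN [g.[z]]hornerM fz mulr0 subr0.
apply: IH.
  move=> i; rewrite coefB; apply: VB => //; rewrite /g -scalerAl coefZ.
  apply: VM; first exact: Vh.
  rewrite coefXnM; case: ifP => _; first exact: subring0.
  by rewrite coef_map; apply: VE.
have [n' sn'] : exists n', size h = n'.+1.
  by exists (size h).-1; rewrite prednK // size_poly_gt0.
rewrite -ltnS; apply: leq_trans leh; rewrite sn' ltnS; apply/leq_sizeP => i.
rewrite leq_eqVlt coefB => /predU1P[<-|lti].
  by move: lg; rewrite /lead_coef sg sn' /= => ->; rewrite subrr.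
by rewrite !nth_default ?subrr // ?sg sn'.
Qed.

(** The ring generated over the base field by finitely many algebraic elements is already a field by
    [subring_inv], and it is spanned by finitely many products. *)
Lemma spanned_generated (s : seq L) : (forall y, algebraicOver iota y) ->
    (forall y, y \in generated (range iota `|` [set` s])) ->
  exists b, forall y, spanned b y.
Proof.
move=> algL genL.
have [V [sV VE Vs [b Vb]]] : exists V : set L, [/\ subring_set V,
    forall c, V (iota c), forall y, y \in s -> V y & exists b,
      V `<=` spanned b].
  elim: s {genL} => [|z s [V [sV VE Vs [b Vb]]]].
    exists (range iota); split=> //; last first.
      exists [:: 1] => _ [c _ <-]; exists (fun=> c).
      by rewrite big_ord1 /= mulr1.
    split; first by exists 1; rewrite ?rmorph1.
    - by move=> _ _ [a _ <-] [c _ <-]; exists (a - c); rewrite ?rmorphB.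
    - by move=> _ _ [a _ <-] [c _ <-]; exists (a * c); rewrite ?rmorphM.
  have [b' Vb'] := spanned_adjoin sV VE Vb (algL z).
  exists (adjoin V z); split; first exact: adjoin_subring.
  - by move=> c; apply: adjoin_sub.
  - move=> y; rewrite inE => /predU1P[->|/Vs Vy]; first exact: adjoin_mem.
    exact: adjoin_sub.
  - by exists b'.
exists b => y; apply: Vb; have /asboolP := genL y; apply.
  have [V1 VB VM] := sV; split=> // x z Vx Vz; apply: VM => //.
  exact: subring_inv.
by move=> z [[c _ <-]|zs]; [apply: VE | apply: Vs].
Qed.

Lemma fin_dim_generated (s : seq L) : (forall y, algebraicOver iota y) ->
    (forall y, y \in generated (range iota `|` [set` s])) ->
  exists N, fin_dim iota N.
Proof.
move=> algL genL; have [b bP] := spanned_generated algL genL.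
exists (size b) => f; have /choice[C CP] := fun i => bP (f i).
pose M := \matrix_(i < (size b).+1, j < size b) C i j.
have : kermx M != 0.
  rewrite kermx_eq0 /row_free; apply/negP => /eqP rM.
  by have := rank_leq_col M; rewrite rM ltnn.
case/rowV0Pn => u /sub_kermxP uM u0.
exists (fun i => u 0 i); split.
  by case/rV0Pn: u0 => i ui; exists i.
under eq_bigr do rewrite CP mulr_sumr.
rewrite exchange_big big1 //= => j _.
transitivity (iota ((u *m M) 0 j) * b`_j); last by rewrite uM mxE rmorph0 mul0r.
rewrite mxE rmorph_sum mulr_suml; apply: eq_bigr => i _.
by rewrite mxE rmorphM mulrA.
Qed.

Hypothesis dimL : exists N, fin_dim iota N.

Definition independent m (b : 'I_m -> L) := forall c : 'I_m -> E,
  \sum_j iota (c j) * b j = 0 -> forall j, c j = 0.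

Lemma fin_dim_bound N m (b : 'I_m -> L) :
  fin_dim iota N -> independent b -> (m <= N)%N.
Proof.
move=> dN indb; rewrite leqNgt; apply/negP => ltNm.
have [c [[i ci0] sc]] := dN (fun i => b (widen_ord ltNm i)).
pose c' (j : 'I_m) := if insub (j : nat) is Some i then c i else 0.
have c'w k : c' (widen_ord ltNm k) = c k.
  by rewrite /c' insubT //= => h; congr c; apply: val_inj.
have := indb c' _ (widen_ord ltNm i); rewrite c'w => ci; case/eqP: ci0;
  apply: ci.
rewrite -[RHS]sc (bigID (fun j :
  'I_m => (j < N.+1)%N)) /= [X in _ + X]big1 ?addr0.
  rewrite (big_ord_narrow ltNm); apply: eq_bigr => k _.
  by rewrite c'w.
by move=> j /negPf h; rewrite /c' insubF // rmorph0 mul0r.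
Qed.

Lemma sum_extend m (c : 'I_m.+1 -> E) (b : 'I_m -> L) z :
  \sum_j iota (c j) * oapp b z (unlift ord_max j) =
  \sum_k iota (c (lift ord_max k)) * b k + iota (c ord_max) * z.
Proof.
rewrite (bigD1_ord ord_max) //= unlift_none addrC; congr (_ + _).
by apply: eq_bigr => k _; rewrite liftK.
Qed.

(** A largest independent family is a basis, so the choice defining [ext_degree] does not fall back
    on its default 0. *)
Lemma ext_degree_gt0 : (0 < ext_degree iota)%N.
Proof.
have [N dN] := dimL; rewrite /ext_degree; case: xgetP => [m _ [b bP]|].
  case: m => [|//] in b bP *; have [c [+ _]] := bP 1.
  by rewrite big_ord0 => /eqP; rewrite oner_eq0.
move=> /= no; exfalso.
have ex : exists m, `[< exists b : 'I_m -> L, independent b >].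
  by exists 0%N; apply/asboolP; exists (fun=> 0) => c _ [].
have bnd m : `[< exists b : 'I_m -> L, independent b >] -> (m <= N)%N.
  by move=> /asboolP[b]; apply: fin_dim_bound.
case: (ex_maxnP ex bnd) => m /asboolP[b indb] maxm; apply: (no m);
  exists b => z.
have [c zE] : exists c : 'I_m -> E, z = \sum_(j < m) iota (c j) * b j.
  pose b' (j : 'I_m.+1) := oapp b z (unlift ord_max j).
  have [c [sc [j cj0]]] : exists c : 'I_m.+1 -> E,
      \sum_j iota (c j) * b' j = 0 /\ exists j, c j != 0.
    apply: contrapT => nex; have : (m.+1 <= m)%N; last by rewrite ltnn.
    apply: maxm; apply/asboolP; exists b' => c sc j; apply/eqP.
    by apply: contrapT => /negP cj; apply: nex; exists c; split=> //; exists j.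
  rewrite sum_extend in sc; have cm0 : c ord_max != 0.
    apply: contraNneq cj0 => cm; rewrite cm rmorph0 mul0r addr0 in sc.
    have ck := indb (fun k => c (lift ord_max k)) sc.
    by case: (unliftP ord_max j) => [k ->|->]; [rewrite ck | rewrite cm].
  have cm1 : iota (c ord_max) != 0 by rewrite fmorph_eq0.
  exists (fun k => - (c (lift ord_max k) / c ord_max)).
  apply: (mulfI cm1); rewrite mulr_sumr; move/eqP: sc;
    rewrite addrC addr_eq0 => /eqP->.
  rewrite -sumrN; apply: eq_bigr => k _; rewrite rmorphN fmorph_div.
  by field.
exists c; split=> // d zE'; apply/funext => j; apply/eqP; rewrite -subr_eq0.
apply/eqP; apply: (indb (fun j => c j - d j));
  under eq_bigr do rewrite rmorphB mulrBl.
by rewrite big_split /= sumrN -zE' -zE subrr.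
Qed.

End FiniteDimension.

Section ValuationOfSums.
Variables (L : fieldType) (w : L -> rat).
Hypothesis wP : rval_axiom w.

Lemma rval_sum_distinct (g : nat -> L) n :
    (forall i j, (i < j < n)%N -> g i != 0 -> g j != 0 -> w (g i) <> w (g j)) ->
  (forall i, (i < n)%N -> g i = 0) \/
  (exists i, [/\ (i < n)%N, g i != 0, \sum_(j < n) g j != 0 &
     w (\sum_(j < n) g j) = w (g i)]).
Proof.
elim: n => [|n IH] H; first by left.
have [|all0|[i [ltin gi0 s0 wE]]] := IH.
- move=> i j /andP[ltij ltjn]; apply: H; rewrite ltij /=; exact: leqW.
- have [gn0|gn0] := eqVneq (g n) 0.
    by left=> i; rewrite ltnS leq_eqVlt => /predU1P[->|/all0].
  right; exists n; rewrite big_ord_recr /= big1 ?add0r // => i _.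
  exact: all0.
right; rewrite big_ord_recr /=; set s := \sum_(j < n) g j in s0 wE *.
have [gn0|gn0] := eqVneq (g n) 0.
  by exists i; rewrite gn0 addr0; split=> //; apply: leqW.
have ne : w (g i) <> w (g n) by apply: H => //; rewrite ltin /=.
have [lt|lt|//] := ltgtP (w (g i)) (w (g n)).
  have [|h1 h2] := rval_dominant wP s0 (y := g n).
    by rewrite val_gtE // wE.
  by exists i; rewrite h2; split=> //; apply: leqW.
have [|h1 h2] := rval_dominant wP gn0 (y := s).
  by rewrite val_gtE // wE.
by exists n; rewrite addrC h2.
Qed.

Lemma rval_dominant_sum (I : finType) (f : I -> L) i : f i != 0 ->
  (forall j, j != i -> f j \in val_gt w (w (f i))) -> \sum_j f j != 0.
Proof.
move=> fi0 h; rewrite (bigD1 i) //=.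
have hs : \sum_(j | j != i) f j \in val_gt w (w (f i)) by apply: val_gt_sum.
by have [] := rval_dominant wP fi0 hs.
Qed.

End ValuationOfSums.

(** * Valuations above a given valuation *)

Section LiesOver.
Variables (E L : fieldType) (iota : {rmorphism E -> L}).
Implicit Types (v : dvaluation E) (w : dvaluation L).

Lemma lies_overP w v : lies_over iota w v <->
  exists2 e : nat, (0 < e)%N & forall c, c != 0 -> rv w (iota c) = rv v c *+ e.
Proof.
split=> -[e e0 h]; exists e => //.
  move=> c c0; rewrite /rv h (dval_fine v c0) -EFin_natmul /=.
  by rewrite rmorphMn.
move=> c; have [->|c0] := eqVneq c 0.
  rewrite rmorph0 !dval0; case: e e0 {h} => // e _.
  by rewrite enatmul_pinfty.
have ic0 : iota c != 0 by rewrite fmorph_eq0.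
rewrite (dval_fine v c0) (dval_fine w ic0) -EFin_natmul; congr EFin.
apply/eqP; rewrite -(eqr_int rat); apply/eqP; have := h c c0; rewrite /rv => ->.
by rewrite rmorphMn.
Qed.

Lemma lies_over_ge0 v w c : lies_over iota w v ->
  (iota c \in val_ge (rv w) 0) = (c \in val_ge (rv v) 0).
Proof.
move=> /lies_overP[e e0 h]; have [->|c0] := eqVneq c 0.
  by rewrite rmorph0 !val_ge0.
by rewrite !val_geE ?fmorph_eq0 // h // pmulrn_lge0.
Qed.

Lemma lies_over_gt0 v w c : lies_over iota w v ->
  (iota c \in val_gt (rv w) 0) = (c \in val_gt (rv v) 0).
Proof.
move=> /lies_overP[e e0 h]; have [->|c0] := eqVneq c 0.
  by rewrite rmorph0 !val_gt0.
by rewrite !val_gtE ?fmorph_eq0 // h // pmulrn_lgt0.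
Qed.

Lemma val_ge_algebraic v w z (f : {poly E}) : lies_over iota w v ->
  f \is monic -> (forall i, f`_i \in val_ge (rv v) 0) ->
  root (map_poly iota f) z -> z \in val_ge (rv w) 0.
Proof.
move=> wv mf fge; apply: (rval_monic_root (rv_axiom w));
  rewrite ?map_monic // => i.
by rewrite coef_map /= (lies_over_ge0 _ wv).
Qed.

End LiesOver.

Lemma lies_over_comp (E K L : fieldType) (i : {rmorphism E -> K})
    (j : {rmorphism K -> L}) v u w :
  lies_over i u v -> lies_over j w u -> lies_over (j \o i) w v.
Proof.
move=> /lies_overP[e e0 h] /lies_overP[f f0 k]; apply/lies_overP.
exists (e * f)%N; first by rewrite muln_gt0 e0.
by move=> c c0; rewrite /= k ?fmorph_eq0 // h // mulrnA.
Qed.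

(** The ramification index of [u] over [v] is the value under [u] of a uniformizer of [v]. *)
Lemma lies_over_descend (E K L : fieldType) (i : {rmorphism E -> K})
    (j : {rmorphism K -> L}) v u w :
  lies_over (j \o i) w v -> lies_over j w u -> lies_over i u v.
Proof.
move=> /lies_overP[e e0 h] /lies_overP[f f0 k]; apply/lies_overP.
have [c c0 vc] := dval_uniformizer v.
have f1 : (f%:R : rat) != 0 by rewrite pnatr_eq0 -lt0n.
have E1 x : x != 0 -> rv u (i x) * f%:R = rv v x * e%:R.
  move=> x0; rewrite mulr_natr -k ?fmorph_eq0 // mulr_natr.
  exact: h.
have := E1 c c0; rewrite {2}/rv vc mul1r => E2.
have p0 : 0 < rv u (i c) by rewrite -(pmulr_lgt0 _ (_ : 0 < f%:R)) ?E2 ltr0n.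
exists `|fine (u (i c))|%N.
  by rewrite absz_gt0; apply: contraTneq p0 => z0; rewrite /rv z0 ltxx.
move=> x x0; apply: (mulIf f1); rewrite E1 // -E2 mulrA; congr (_ * _).
rewrite -mulr_natr; congr (_ * _); rewrite /rv natr_absz ger0_norm //.
by rewrite -(ler_int rat) ltW.
Qed.

(* Dividing by the least positive value normalizes a group homomorphism. *)
Lemma normalize_valuation (L : fieldType) (f : L -> int) :
  (forall x y, x != 0 -> y != 0 -> f (x * y) = f x + f y) ->
  (forall x y, x != 0 -> y != 0 -> x + y != 0 ->
     Num.min (f x) (f y) <= f (x + y)) ->
  (exists2 x, x != 0 & 0 < f x) ->
  exists (w : dvaluation L) (g : nat), (0 < g)%N /\
    forall x, x != 0 -> f x = fine (w x) * g%:Z.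
Proof.
move=> fM fD [x1 x10 fx1].
have ex : exists n, `[< (0 < n)%N /\ exists2 x, x != 0 & f x = n%:Z >].
  exists `|f x1|%N; apply/asboolP; split; first by move: fx1; lia.
  by exists x1 => //; move: fx1; lia.
case: (ex_minnP ex) => g /asboolP[g0 [t t0 ft]] gmin.
have f1 : f 1 = 0.
  by have := fM 1 1 (oner_neq0 L) (oner_neq0 L); rewrite mulr1; lia.
have fV x : x != 0 -> f x^-1 = - f x.
  move=> x0; have := fM x x^-1 x0; rewrite invr_eq0 divff // f1 => /(_ x0); lia.
have fX x n : x != 0 -> f (x ^+ n) = f x *+ n.
  move=> x0; elim: n => [|n IH]; first by rewrite expr0 f1.
  by rewrite exprS fM ?expf_neq0 // IH mulrS.
have ftz (n : int) : f (t ^ n) = n * g%:Z.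
  case: n => n; first by rewrite -exprnP fX // ft; lia.
  by rewrite NegzE -exprnN fV ?expf_neq0 // fX // ft; lia.
have gdvd x : x != 0 -> f x = (f x %/ g%:Z)%Z * g%:Z.
  move=> x0; have g0' : g%:Z != 0 by move: g0; lia.
  have := divz_eq (f x) g%:Z; have := modz_ge0 (f x) g0'.
  have := ltz_pmod (f x) (_ : 0 < g%:Z); rewrite ltz_nat => /(_ g0).
  set q := (_ %/ _)%Z; set r := (_ %% _)%Z => ltr r0 fE.
  have y0 : x * t ^ (- q) != 0 by rewrite mulf_neq0 ?expfz_neq0.
  have fy : f (x * t ^ (- q)) = r by rewrite fM ?expfz_neq0 // ftz fE; lia.
  have [rz|rn] := eqVneq r 0; first by rewrite {1}fE rz addr0.
  have : (g <= `|r|)%N.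
    apply: gmin; apply/asboolP; split; first by rewrite absz_gt0.
    by exists (x * t ^ (- q)) => //; rewrite fy gez0_abs.
  by move: ltr r0; lia.
have [|||w wE] := @dvaluation_of_int L (fun x => (f x %/ g%:Z)%Z).
- move=> x y x0 y0; have h := fM x y x0 y0; have g0' : g%:Z != 0 by move: g0;
    lia.
  rewrite (gdvd _ x0) (gdvd _ y0) (gdvd _ (mulf_neq0 x0 y0)) -mulrDl in h.
  exact: (mulIf g0' h).
- move=> x y x0 y0 xy0; have := fD x y x0 y0 xy0.
  by rewrite !ge_min => /orP[h|h]; apply/orP; [left|right]; apply: lez_pdiv2r.
- by exists t => //; rewrite ft divzz; move: g0; lia.
by exists w, g; split=> // x x0; rewrite wE //= -gdvd.
Qed.

Lemma restrict_valuation (K L : fieldType) (j : {rmorphism K -> L})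
    (w : dvaluation L) : (exists2 c, c != 0 & 0 < rv w (j c)) ->
  exists u : dvaluation K, lies_over j w u.
Proof.
move=> [c c0 wc]; have wP := rv_axiom w.
have jn0 x : x != 0 -> j x != 0 by rewrite fmorph_eq0.
have [|||u [g [g0 uE]]] := @normalize_valuation K (fun x => fine (w (j x))).
- move=> x y x0 y0; apply/eqP; rewrite -(eqr_int rat) intrD; apply/eqP.
  by rewrite rmorphM; apply: (rvalM wP); apply: jn0.
- move=> x y x0 y0 xy0; have [_ h] := wP.
  have := h _ _ (jn0 _ x0) (jn0 _ y0); rewrite -rmorphD => /(_ (jn0 _ xy0)).
  by rewrite /rv !ge_min !ler_int.
- by exists c => //; move: wc; rewrite /rv ltr0z.
exists u; apply/lies_overP; exists g => // x x0.
by rewrite /rv uE // intrM mulr_natr.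
Qed.

Section FiniteExtensionValuations.
Variables (E L : fieldType) (iota : {rmorphism E -> L}) (N : nat).
Hypothesis dimL : fin_dim iota N.
Implicit Types (v : dvaluation E) (w : dvaluation L).

(** The powers of [x] up to [N] are linearly dependent, so two terms of a relation have equal value,
    and some multiple [j - i] of [w x], with [j - i] at most [N], is an integer. Hence [M] is a
    common denominator of all values, and [normalize_valuation] applies to [M] times [w]. *)
Lemma discretize v (w : L -> rat) : rval_axiom w ->
  (forall c, c != 0 -> w (iota c) = rv v c) ->
  exists u : dvaluation L, lies_over iota u v /\
    forall x, x != 0 -> (rv u x < 0) = (w x < 0).
Proof.
move=> wP wE; pose M := (N.+1)`!.
have M0 : (0 < M)%N by apply: fact_gt0.
have /choice[f fE] : forall x, exists k : int, x != 0 -> w x * M%:R = k%:~R.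
  move=> x; have [->|x0] := eqVneq x 0; first by exists 0.
  have [c [[i0 ci0] sc]] := dimL (fun i => x ^+ i).
  pose g i := if insub i is Some j then iota (c j) * x ^+ i else 0.
  have gE (i : 'I_N.+1) : g i = iota (c i) * x ^+ i.
    by rewrite /g; case: insubP => [k _ /val_inj-> //|]; rewrite ltn_ord.
  have xn i : x ^+ i != 0 by apply: expf_neq0.
  have [i [j [ltij ltjN gi gj wg]]] : exists i j,
      [/\ (i < j)%N, (j < N.+1)%N, g i != 0, g j != 0 & w (g i) = w (g j)].
    apply: contrapT => nex; have [|all0|[i [_ _ + _]]] :=
      @rval_sum_distinct _ _ wP g N.+1.
    - by move=> i j /andP[? ?] ? ? ?; apply: nex; exists i, j.
    - move: (all0 i0 (ltn_ord i0)); rewrite gE => /eqP.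
      by rewrite mulf_eq0 fmorph_eq0 (negPf ci0) (negPf (xn _)).
    by rewrite (eq_bigr _ (fun i _ => gE i)) sc eqxx.
  have ltiN : (i < N.+1)%N by apply: ltn_trans ltjN.
  rewrite -[i]/(val (Ordinal ltiN)) -[j]/(val (Ordinal ltjN)) !gE in gi gj wg.
  move: gi gj; rewrite !mulf_eq0 !negb_or !fmorph_eq0 => /andP[ci _] /andP[cj
    _].
  move: wg; rewrite !rvalM ?fmorph_eq0 // !wE // !rvalX //= => wg.
  have [e ME] : exists e, M = (e * (j - i))%N.
    by apply/dvdnP; apply: dvdn_fact; lia.
  exists ((fine (v (c (Ordinal ltiN))) - fine (v (c (Ordinal ltjN)))) * e%:Z) =>
    _.
  rewrite ME natrM mulrCA intrM intrB -pmulrn mulrC; congr (_ * _).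
  rewrite mulr_natr mulrnBr; last exact: ltnW.
  by move: wg; rewrite /rv; lra.
have M1 : (0 : rat) < M%:R by rewrite ltr0n.
have fx x : x != 0 -> w x = (f x)%:~R / M%:R.
  by move=> x0; rewrite -fE // mulfK // lt0r_neq0.
have [c c0 vc] := dval_uniformizer v.
have ic0 : iota c != 0 by rewrite fmorph_eq0.
have rvc : rv v c = 1 by rewrite /rv vc.
have [|||u [g [g0 uE]]] := @normalize_valuation L f.
- move=> x y x0 y0; apply/eqP; rewrite -(eqr_int rat) intrD -!fE ?mulf_neq0 //.
  by rewrite rvalM // mulrDl.
- move=> x y x0 y0 xy0; have [_ /(_ _ _ x0 y0 xy0)] := wP.
  by rewrite !ge_min !fx // !ler_pM2r ?invr_gt0 // !ler_int.
- by exists (iota c) => //; rewrite -(ltr0z rat) -fE // wE // rvc mul1r.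
have g1 : (0 : rat) < g%:R by rewrite ltr0n.
have wu x : x != 0 -> w x * M%:R = rv u x * g%:R.
  by move=> x0; rewrite fE // uE // intrM.
exists u; split; last first.
  move=> x x0; rewrite -[RHS](pmulr_llt0 _ M1) wu // pmulr_llt0 //.
have E2 : M%:R = rv u (iota c) * g%:R by rewrite -wu // wE // rvc mul1r.
have p0 : 0 < rv u (iota c) by rewrite -(pmulr_lgt0 _ g1) -E2.
apply/lies_overP; exists `|fine (u (iota c))|%N.
  by rewrite absz_gt0; apply: contraTneq p0 => z0; rewrite /rv z0 ltxx.
move=> x x0; apply: (mulIf (lt0r_neq0 g1)); rewrite -wu ?fmorph_eq0 // wE //.
rewrite E2 mulrA; congr (_ * _); rewrite -mulr_natr; congr (_ * _).
by rewrite /rv natr_absz ger0_norm // -(ler_int rat) ltW.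
Qed.

(** If the ring of [w] were contained in that of [w'], units of [w] would be units of [w'], so [w']
    would be a multiple of [w]; both being normalized, they would coincide. *)
Lemma lies_over_distinct v w w' : lies_over iota w v -> lies_over iota w' v ->
  w <> w' -> exists2 x, x != 0 & 0 <= rv w x /\ rv w' x < 0.
Proof.
move=> /lies_overP[e e0 h] /lies_overP[e' e0' h'] nw; apply: contrapT => nex.
have ge x : x != 0 -> 0 <= rv w x -> 0 <= rv w' x.
  by move=> x0 wx; rewrite leNgt; apply/negP => w'x; apply: nex; exists x.
have wP := rv_axiom w; have wP' := rv_axiom w'.
have [t t0 wt] := dval_uniformizer w.
have rwt : rv w t = 1 by rewrite /rv wt.
have zero x : x != 0 -> rv w x = 0 -> rv w' x = 0.
  move=> x0 wx; have := ge x x0; have := ge x^-1.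
  by rewrite invr_eq0 !rvalV // wx oppr0 => /(_ x0 (lexx _)) a /(_ (lexx _)) b;
    lra.
have mul x : x != 0 -> rv w' x = rv w x * rv w' t.
  move=> x0; have tn0 : t ^ (- fine (w x)) != 0 by rewrite expfz_neq0.
  have : rv w' (x * t ^ (- fine (w x))) = 0.
    apply: zero; first by rewrite mulf_neq0.
    by rewrite rvalM // rvXz // rwt mul1r intrN /rv subrr.
  by rewrite rvalM // rvXz // /rv intrN; lra.
have [s s0 w's] := dval_uniformizer w'.
have rws : rv w' s = 1 by rewrite /rv w's.
apply: nw; apply: dvaluation_eq => x x0.
have t1 : rv w' t = 1.
  have : rv w s * rv w' t == 1%:~R by rewrite -mul // rws.
  rewrite /rv -intrM eqr_int => /eqP.
  have := ge t t0; rewrite rwt ler01 => /(_ isT); rewrite /rv ler0z.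
  move: (fine (w s)) (fine (w' t)) => a b b0 ab.
  have bn : b != 0 by apply: contra_eq_neq ab => ->; rewrite mulr0.
  have b1 : 1 <= b by lia.
  have a1 : 1 <= a by nia.
  by have -> : b = 1 by nia.
rewrite (dval_fine w x0) (dval_fine w' x0); congr EFin; apply/eqP.
by rewrite -(eqr_int rat) -/(rv w x) -/(rv w' x) (mul x x0) t1 mulr1.
Qed.

Lemma separate_pair v w w' : lies_over iota w v -> lies_over iota w' v ->
  w <> w' -> exists x, [/\ x != 0, 0 < rv w x & rv w' x < 0].
Proof.
move=> wv w'v nw; have [a a0 [wa w'a]] := lies_over_distinct wv w'v nw.
have [b b0 [w'b wb]] := lies_over_distinct w'v wv (nesym nw).
exists (a / b); rewrite mulf_neq0 ?invr_eq0 //.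
have wP := rv_axiom w; have wP' := rv_axiom w'.
by rewrite !rvalM ?invr_eq0 // !rvalV //; split=> //; lra.
Qed.

(* The inductive step of weak approximation: multiply by a high power of a    *)
(* separating element [z], or by [1 + z ^+ r].                                *)
Lemma separate_seq v w (s : seq (dvaluation L)) : lies_over iota w v ->
    (forall w', w' \in s -> lies_over iota w' v /\ w <> w') ->
  exists x, [/\ x != 0, 0 < rv w x & forall w', w' \in s -> rv w' x < 0].
Proof.
move=> wv; elim: s => [|w1 s IH] sP.
  have [c c0 wc] := dval_uniformizer w; exists c; split=> //.
  by rewrite /rv wc.
have [|z [z0 wz sz]] := IH; first by move=> w' w's; apply: sP;
  rewrite inE w's orbT.
have [w1v nw] := sP w1 (mem_head _ _).
have [y [y0 wy w1y]] := separate_pair wv w1v nw.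
have [lt|gt|eq] := ltgtP (rv w1 z) 0.
  by exists z; split=> // w'; rewrite inE => /predU1P[->|/sz].
all: pose r := (\sum_(w' <- s) `|fine (w' y)|).+1.
all: have rP w' : w' \in s -> rv w' y + rv w' z *+ r < 0.
1,3: move=> w's; have := sz _ w's; have : (`|fine (w' y)| < r)%N
       by rewrite /r ltnS (big_rem _ w's) leq_addr.
1,2: rewrite /rv -mulr_natr pmulrn -intrM -intrD !ltrz0.
1,2: by move: (fine (w' y)) (fine (w' z)) r => b a n; nia.
- have zr w' : rv w' z *+ r = rv w' (z ^+ r) by rewrite rvalX //;
    apply: rv_axiom.
  have zr0 : z ^+ r != 0 by rewrite expf_neq0.
  have one w' : 0 < rv w' z -> 1 + z ^+ r != 0 /\ rv w' (1 + z ^+ r) = 0.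
    have w'P := rv_axiom w'; move=> w'z; rewrite -(rval1 w'P).
    apply: rval_dominant; rewrite ?oner_neq0 // val_gtE // (rval1 w'P).
    by rewrite -zr pmulrn_lgt0.
  have [s0 ws0] := one w wz; have [_ w1s0] := one w1 gt.
  exists (y * (1 + z ^+ r)); rewrite mulf_neq0 //; split=> //.
    by rewrite (rvalM (rv_axiom w)) // ws0 addr0.
  move=> w'; rewrite inE => /predU1P[->|w's].
    by rewrite (rvalM (rv_axiom w1)) // w1s0 addr0.
  have w'P := rv_axiom w'; rewrite (rvalM w'P) //.
  have -> : rv w' (1 + z ^+ r) = rv w' z *+ r; last exact: rP.
  rewrite zr addrC; have [|] := rval_dominant w'P zr0 (y := 1) => //.
  by rewrite val_gtE ?oner_neq0 // (rval1 w'P) -zr mulrn_wlt0 ?sz.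
- exists (y * z ^+ r); rewrite mulf_neq0 ?expf_neq0 //; split=> //.
    rewrite (rvalM (rv_axiom w)) ?expf_neq0 // (rvalX (rv_axiom w)) //.
    by rewrite addr_gt0 // pmulrn_lgt0.
  move=> w'; have w'P := rv_axiom w'; rewrite inE (rvalM w'P) ?expf_neq0 //.
  rewrite (rvalX w'P) // => /predU1P[->|/rP //].
  by rewrite eq mul0rn addr0.
Qed.

(** To each of finitely many extensions belongs an element [z j] of value 0 there and of positive
    value at the others. These elements are independent: in a relation, the term whose coefficient
    has least value dominates at its own place. So there are at most [N] extensions. *)
Lemma finite_extensions v : finite_set [set w | lies_over iota w v].
Proof.
apply: (@finite_set_bounded _ _ N) => s us sP.
have /choice[z zP] : forall j : 'I_(size s), exists z, z != 0 /\
    forall i : 'I_(size s), rv (tnth (in_tuple s) i) z = 0 /\ i = j \/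
      0 < rv (tnth (in_tuple s) i) z /\ i <> j.
  move=> j; set w := tnth (in_tuple s) j; have wP := rv_axiom w.
  have [|w' w's|u [u0 wu su]] := @separate_seq v w (rem w s).
  - by apply: sP; apply: mem_tnth.
  - have : w' != w /\ w' \in s by move: w's;
      rewrite mem_rem_uniq // inE => /andP.
    by move=> [/eqP ne w's']; split; [apply: sP | apply: nesym].
  have [s0 ws0] : 1 + u != 0 /\ rv w (1 + u) = 0.
    rewrite -(rval1 wP); apply: rval_dominant; rewrite ?oner_neq0 //.
    by rewrite val_gtE // (rval1 wP).
  (* [u] has positive value at [w] and negative value at the other places, so this inverse has value
     0 at [w] and positive value elsewhere. *)
  exists (1 + u)^-1; rewrite invr_eq0; split=> // i.
  have [->|/eqP ne] := eqVneq i j; first by left; rewrite rvalV // ws0 oppr0.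
  right; split=> //; set w' := tnth _ i; have w'P := rv_axiom w'.
  have w'u : rv w' u < 0.
    apply: su; rewrite mem_rem_uniq // inE mem_tnth andbT; apply/eqP => ww.
    by apply: ne; apply: (elimT (tuple_uniqP (in_tuple s)) us).
  rewrite rvalV // oppr_gt0 addrC.
  have [|_ ->] := rval_dominant w'P u0 (y := 1) => //.
  by rewrite val_gtE ?oner_neq0 // (rval1 w'P).
apply: (fin_dim_bound (b := z) dimL) => c sc;
  apply: contrapT => /existsNP[j0 cj0].
have cj1 : c j0 != 0 by apply/eqP.
case: (@arg_minP _ _ _ j0 (fun i => c i !=
  0) (fun i => rv v (c i)) cj1) => j cj minj.
set w := tnth (in_tuple s) j; have wP := rv_axiom w.
have /lies_overP[e e0 h] : lies_over iota w v by apply: sP; apply: mem_tnth.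
have ic i : c i != 0 -> iota (c i) != 0 by rewrite fmorph_eq0.
have z0 i : z i != 0 by case: (zP i).
have wz : rv w (z j) = 0 by have [_ /(_ j)[[]|[_ []]]] := zP j.
have fj0 : iota (c j) * z j != 0 by rewrite mulf_neq0 ?ic.
suff fgt : forall i, i != j ->
    iota (c i) * z i \in val_gt (rv w) (rv w (iota (c j) * z j)).
  by have := rval_dominant_sum wP (f := fun i => iota (c i) * z i) fj0 fgt;
    rewrite sc eqxx.
move=> i ne.
have [ci|ci] := eqVneq (c i) 0; first by rewrite ci rmorph0 mul0r val_gt0.
rewrite val_gtE ?mulf_neq0 ?ic // !rvalM ?ic // !h // wz addr0.
have wi : 0 < rv w (z i).
  have [_ /(_ j)[[_ ij]|[]//]] := zP i.
  by move: ne; rewrite ij eqxx.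
by have := lerMn2r e (rv v (c j)) (rv v (c i)); rewrite minj // orbT => le; lra.
Qed.

Section ResidueDegree.
Variables (v : dvaluation E) (w : dvaluation L).
Hypothesis wv : lies_over iota w v.
Let vP := rv_axiom v.
Let wP := rv_axiom w.

Definition residually_independent m (b : 'I_m -> L) :=
  (forall j, b j \in val_ge (rv w) 0) /\
  forall c : 'I_m -> E, (forall j, c j \in val_ge (rv v) 0) ->
    \sum_j iota (c j) * b j \in val_gt (rv w) 0 ->
    forall j, c j \in val_gt (rv v) 0.

Lemma residually_independent_bound m (b : 'I_m -> L) :
  residually_independent b -> (m <= N)%N.
Proof.
move=> [bge bind]; apply: (fin_dim_bound (b := b) dimL) => c sc.
apply: contrapT => /existsNP[j0 /eqP cj0].
case: (@arg_minP _ _ _ j0 (fun i => c i !=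
  0) (fun i => rv v (c i)) cj0) => j cj minj.
have := bind (fun i => c i / c j).
have -> : \sum_i iota (c i / c j) * b i =
  (iota (c j))^-1 * \sum_i iota (c i) * b i.
  rewrite mulr_sumr; apply: eq_bigr => i _.
  by rewrite fmorph_div mulrA (mulrC _ (iota (c i))).
rewrite sc mulr0 val_gt0 => /(_ _ isT) H.
have : c j / c j \in val_gt (rv v) 0.
  apply: H => i; have [->|ci] := eqVneq (c i) 0; first by rewrite mul0r val_ge0.
  by rewrite val_geE ?mulf_neq0 ?invr_eq0 // rvalM ?invr_eq0 // rvalV //
    subr_ge0 minj.
by rewrite divff // val_gtE ?oner_neq0 // rval1 // ltxx.
Qed.

(** As for [ext_degree_gt0]: a largest residually independent family is a basis of the residue
    field, so the default 0 is not chosen. *)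
Lemma residue_degree_gt0 : (0 < residue_degree iota w v)%N.
Proof.
rewrite /residue_degree; case: xgetP => [m _ [b [_ _ bs]]|].
  case: m => [|//] in b bs *; have [|c _] := bs 1.
    by rewrite -rv_ge0 val_ge1.
  by rewrite big_ord0 subr0 -rv_gt0 val_gtE ?oner_neq0 // rval1 // ltxx.
move=> /= no; exfalso.
have ex : exists m, `[< exists b : 'I_m -> L, residually_independent b >].
  exists 0%N; apply/asboolP; exists (fun=> 0).
  by split=> [[]|c _ _ []].
have bnd m : `[< exists b : 'I_m -> L,
  residually_independent b >] -> (m <= N)%N.
  by move=> /asboolP[b]; apply: residually_independent_bound.
case: (ex_maxnP ex bnd) => m /asboolP[b [bge bind]] maxm; apply: (no m);
  exists b.
split; first by move=> j; rewrite -rv_ge0.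
  move=> c cge; rewrite -rv_gt0 => h j; rewrite -rv_gt0; apply: bind => // i.
  by rewrite rv_ge0.
move=> z; rewrite -rv_ge0 => zge.
pose b' (j : 'I_m.+1) := oapp b z (unlift ord_max j).
have [c [cge [sc [j cj]]]] : exists c : 'I_m.+1 -> E,
    (forall j, c j \in val_ge (rv v) 0) /\
    \sum_j iota (c j) * b' j \in val_gt (rv w) 0 /\
    exists j, c j \notin val_gt (rv v) 0.
  apply: contrapT => nex; have : (m.+1 <= m)%N; last by rewrite ltnn.
  apply: maxm; apply/asboolP; exists b'; split.
    by move=> j; rewrite /b'; case: unlift.
  move=> c cge sc j; apply: contrapT => /negP cj; apply: nex.
  by exists c; split=> //; split=> //; exists j.
rewrite sum_extend in sc.
have cmax : c ord_max \notin val_gt (rv v) 0.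
  apply/negP => cm; case/negP: cj.
  have cmz : iota (c ord_max) * z \in val_gt (rv w) 0.
    by apply: (val_gt0M wP) => //; rewrite (lies_over_gt0 _ wv).
  have sc' : \sum_(k < m) iota (c (lift ord_max k)) * b k \in val_gt (rv w) 0.
    by have := val_gtD wP sc (y := - (iota (c ord_max) * z)); rewrite addrK;
      apply; rewrite val_gtN.
  have ck := bind (fun k => c (lift ord_max k)) (fun k => cge _) sc'.
  by case: (unliftP ord_max j) => [k ->|-> //].
have cm0 : c ord_max != 0 by apply: contraNneq cmax => ->; rewrite val_gt0.
have cv : rv v (c ord_max) = 0.
  apply/le_anti; move: (cge ord_max) cmax.
  by rewrite val_geE // val_gtE // -leNgt => -> ->.
have cVge : (c ord_max)^-1 \in val_ge (rv v) 0.
  by rewrite val_geE ?invr_eq0 // rvalV // cv oppr0.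
have ic0 : iota (c ord_max) != 0 by rewrite fmorph_eq0.
exists (fun k => - (c (lift ord_max k) / c ord_max)).
  by move=> k; rewrite -rv_ge0 val_geN // val_ge0M.
rewrite -rv_gt0.
have -> : z - \sum_(k < m) iota (- (c (lift ord_max k) / c ord_max)) * b k =
   (\sum_(k < m) iota (c (lift ord_max k)) * b k + iota (c ord_max) * z) *
    (iota (c ord_max))^-1.
  rewrite mulrDl mulr_suml addrC [in RHS]addrC mulrAC divff // mul1r.
  rewrite [RHS]addrC; congr (_ + _); rewrite -sumrN; apply: eq_bigr => k _.
  by rewrite rmorphN fmorph_div mulNr opprK mulrAC.
by apply: (val_gt0M wP) => //; rewrite -fmorphV (lies_over_ge0 _ wv).
Qed.

End ResidueDegree.
End FiniteExtensionValuations.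

(** * Elements integral at all places *)

Section GaussLemma.
Variables (E : fieldType) (v : E -> rat).
Hypothesis vP : rval_axiom v.
Implicit Types f g : {poly E}.

Lemma min_valuation_coef f : f != 0 -> exists i,
  [/\ f`_i != 0, forall k, f`_k \in val_ge v (v f`_i) &
      forall k, (k < i)%N -> f`_k \in val_gt v (v f`_i)].
Proof.
move=> f0; have lf0 : f`_(size f).-1 !=
  0 by rewrite -/(lead_coef f) lead_coef_eq0.
have sf : ((size f).-1 < size f)%N by rewrite ltn_predL size_poly_gt0.
pose P (i : 'I_(size f)) := f`_i != 0.
case: (@arg_minP _ _ _ (Ordinal sf) P (fun i => v f`_i) lf0) => i0 fi0 mini.
have ge k : f`_k \in val_ge v (v f`_i0).
  have [->|fk] := eqVneq f`_k 0; first exact: val_ge0.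
  have [le|lt] := leqP (size f) k; first by rewrite nth_default ?eqxx in fk.
  by rewrite val_geE //; apply: (mini (Ordinal lt)).
have ex : exists i, (f`_i != 0) && (v f`_i == v f`_i0) by exists i0;
  rewrite eqxx andbT; exact: fi0.
case: (ex_minnP ex) => i /andP[fi /eqP vi] imin; exists i; split=> //.
  by move=> k; rewrite vi.
move=> k ltki; rewrite vi; have [->|fk] := eqVneq f`_k 0; first exact: val_gt0.
rewrite val_gtE // lt_neqAle -(val_geE _ _ fk) ge andbT eq_sym.
by apply/negP => vk; have := imin k; rewrite fk vk => /(_ isT);
  rewrite leqNgt ltki.
Qed.

(** Take in each factor the first coefficient of least value. Their product dominates one
    coefficient of [f * g]. The one from [g] has value at most 0 because [g] is monic, so the one
    from [f] cannot be negative. *)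
Lemma gauss_monic_factor f g : f \is monic -> g \is monic ->
  (forall i, (f * g)`_i \in val_ge v 0) -> forall i, f`_i \in val_ge v 0.
Proof.
move=> mf mg fg.
have neg h i : h \is monic -> (forall k,
  h`_k \in val_ge v (v h`_i)) -> v h`_i <= 0.
  move=> /monicP mh /(_ (size h).-1); rewrite -/(lead_coef h) mh.
  by rewrite val_geE ?oner_neq0 // rval1.
have [i [fi fge fgt]] := min_valuation_coef (monic_neq0 mf).
have [j [gj gge ggt]] := min_valuation_coef (monic_neq0 mg).
suff vfi : 0 <= v f`_i by move=> k; apply: val_ge_le vfi (fge k).
rewrite leNgt; apply/negP => vfi.
have vij : v (f`_i * g`_j) < 0.
  by rewrite rvalM //; have := neg g j mg gge; lra.
have lti : (i < (i + j).+1)%N by rewrite ltnS leq_addr.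
pose t (k : 'I_(i + j).+1) := f`_k * g`_(i + j - k).
have tE : t (Ordinal lti) = f`_i * g`_j by rewrite /t /= addKn.
have t0 : t (Ordinal lti) != 0 by rewrite tE mulf_neq0.
have sgt : \sum_(k | k != Ordinal lti) t k \in val_gt v (v (t (Ordinal lti))).
  apply: val_gt_sum => // k ne; rewrite tE rvalM // /t.
  have : (k : nat) != i by move: ne; rewrite -val_eqE.
  rewrite neq_ltn => /orP[lt|lt]; first by apply: val_gtM => //; apply: fgt.
  rewrite mulrC addrC; apply: val_gtM => //; apply: ggt.
  by have := ltn_ord k; move: lt; lia.
have [s0 sE] := rval_dominant vP t0 sgt.
have := fg (i + j)%N; rewrite coefM (bigD1 (Ordinal lti)) //=.
by rewrite val_geE // sE tE leNgt vij.
Qed.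

End GaussLemma.

Lemma minimal_polynomial (E L : fieldType) (iota : {rmorphism E -> L}) y :
  algebraicOver iota y -> exists m : {poly E},
  [/\ m \is monic, root (map_poly iota m) y &
      forall g, root (map_poly iota g) y -> exists h, g = h * m].
Proof.
move=> [f f0 fy].
have ex : exists k, `[< exists g, [/\ g != 0,
  root (map_poly iota g) y & size g = k] >].
  by exists (size f); apply/asboolP; exists f.
case: (ex_minnP ex) => k /asboolP[g [g0 gy sg]] kmin.
have lg0 : lead_coef g != 0 by rewrite lead_coef_eq0.
exists ((lead_coef g)^-1 *: g); split.
- by rewrite monicE lead_coefZ mulVf.
- by rewrite linearZ /= rootZ // fmorph_eq0 invr_eq0.
move=> h hy; have mg : (lead_coef g)^-1 *: g \is monic by rewrite monicE
  lead_coefZ mulVf.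
set m := _ *: g in mg *.
have my : root (map_poly iota m) y by rewrite linearZ /= rootZ // fmorph_eq0
  invr_eq0.
exists (h %/ m); rewrite {1}(divp_eq h m).
suff -> : h %% m = 0 by rewrite addr0.
apply/eqP/negPn/negP => r0.
have : (k <= size (h %% m)%R)%N.
  apply: kmin; apply/asboolP; exists (h %% m); split=> //.
  have -> : h %% m = h - h %/ m * m by rewrite {2}(divp_eq h m) addrC addKr.
  rewrite rmorphB rmorphM /= rootE hornerD hornerN hornerM.
  by rewrite (rootP hy) (rootP my) mulr0 subrr.
have : (size (h %% m)%R < size m)%N by rewrite ltn_modp monic_neq0.
by rewrite size_scale ?invr_eq0 // sg => lt; rewrite leqNgt lt.
Qed.

(** The minimal polynomial is a monic factor of an integral monic one, to which Gauss's lemma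
    applies. *)
Lemma integral_minimal_polynomial (E L : fieldType) (iota : {rmorphism E -> L})
    (v : dvaluation E) y (m : {poly E}) : integral_at iota v y -> m \is monic ->
    (forall g, root (map_poly iota g) y -> exists h, g = h * m) ->
  forall i, m`_i \in val_ge (rv v) 0.
Proof.
move=> [g [mg gge gy]] mm /(_ g gy)[h gE]; have vP := rv_axiom v.
have mh : h \is monic by rewrite -(monicMr _ mm) -gE.
by apply: (gauss_monic_factor vP mm mh) => i; rewrite mulrC -gE.
Qed.

Lemma roots_repeat (L : fieldType) (g : {poly L}) (z : nat -> L) : g != 0 ->
  (forall k, root g (z k)) -> exists i j, (i < j)%N /\ z i = z j.
Proof.
move=> g0 gz; apply: contrapT => nex.
have /(max_poly_roots g0) : all (root g) (map z (seq.iota 0 (size g))).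
  by apply/allP => _ /mapP[k _ ->].
rewrite size_map size_iota ltnn => /(_ _)/notF; apply.
rewrite map_inj_in_uniq ?iota_uniq // => i j _ _ zij.
by have [lt|lt|//] := ltngtP i j; case: nex; [exists i, j | exists j, i].
Qed.

(** * Elements of finite fields *)

Section FrobeniusPeriodic.
Variables (L : fieldType) (p : nat).
Hypothesis charL : p \in [pchar L].

(** In characteristic p this means that [y] lies in a finite field, equivalently that it is
    algebraic over F_p. In this form it forces all values of a nonzero [y] to be 0. *)
Definition frobenius_periodic (y : L) := exists2 m,
  (0 < m)%N & y ^+ (p ^ m) = y.

Let pp : p.-nat p. Proof. exact: pnat_id (pcharf_prime charL). Qed.

Lemma frobeniusD m : {morph (fun x : L => x ^+ (p ^ m)) : x y / x + y}.
Proof. exact: Defs.frobD charL pp m. Qed.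

Lemma frobenius0 m : (0 : L) ^+ (p ^ m) = 0. Proof. exact: Defs.frob0 pp m. Qed.

Lemma frobenius_inj m : injective (fun x : L => x ^+ (p ^ m)).
Proof.
move=> x y /= e; apply/eqP; rewrite -subr_eq0.
have := frobeniusD m (x - y) y; rewrite /= subrK e => /eqP.
rewrite eq_sym -subr_eq0 addrK expf_eq0 => /andP[_]//.
Qed.

Lemma frobenius_iter (y : L) m k : y ^+ (p ^ m) = y -> y ^+ (p ^ (m * k)) = y.
Proof.
move=> ym; elim: k => [|k IH]; first by rewrite muln0 expn0 expr1.
by rewrite mulnS expnD exprM ym.
Qed.

Lemma frobenius_periodic_common (s : seq L) : (forall y,
  y \in s -> frobenius_periodic y) ->
  exists2 m, (0 < m)%N & forall y, y \in s -> y ^+ (p ^ m) = y.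
Proof.
elim: s => [|y s IH] sP; first by exists 1%N.
have [|m m0 mP] := IH; first by move=> z zs; apply: sP; rewrite inE zs orbT.
have [k k0 yk] := sP y (mem_head _ _).
exists (m * k)%N; first by rewrite muln_gt0 m0.
move=> z; rewrite inE => /predU1P[->|zs]; first by rewrite mulnC frobenius_iter.
by rewrite frobenius_iter ?mP.
Qed.

(** A power of Frobenius that fixes all coefficients maps roots of [g] to roots. The orbit of [y]
    therefore repeats, and injectivity of Frobenius brings the repetition back to [y]. *)
Lemma root_frobenius_periodic (g : {poly L}) y : g != 0 -> root g y ->
  (forall i, frobenius_periodic g`_i) -> frobenius_periodic y.
Proof.
move=> g0 gy gP; have [m m0 mP] : exists2 m, (0 < m)%N & forall c,
  c \in (g : seq L) -> c ^+ (p ^ m) = c.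
  by apply: frobenius_periodic_common => c /(nthP 0)[i _ <-].
have gF z : root g z -> root g (z ^+ (p ^ m)).
  move=> /rootP gz; apply/rootP; rewrite -[RHS](frobenius0 m) -gz !horner_coef.
  rewrite (big_morph _ (frobeniusD m) (frobenius0 m)); apply: eq_bigr => i _.
  by rewrite exprMn -!exprM mulnC mP // mem_nth.
pose z k := y ^+ (p ^ (m * k)).
have zS k : z k.+1 = z k ^+ (p ^ m) by rewrite /z -exprM -expnD -mulnSr.
have zroot k : root g (z k).
  elim: k => [|k IH]; first by rewrite /z muln0 expn0 expr1.
  by rewrite zS; apply: gF.
have [i [j [ltij zij]]] := roots_repeat g0 zroot.
exists (m * (j - i))%N; first by rewrite muln_gt0 m0 subn_gt0.
apply: (@frobenius_inj (m * i));
  rewrite /= -exprM -expnD -mulnDr subnK ?(ltnW ltij) //.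
Qed.

Lemma algebraic_Fp_periodic y :
  algebraicOver (fun c : 'F_p => (c : nat)%:R : L) y -> frobenius_periodic y.
Proof.
have pr := pcharf_prime charL.
move=> [g g0 gy]; apply: (root_frobenius_periodic _ gy).
  (* Elements of F_p are represented by numbers below [p], so a nonzero coefficient stays nonzero in
     [L]. *)
  apply: contra_neq g0 => mg0; apply/polyP => i; rewrite coef0.
  have := congr1 (fun h : {poly L} => h`_i) mg0; rewrite coef_map_id0 // coef0.
  move/eqP; rewrite -(dvdn_pcharf charL) => d; apply/val_inj/eqP.
  rewrite /= -leqn0 leqNgt; apply/negP => /(dvdn_leq)/(_ d).
  have lt : (nat_of_ord (g`_i)%R < p)%N by rewrite -[X in (_ < X)%N](Fp_cast pr)
    ltn_ord.
  by rewrite leqNgt lt.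
move=> i; exists 1%N => //; rewrite coef_map_id0 // expn1.
exact: (pFrobenius_aut_nat charL).
Qed.

End FrobeniusPeriodic.

Lemma generated_sub (L : fieldType) (S S' : set L) :
  (forall y, S y -> y \in generated S') ->
  forall y, y \in generated S -> y \in generated S'.
Proof.
move=> SS' y /asboolP /(_ [set y | y \in generated S']); apply; last exact: SS'.
by have [g1 gB gV] := generated_divring S'; split.
Qed.

Lemma generated_image (K L : fieldType) (j : {rmorphism K -> L}) (S : set K)
    (S' : set L) : (forall y, S y -> j y \in generated S') ->
  forall y, y \in generated S -> j y \in generated S'.
Proof.
move=> SS' y /asboolP /(_ [set y | j y \in generated S']); apply;
  last exact: SS'.
have [g1 gB gV] := generated_divring S'.
split=> [|x z /= jx jz|x z /= jx jz]; first by rewrite /= rmorph1.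
- by rewrite rmorphB gB.
- by rewrite fmorph_div gV.
Qed.

(** * Places of the finite extension K(x) *)

Section PlacesOfFiniteExtension.
Variables (p : nat) (F K : fieldType) (jF : {rmorphism F -> K}).
Variables (n : nat) (X : 'I_n -> K) (L : fieldType) (jx : {rmorphism K -> L}).
Variables (sK : seq K) (x : L).
Hypotheses (charK : p \in [pchar K]) (F_closure : is_alg_closure_Fp p jF).
Hypotheses (n_gt0 : (0 < n)%N) (X_basis : transcendence_basis jF X).
Hypothesis genK : forall y, y \in generated (set0 `|` [set` sK]).
Hypothesis genL : forall y, y \in generated (range jx `|` [set x]).
Hypothesis algL : forall y, algebraicOver jx y.

Local Notation E := (ratfield jF X).
Local Notation jE := (@sfval _ _ : {rmorphism E -> K}).
Local Notation places := (places_over jx (places_KF jF X)).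
Local Notation degree := (degree_over jx (places_KF jF X) (degree_KF jF X)).

Let evi : forall Q, mpoly.mmap jF X Q = 0 ->
  Q = 0. Proof. by case: X_basis. Qed.
Let algK : forall y : K, algebraicOver jE y. Proof. by case: X_basis. Qed.

Lemma charL : p \in [pchar L].
Proof. by rewrite (fmorph_pchar jx). Qed.

Lemma algebraic_tower y : algebraicOver (jx \o jE) y.
Proof.
have [f f0 fy] := algL y.
apply/integral_algebraic/(integral_root (p := map_poly jx f)) => //.
  by rewrite map_poly_eq0.
move=> _ /(nthP 0)[i _ <-]; rewrite coef_map; apply: integral_rmorph.
exact/integral_algebraic.
Qed.

Lemma fin_dim_K : exists N, fin_dim jE N.
Proof.
apply: (@fin_dim_generated _ _ _ sK) => // y;
  apply: generated_sub (genK y) => z [//|zs].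
by apply: sub_generated; right.
Qed.

Lemma fin_dim_L : exists N, fin_dim jx N.
Proof.
apply: (@fin_dim_generated _ _ _ [:: x]) => // y; apply: generated_sub (genL y).
move=> z [zj|->]; apply: sub_generated; first by left.
by right; rewrite /= inE.
Qed.

Lemma fin_dim_tower : exists N, fin_dim (jx \o jE) N.
Proof.
apply: (@fin_dim_generated _ _ _ (x :: map jx sK)) => [|y];
  first exact: algebraic_tower.
apply: generated_sub (genL y) => z [[c _ <-]|->]; last first.
  by apply: sub_generated; right; rewrite /= inE eqxx.
apply: generated_image (genK c) => a [//|as_]; apply: sub_generated; right.
by rewrite /= inE map_f ?orbT.
Qed.

Lemma degree_KF_gt0 u : places_KF jF X u -> 0 < degree_KF jF X u.
Proof.
move=> [v bv uv]; rewrite /degree_KF /degree_over; case: xgetP => [d _|].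
  move=> [v' [bv' uv' ->]]; have [N dN] := fin_dim_K.
  rewrite divr_gt0 ?mulr_gt0 ?ltr0n ?base_degree_gt0 ?ext_degree_gt0 //.
    by have := residue_degree_gt0 dN uv'.
  by exists N.
by move=> /= no; case: (no _ (ex_intro _ v (And3 bv uv erefl))).
Qed.

Lemma degree_gt0 w : places w -> 0 < degree w.
Proof.
move=> [u bu wu]; rewrite /degree_over; case: xgetP => [d _|].
  move=> [u' [bu' wu' ->]]; have [N dN] := fin_dim_L.
  rewrite divr_gt0 ?mulr_gt0 ?ltr0n ?degree_KF_gt0 ?ext_degree_gt0 //.
    by have := residue_degree_gt0 dN wu'.
  by exists N.
by move=> /= no; case: (no _ (ex_intro _ u (And3 bu wu erefl))).
Qed.

Lemma places_over_base w : places w -> exists2 v,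
  base_places v & lies_over (jx \o jE) w v.
Proof.
by move=> [u [v bv uv] wu]; exists v => //; apply: lies_over_comp uv wu.
Qed.

(** The intermediate place of [K] that the definition of [places] asks for is the normalized
    restriction of [w]. *)
Lemma places_of_base v w : base_places v -> lies_over (jx \o jE) w v ->
  places w.
Proof.
move=> bv wv; have [c c0 vc] := dval_uniformizer v.
have [|u wu] := @restrict_valuation _ _ jx w.
  exists (jE c); first by rewrite fmorph_eq0.
  have /lies_overP[e e0 h] := wv; rewrite (h c c0) /rv vc.
  by rewrite pmulrn_lgt0.
by exists u => //; exists v => //; apply: lies_over_descend wv wu.
Qed.

(** If [y] were nonintegral at a base place, [valuation_extension] and [discretize] would produce a
    place where it has a pole. So its minimal polynomial is integral at all base places, its
    coefficients lie in [F] by [base_integral], and [y] is algebraic over F_p. *)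
Theorem everywhere_integral_periodic y :
  (forall w, places w -> y \in val_ge (rv w) 0) -> frobenius_periodic p y.
Proof.
move=> yint; have [m [mm my mmin]] := minimal_polynomial (algebraic_tower y).
have mF i : exists c, sfval m`_i = jF c.
  apply: (base_integral evi) => // v bv; rewrite -rv_ge0.
  have [yv|nyv] := pselect (integral_at (jx \o jE) v y).
    exact: (integral_minimal_polynomial yv mm mmin).
  have [w [wP wE y0 wy]] := valuation_extension algebraic_tower nyv.
  have [N dN] := fin_dim_tower.
  have [u [uv uy]] := discretize dN wP wE.
  have := yint u (places_of_base bv uv).
  by rewrite val_geE // leNgt uy // wy.
apply: (root_frobenius_periodic charL _ my).
  by rewrite map_poly_eq0 monic_neq0.
move=> i; rewrite coef_map /=; have [c ->] := mF i.
have : algebraicOver (fun c : 'F_p => (c : nat)%:R : K) (jF c).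
  have : range jF (jF c) by exists c.
  by rewrite F_closure.
by move=> /(algebraic_Fp_periodic charK)[k k0 ck]; exists k => //;
  rewrite -rmorphXn ck.
Qed.

(** A pole of [c] lies above a pole of some coefficient of its minimal polynomial over the rational
    function field. There are finitely many such base places, each with finitely many places above
    it. *)
Lemma finite_poles (c : K) :
  finite_set [set w | places w /\ jx c \notin val_ge (rv w) 0].
Proof.
have [f [mf fc _]] := minimal_polynomial (algK c).
pose B := \bigcup_(i in `I_(size f)) [set v | base_places v /\ (v f`_i < 0)%E].
have finB : finite_set B.
  apply: bigcup_finite => [|i _]; first exact: finite_II.
  exact: (finite_base_poles evi).
have [N dN] := fin_dim_tower.
have : finite_set (\bigcup_(v in B) [set w | lies_over (jx \o jE) w v]).
  by apply: bigcup_finite => // v _; apply: finite_extensions dN v.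
apply: sub_finite_set => w [Mw wc]; have [v bv wv] := places_over_base Mw.
exists v => //; apply: contrapT => nB; case/negP: wc.
have fc' : root (map_poly (jx \o jE) f) (jx c) by rewrite map_poly_comp
  rmorph_root.
apply: (val_ge_algebraic wv mf _ fc') => i; rewrite rv_ge0 leNgt;
  apply/negP => vi.
apply: nB; exists i; last by [].
by rewrite /=; apply: contraTT vi; rewrite -leqNgt => le;
  rewrite nth_default // dval0.
Qed.

End PlacesOfFiniteExtension.

(** * Twisted polynomials *)

Section TwistedEvaluation.
Variables (K : fieldType) (p q : nat).
Variables (charK : p \in [pchar K]) (qp : p.-nat q).
Hypothesis q_gt1 : (1 < q)%N.
Local Notation twp := (twpoly charK qp).

Lemma coef_twM (f g : twp) i : ((f * g : twp) : {poly K})`_i =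
  \sum_(j < i.+1) (f : {poly K})`_j * (g : {poly K})`_(i - j) ^+ (q ^ j).
Proof. by rewrite -(Defs.coef_tw_mul qp). Qed.

Lemma tw_one : (1 : twp) = (1 : {poly K}). Proof. by []. Qed.

(** In every term but one, an index exceeds the degree of its factor. So K{tau} is a domain in which
    degrees add up. *)
Lemma tw_sum_top (f g : {poly K}) : f != 0 -> g != 0 ->
  \sum_(j < ((size f).-1 + (size g).-1).+1)
    f`_j * g`_((size f).-1 + (size g).-1 - j) ^+ (q ^ j) =
  lead_coef f * lead_coef g ^+ (q ^ (size f).-1).
Proof.
move=> f0 g0; have sf : (0 < size f)%N by rewrite size_poly_gt0.
have sg : (0 < size g)%N by rewrite size_poly_gt0.
have lti : ((size f).-1 < ((size f).-1
  + (size g).-1).+1)%N by rewrite ltnS leq_addr.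
rewrite (bigD1 (Ordinal lti)) //= addKn big1 ?addr0 // => j ne.
have : (j : nat) != (size f).-1 by move: ne; rewrite -val_eqE.
have qj j' : (0 : K) ^+ (q ^ j') = 0.
  by rewrite expr0n expn_eq0; case: q q_gt1 => [|[]].
rewrite neq_ltn => /orP[lt|gt]; last first.
  by rewrite [f`_j]nth_default ?mul0r // (leq_trans (leqSpred _) gt).
rewrite [g`__]nth_default ?qj ?mulr0 //.
move: (nat_of_ord j) lt => k; move: (size f).-1 (size g) sg => a b; lia.
Qed.

Lemma twM_neq0 (f g : twp) : f != 0 -> g != 0 -> f * g != 0.
Proof.
move=> f0 g0; apply/eqP => fg0.
have := coef_twM f g ((size (f : {poly K})).-1 + (size (g : {poly K})).-1).
rewrite fg0 (tw_sum_top f0 g0) coef0 => /esym/eqP.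
by rewrite mulf_eq0 expf_eq0 !lead_coef_eq0 (negPf f0) (negPf g0) andbF.
Qed.

Lemma size_twM (f g : twp) : f != 0 -> g != 0 ->
  size ((f * g : twp) : {poly K}) =
  (size (f : {poly K}) + size (g : {poly K})).-1.
Proof.
move=> f0 g0; have sf : (0 < size (f : {poly K}))%N by rewrite size_poly_gt0.
have sg : (0 < size (g : {poly K}))%N by rewrite size_poly_gt0.
apply/eqP; rewrite eqn_leq size_poly /=.
have nz : ((f * g : twp) : {poly K})`_((size (f : {poly K})).-1 + (size (g :
  {poly K})).-1) != 0.
  rewrite coef_twM tw_sum_top // mulf_neq0 ?expf_neq0 ?lead_coef_eq0 //.
rewrite leqNgt; apply/negP => lt; move: nz; rewrite nth_default ?eqxx //.
by move: lt; move: (size _) (size _) (size _) sf sg => a b c; lia.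
Qed.

Lemma lead_coef_twM (f g : twp) : f != 0 -> g != 0 ->
  lead_coef ((f * g : twp) : {poly K}) =
  lead_coef (f : {poly K}) * lead_coef (g : {poly K}) ^+ (q ^ (size (f :
    {poly K})).-1).
Proof.
move=> f0 g0; have sf : (0 < size (f : {poly K}))%N by rewrite size_poly_gt0.
have sg : (0 < size (g : {poly K}))%N by rewrite size_poly_gt0.
rewrite /lead_coef size_twM //.
have -> : (size (f : {poly K}) + size (g : {poly K})).-2 =
  ((size (f : {poly K})).-1 + (size (g : {poly K})).-1)%N.
  by move: (size _) (size _) sf sg => a b; lia.
by rewrite coef_twM tw_sum_top.
Qed.

Lemma size_twX (f : twp) n : f != 0 ->
  size ((f ^+ n : twp) : {poly K}) = ((size (f :
    {poly K})).-1 * n).+1 /\ f ^+ n != 0.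
Proof.
move=> f0; have sf : (0 < size (f : {poly K}))%N by rewrite size_poly_gt0.
elim: n => [|n [IH fn0]].
  by rewrite expr0 tw_one size_poly1 muln0 oner_neq0.
rewrite exprS size_twM // twM_neq0 // IH; split=> //.
by case: (size _) sf => [//|a] _; rewrite mulnS addnS addSn.
Qed.

Lemma size_twM_leq (f g : twp) : (size (((f * g)%R : twp) : {poly K}) <=
  (size (f : {poly K}) + size (g : {poly K})).-1)%N.
Proof. exact: size_poly. Qed.

Lemma size_tw_poly (f : {poly K}) : f != 0 ->
  size (tw_poly q f) = (q ^ (size f).-1).+1 /\ lead_coef (tw_poly q f) =
    lead_coef f.
Proof.
move=> f0; have [n sn] : exists n, size f = n.+1.
  by exists (size f).-1; rewrite prednK // size_poly_gt0.
rewrite /tw_poly /lead_coef sn big_ord_recr /=.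
have lf0 : f`_n != 0.
  by have := f0; rewrite -lead_coef_eq0 /lead_coef sn.
have top : size (f`_n *: 'X^(q ^ n)) = (q ^ n).+1.
  by rewrite size_scale // size_polyXn.
set s := \sum_(i < _) _.
have ss : (size s < size (f`_n *: 'X^(q ^ n)))%N.
  rewrite top ltnS; apply: (leq_trans (size_sum _ _ _));
    apply/bigmax_leqP => i _.
  apply: (leq_trans (size_scale_leq _ _)); rewrite size_polyXn.
  by rewrite ltn_exp2l.
rewrite addrC -/(lead_coef _) size_polyDl //; split=> //.
by rewrite lead_coefDl // lead_coefZ lead_coefXn mulr1.
Qed.

Lemma tw_degE (f : {poly K}) : f != 0 -> tw_deg q f = (q ^ (size f).-1)%N.
Proof. by move=> f0; rewrite /tw_deg; have [-> _] := size_tw_poly f0. Qed.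

Section Evaluation.
Variables (L : fieldType) (iota : {rmorphism K -> L}).

(** With [phi a] for [f] this is convertible to [act], so its properties transfer to the action
    directly. *)
Definition tw_eval (f : {poly K}) (y : L) :
  L := (map_poly iota (tw_poly q f)).[y].

Lemma tw_evalE (f : {poly K}) N y : (size f <= N)%N ->
  tw_eval f y = \sum_(i < N) iota f`_i * y ^+ (q ^ i).
Proof.
move=> le; rewrite /tw_eval /tw_poly rmorph_sum horner_sum.
rewrite (big_ord_widen N (fun i => (map_poly iota (f`_i *: 'X^(q ^ i))).[y]) le)
  big_mkcond.
apply: eq_bigr => i _; case: ltnP => lti;
  last by rewrite nth_default // rmorph0 mul0r.
by rewrite linearZ /= map_polyXn hornerZ hornerXn.
Qed.

Lemma frobqD j : {morph (fun x : L => x ^+ (q ^ j)) : x y / x + y}.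
Proof.
have charL : p \in [pchar L] by rewrite (fmorph_pchar iota).
exact: Defs.frobD charL qp j.
Qed.

Lemma frobq0 j : (0 : L) ^+ (q ^ j) = 0. Proof. exact: Defs.frob0 qp j. Qed.

Lemma tw_eval0 f : tw_eval f 0 = 0.
Proof.
by rewrite (tw_evalE _ (leqnn _)) big1 // => i _; rewrite frobq0 mulr0.
Qed.

Lemma tw_evalD f y z : tw_eval f (y + z) = tw_eval f y + tw_eval f z.
Proof.
rewrite !(tw_evalE _ (leqnn _)) -big_split; apply: eq_bigr => i _.
by rewrite frobqD mulrDr.
Qed.

Lemma tw_eval_addl (f g : {poly K}) y :
  tw_eval (f + g) y = tw_eval f y + tw_eval g y.
Proof.
have lf := leq_maxl (size f) (size g); have lg := leq_maxr (size f) (size g).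
have lfg := size_polyD f g.
rewrite (tw_evalE _ lfg) (tw_evalE _ lf) (tw_evalE _ lg) -big_split.
by apply: eq_bigr => i _; rewrite coefD rmorphD mulrDl.
Qed.

Lemma tw_eval_1 y : tw_eval 1 y = y.
Proof.
have s1 : (size (1%R : {poly K}) <= 1)%N by rewrite size_poly1.
by rewrite (tw_evalE _ s1) big_ord1 coef1 rmorph1 mul1r expn0 expr1.
Qed.

(** Multiplication in K{tau} is composition of additive polynomials. Both sides are sums of the same
    terms [t j k], grouped by [j + k] on the left, and terms out of range vanish. *)
Lemma tw_eval_mul (f g : twp) y :
  tw_eval ((f * g : twp) : {poly K}) y = tw_eval (f : {poly K}) (tw_eval (g :
    {poly K}) y).
Proof.
set a := size (f : {poly K}); set b := size (g : {poly K}).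
have lfg : (size (((f * g)%R : twp) : {poly K}) <= a + b)%N.
  by apply: leq_trans (size_twM_leq f g) _; apply: leq_pred.
rewrite (tw_evalE _ lfg) (tw_evalE _ (leqnn a)).
pose t (j k : nat) := iota (f : {poly K})`_j * (iota (g :
  {poly K})`_k * y ^+ (q ^ k)) ^+ (q ^ j).
transitivity (\sum_(j < a) \sum_(k < b) t j k); last first.
  apply: eq_bigr => j _; rewrite (tw_evalE _ (leqnn b)).
  by rewrite (big_morph _ (frobqD j) (frobq0 j)) mulr_sumr.
have t0 j k : (a <= j)%N || (b <= k)%N -> t j k = 0.
  rewrite /t => /orP[le|le].
    by rewrite [(f : {poly K})`_j]nth_default // rmorph0 mul0r.
  by rewrite [(g : {poly K})`_k]nth_default // rmorph0 mul0r frobq0 mulr0.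
transitivity (\sum_(i < a + b) \sum_(j < a + b | (j <= i)%N) t j (i - j)%N).
  apply: eq_bigr => i _; rewrite coef_twM rmorph_sum mulr_suml.
  rewrite (big_ord_narrow (F := fun j :
    'I_(a + b) => t j (i - j)%N) (ltn_ord i)) /=.
  apply: eq_bigr => j _; have le : (j <= i)%N by rewrite -ltnS.
  rewrite /t rmorphM rmorphXn /= exprMn -exprM -expnD subnK //.
  by rewrite mulrA.
rewrite (exchange_big_dep predT) //=.
rewrite (big_ord_widen (a + b) (fun j => \sum_(k < b) t j k)) ?leq_addr //.
rewrite [RHS]big_mkcond; apply: eq_bigr => j _.
case: ltnP => ltja; last by rewrite big1 // => i _; rewrite t0 ?ltja.
rewrite -(big_mkord (fun i => (j <= i)%N) (fun i => t j (i - j)%N)).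
have leja : (j <= a + b)%N by apply: (leq_trans (ltnW ltja)); apply: leq_addr.
rewrite (big_cat_nat (n := j)) //= [X in X + _]big_nat_cond [X in X
  + _]big1 ?add0r; last first.
  by move=> m /andP[/andP[_ lt]]; rewrite leqNgt lt.
rewrite -{1}[nat_of_ord j]add0n big_addn.
rewrite (eq_big (fun=> true) (fun k => t j k)); last 2 first.
- by move=> k; rewrite leq_addl.
- by move=> k _; rewrite addnK.
have leb : (b <= a + b - j)%N.
  by rewrite -{1}(addnK j b) leq_sub2r // -[leqRHS]addnC leq_add2l ltnW.
rewrite (big_cat_nat (n := b)) //= [X in _ + X]big_nat_cond [X in _
  + X]big1 ?addr0; last first.
  by move=> k /andP[/andP[le _] _]; rewrite t0 // le orbT.
by rewrite big_mkord.
Qed.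
End Evaluation.
End TwistedEvaluation.

(** * Algebraic dependence in the function field *)

Section TranscendenceDegreeOne.
Variables (Fq k : fieldType) (cst : {rmorphism Fq -> k}).

Definition eval_at (b : k) (h : {poly Fq}) : k := (map_poly cst h).[b].

Lemma eval_atD b g h : eval_at b (g + h) = eval_at b g + eval_at b h.
Proof. by rewrite /eval_at rmorphD hornerD. Qed.
Lemma eval_atB b g h : eval_at b (g - h) = eval_at b g - eval_at b h.
Proof. by rewrite /eval_at rmorphB hornerD hornerN. Qed.
Lemma eval_atM b g h : eval_at b (g * h) = eval_at b g * eval_at b h.
Proof. by rewrite /eval_at rmorphM hornerM. Qed.
Lemma eval_atC b c : eval_at b c%:P = cst c.
Proof. by rewrite /eval_at map_polyC hornerC. Qed.
Lemma eval_atX b : eval_at b 'X = b.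
Proof. by rewrite /eval_at map_polyX hornerX. Qed.

Section Transcendental.
Variable b : k.
Hypothesis btr : ~ algebraicOver cst b.

Lemma eval_at_neq0 h : h != 0 -> eval_at b h != 0.
Proof. by move=> h0; apply/eqP => hb; apply: btr; exists h => //;
  apply/rootP. Qed.

Lemma simple_fraction y : y \in generated (range cst `|` [set b]) ->
  exists h g, g != 0 /\ y * eval_at b g = eval_at b h.
Proof.
move=> /asboolP /(_ [set y | exists h g,
  g != 0 /\ y * eval_at b g = eval_at b h]).
apply.
- split.
  + by exists 1, 1; rewrite oner_neq0 mul1r.
  + move=> y1 y2 [h1 [g1 [g10 E1]]] [h2 [g2 [g20 E2]]].
    exists (h1 * g2 - h2 * g1), (g1 * g2); rewrite mulf_neq0 //; split=> //.
    by rewrite eval_atB !eval_atM -E1 -E2; ring.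
  + move=> y1 y2 [h1 [g1 [g10 E1]]] [h2 [g2 [g20 E2]]].
    have [->|y20] := eqVneq y2 0.
      exists 0, 1; rewrite oner_neq0 invr0 mulr0 mul0r; split=> //.
      by rewrite -polyC0 eval_atC rmorph0.
    have h20 : h2 != 0.
      apply: contra_neq y20 => h20; apply: (mulIf (eval_at_neq0 g20)).
      by rewrite E2 h20 -polyC0 eval_atC rmorph0 mul0r.
    exists (h1 * g2), (g1 * h2); rewrite mulf_neq0 //; split=> //.
    by rewrite !eval_atM -E1 -E2; field.
- move=> y' [[c _ <-]|->].
    by exists c%:P, 1; rewrite oner_neq0 -polyC1 !eval_atC rmorph1 mulr1.
  by exists 'X, 1; rewrite oner_neq0 -polyC1 eval_atC rmorph1 mulr1 eval_atX.
Qed.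

Lemma clear_denominators y :
  algebraicOver (@sfval k (range cst `|` [set b])) y ->
  exists2 G : {poly {poly Fq}}, G != 0 &
    \sum_(i < size G) eval_at b G`_i * y ^+ i = 0.
Proof.
move=> [P P0 /rootP Py].
have [g g0 gP] : exists2 g, g != 0 & forall i, exists h,
  sfval P`_i * eval_at b g = eval_at b h.
  suff [g g0 gP] : exists2 g, g != 0 & forall c, c \in (P : seq _) -> exists h,
    sfval c * eval_at b g = eval_at b h.
    exists g => // i; have [lt|le] := ltnP i (size P);
      first by apply/gP/mem_nth.
    by exists 0; rewrite nth_default //= mul0r -polyC0 eval_atC rmorph0.
  elim: (P : seq _) => [|c s [g g0 gP]]; first by exists 1; rewrite ?oner_neq0.
  have [h' [g' [g'0 E]]] := simple_fraction (valP c).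
  exists (g * g'); first by rewrite mulf_neq0.
  move=> d; rewrite inE => /predU1P[->|/gP[h hE]].
    by exists (h' * g); rewrite !eval_atM -E; ring.
  by exists (h * g'); rewrite !eval_atM -hE; ring.
have [h hP] := choice gP; pose G := \poly_(i < size P) h i.
have GE i : eval_at b G`_i = sfval P`_i * eval_at b g.
  rewrite coef_poly; case: ltnP => [_|le]; first by rewrite hP.
  by rewrite nth_default //= mul0r -polyC0 eval_atC rmorph0.
exists G.
  apply: contra_neq P0 => G0; apply/polyP => i; apply: val_inj.
  apply: (mulIf (eval_at_neq0 g0)); have := GE i.
  by rewrite G0 !coef0 -polyC0 eval_atC rmorph0 /= mul0r => <-.
have sG : (size G <= size P)%N by apply: size_poly.
have -> : \sum_(i < size G) eval_at b G`_i * y ^+ i =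
  \sum_(i < size P) eval_at b G`_i * y ^+ i.
  rewrite (big_ord_widen _ (fun i => eval_at b G`_i * y ^+ i) sG) big_mkcond.
  apply: eq_bigr => i _; case: ltnP => // le.
  by rewrite nth_default // -polyC0 eval_atC rmorph0 mul0r.
transitivity ((map_poly (@sfval _ _) P).[y] * eval_at b g);
  last by rewrite Py mul0r.
rewrite horner_coef size_map_poly mulr_suml.
by apply: eq_bigr => i _; rewrite GE coef_map mulrAC.
Qed.

End Transcendental.

Hypothesis k_curve : function_field cst.

(** By exchange the separating variable [T] is algebraic over Fq(b), hence so is [a]; clearing
    denominators gives a polynomial relation between [a] and [b]. *)
Lemma algebraic_dependence a b : ~ algebraicOver cst b ->
  exists2 G : {poly {poly Fq}}, G != 0 &
    \sum_(i < size G) eval_at b G`_i * a ^+ i = 0.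
Proof.
move=> btr; have [_ [T Ttr Talg]] := k_curve.
pose sb := (@sfval k (range cst `|` [set b]) : {rmorphism _ -> _}).
have memP h : eval_at b h \in generated (range cst `|` [set b]).
  rewrite /eval_at horner_coef rpred_sum // => i _; rewrite coef_map rpredM //.
    by apply: sub_generated; left; exists h`_i.
  by rewrite rpredX //; apply: sub_generated; right.
(* The relation of [b] over Fq(T) is read as a polynomial in [T] with coefficients in Fq[b]; [H j]
   collects the coefficient of [T ^+ j]. *)
have Tb : algebraicOver sb T.
  have [G G0 GE] := clear_denominators Ttr (Talg b).
  pose N := \max_(i < size G) size (G`_i)%R.
  have leN i : (size (G`_i)%R <= N)%N.
    have [lt|le] := ltnP i (size G); first exact: (leq_bigmax (Ordinal lt)).
    by rewrite nth_default // size_poly0.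
  pose H j := \poly_(i < size G) G`_i`_j.
  exists (\poly_(j < N) Subfield (memP (H j))).
    apply/eqP => Q0; case/eqP: G0; apply/polyP => i; apply/polyP => j;
      rewrite !coef0.
    have [ltj|lej] := ltnP j N;
      last by rewrite nth_default // (leq_trans (leN i)).
    have [lti|lei] := ltnP i (size G);
      last by rewrite [G`_i]nth_default // coef0.
    have /eqP := congr1 (fun Q : {poly _} => sfval Q`_j) Q0.
    rewrite coef_poly ltj coef0 /= => Hb.
    have : H j == 0 by apply: contraLR Hb => /(eval_at_neq0 btr).
    by move/eqP/(congr1 (fun Q : {poly Fq} => Q`_i));
      rewrite coef_poly lti coef0.
  apply/rootP; rewrite -[RHS]GE.
  rewrite (horner_coef_wide (n := N)); last by rewrite size_map_poly size_poly.
  transitivity (\sum_(j < N) \sum_(i < size G) cst G`_i`_j * b ^+ i * T ^+ j).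
    apply: eq_bigr => j _; rewrite coef_map coef_poly ltn_ord /= /eval_at.
    rewrite (horner_coef_wide (n := size G));
      last by rewrite size_map_poly size_poly.
    rewrite mulr_suml; apply: eq_bigr => i _;
      rewrite coef_map coef_poly ltn_ord //.
  rewrite exchange_big; apply: eq_bigr => i _ /=; rewrite /eval_at.
  rewrite (horner_coef_wide (n := N)); last by rewrite size_map_poly.
  by rewrite mulr_suml; apply: eq_bigr => j _; rewrite coef_map mulrAC.
have subT y : y \in generated (range cst `|` [set T]) -> algebraicOver sb y.
  move=> /asboolP /(_ [set y | algebraicOver sb y]); apply.
    split; first exact: algebraic1.
    - by move=> y1 y2; apply: algebraic_sub.
    - by move=> y1 y2; apply: algebraic_div.
  move=> _ [[c _ <-]|-> //]; rewrite -(eval_atC b).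
  by have := algebraic_id sb (Subfield (memP c%:P)).
apply: (clear_denominators btr); have [f f0 fa] := Talg a.
apply/(integral_algebraic sb)/(integral_root (p :=
  map_poly (@sfval _ _) f)) => //.
  by rewrite map_poly_eq0.
move=> _ /(nthP 0)[i _ <-]; rewrite coef_map; apply/integral_algebraic.
exact/subT/valP.
Qed.

End TranscendenceDegreeOne.

(** * Local heights *)

Lemma expr2_gt (R : realDomainType) (D : R) m : 2 <= D -> m%:R < D ^+ m.
Proof.
move=> D2; elim: m => [|m IH]; first by rewrite expr0 ltr01.
have m0 : (0 : R) <= m%:R by rewrite ler0n.
have D1 : 1 <= D ^+ m by apply: exprn_ege1; apply: le_trans D2; rewrite ler1n.
rewrite exprS -natr1; nra.
Qed.

Lemma le_div_exp_eq0 (R : archiRealFieldType) (D C x : R) : 2 <= D ->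
  (forall m, `|x| <= C / D ^+ m) -> x = 0.
Proof.
move=> D2 H; apply/eqP/negPn/negP => x0;
  have nx : 0 < `|x| by rewrite normr_gt0.
have C0 : 0 <= C.
  by have := H 0%N; rewrite expr0 divr1; apply: le_trans; apply: ltW.
have mP := archi_boundP (divr_ge0 C0 (ltW nx)).
have := lt_trans mP (expr2_gt (Num.bound (C / `|x|)) D2).
have := H (Num.bound (C / `|x|)); rewrite ler_pdivlMr ?exprn_gt0 //;
  last by lra.
by rewrite ltr_pdivrMr // mulrC leNgt => /negbTE->.
Qed.

(** * Convergence of Tate's limit *)

Section TateLimit.
Variables (R : realType) (D C : R) (x : nat -> R).
Hypotheses (D2 : 2 <= D) (xP : forall m, `|x m.+1 - D * x m| <= C).

Let u m := x m / D ^+ m.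
Let D0 : 0 < D. Proof. by move: D2; lra. Qed.
Let Dm m : 0 < D ^+ m. Proof. exact: exprn_gt0. Qed.
Let C0 : 0 <= C. Proof. by apply: le_trans (xP 0); apply: normr_ge0. Qed.

Lemma tate_step m : `|u m.+1 - u m| <= C / D ^+ m.+1.
Proof.
have -> : u m.+1 - u m = (x m.+1 - D * x m) / D ^+ m.+1.
  rewrite /u mulrBl exprS; congr (_ - _).
  by rewrite -mulf_div divff ?mul1r // gt_eqF.
rewrite normrM normfV (gtr0_norm (Dm _)) ler_pM2r ?invr_gt0 //.
Qed.

(** All steps after [m] add up to at most [C / D ^+ m], because they are bounded by a geometric
    series of ratio at most 1/2. So adding or subtracting this error makes the sequence monotone. *)
Lemma tate_upper : {homo (fun m => u m + C / D ^+ m) :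
  n m / (n <= m)%N >-> m <= n}.
Proof.
apply: homo_leq => [//|a b c ab bc|m]; first exact: le_trans bc ab.
have /ler_normlP[_] := tate_step m; rewrite exprS.
have -> : C / D ^+ m = D * (C / (D * D ^+ m)).
  by field; rewrite !gt_eqF.
have : 0 <= C / (D * D ^+ m) by rewrite divr_ge0 // mulr_ge0 // ltW.
by move: (C / _) D2 => y; nra.
Qed.

Lemma tate_lower : {homo (fun m => u m - C / D ^+ m) :
  n m / (n <= m)%N >-> n <= m}.
Proof.
apply: homo_leq => [//|a b c ab bc|m]; first exact: le_trans ab bc.
have /ler_normlP[+ _] := tate_step m; rewrite exprS.
have -> : C / D ^+ m = D * (C / (D * D ^+ m)).
  by field; rewrite !gt_eqF.
have : 0 <= C / (D * D ^+ m) by rewrite divr_ge0 // mulr_ge0 // ltW.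
by move: (C / _) D2 => y; nra.
Qed.

Lemma tate_limit k : `|lim (u @ \oo) - u k| <= C / D ^+ k.
Proof.
have CD m : 0 <= C / D ^+ m by rewrite divr_ge0 // ltW.
have cvgh : cvgn (fun m => u m + C / D ^+ m).
  apply: nonincreasing_is_cvgn; first exact: tate_upper.
  exists (u 0 - C / D ^+ 0) => _ [m _ <-];
    apply: le_trans (tate_lower (leq0n m)) _.
  by have := CD m; lra.
have cvgC : (fun m => C / D ^+ m) @ \oo --> (0 : R).
  have := @cvg_geometric R C D^-1;
    rewrite normfV (gtr0_norm D0) invf_lt1 // => /(_ _).
  have -> : geometric C D^-1 = (fun m => C / D ^+ m).
    by apply/funext => m; rewrite /= exprVn.
  by apply; move: D2; lra.
have cvgu : cvgn u.
  have -> : u = (fun m => (u m + C / D ^+ m) - C / D ^+ m).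
    by apply/funext => m; rewrite addrK.
  by apply: is_cvgB => //; apply/cvg_ex; exists 0.
rewrite ler_norml; apply/andP; split.
  rewrite lerBrDl; apply: limr_ge => //; exists k => // m /= km.
  by have := tate_lower km; have := CD m; lra.
rewrite lerBlDl; apply: limr_le => //; exists k => // m /= km.
by have := tate_upper km; have := CD m; lra.
Qed.

End TateLimit.

Section NegativePart.
Variables (L : fieldType) (w : dvaluation L).
Let wP := rv_axiom w.

Definition neg_part (z : L) : int := fine (mine 0 (w z))%E.

Lemma neg_partE z : z != 0 -> neg_part z = Num.min 0 (fine (w z)).
Proof. by move=> z0; rewrite /neg_part (dval_fine w z0) -EFin_min. Qed.

Lemma neg_part0 : neg_part 0 = 0.
Proof. by rewrite /neg_part dval0 /mine lt0y. Qed.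

Lemma neg_part_le0 z : neg_part z <= 0.
Proof.
have [->|z0] := eqVneq z 0; first by rewrite neg_part0.
by rewrite neg_partE // ge_min lexx.
Qed.

Lemma neg_part_lt0 z : z != 0 -> rv w z <= 0 -> (neg_part z)%:~R = rv w z.
Proof.
move=> z0; rewrite neg_partE // /rv lerz0 => le.
by rewrite min_r.
Qed.

Lemma neg_part_ge z c : c <= 0 -> z \in val_ge (rv w) c ->
  c <= (neg_part z)%:~R.
Proof.
move=> c0; have [->|z0] := eqVneq z 0; first by rewrite neg_part0.
by rewrite val_geE // neg_partE // /rv /Num.min; case: ifP.
Qed.

End NegativePart.

Section TwistedGrowth.
Variables (K : fieldType) (p q : nat) (charK : p \in [pchar K]) (qp : p.-nat q).
Hypothesis q_gt1 : (1 < q)%N.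
Variables (L : fieldType) (iota : {rmorphism K -> L}) (w : dvaluation L).
Let wP := rv_axiom w.
Local Notation u := (neg_part w).

(** Far below the values of the coefficients the top term dominates and the negative part is scaled
    by the degree up to a constant; elsewhere both sides are bounded. *)
Lemma tw_eval_growth (f : {poly K}) : f != 0 -> exists C : nat, forall y,
  `|u (tw_eval q iota f y) - (q ^ (size f).-1)%N%:Z * u y| <= C%:Z.
Proof.
move=> f0; have [n sn] : exists n, size f = n.+1.
  by exists (size f).-1; rewrite prednK // size_poly_gt0.
pose m := (\sum_(i < n.+1) `|fine (w (iota (f`_i)%R))|)%N.
have mP i : (i <= n)%N -> `|rv w (iota f`_i)| <= m%:R.
  move=> le; have lt : (i < n.+1)%N by [].
  rewrite /rv -intr_norm -abszE -pmulrn ler_nat.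
  by rewrite /m (bigD1 (Ordinal lt)) //= leq_addr.
set D := (q ^ n)%N; have -> : (q ^ (size f).-1)%N = D by rewrite sn.
have D1 : (1 : rat) <= D%:R by rewrite ler1n expn_gt0 ltnW.
have m0 : (0 : rat) <= m%:R by rewrite ler0n.
exists (m + 2 * m * D)%N => y.
have evE : tw_eval q iota f y = \sum_(i < n.+1) iota f`_i * y ^+ (q ^ i).
  by apply: tw_evalE; rewrite sn.
have [->|y0] := eqVneq y 0.
  by rewrite (tw_eval0 qp) // !neg_part0 mulr0 subr0 normr0.
have yX j : y ^+ j != 0 by apply: expf_neq0.
rewrite -(ler_int rat) intr_norm intrB intrM -!pmulrn.
have fn0 : f`_n != 0 by rewrite -[n]/(n.+1.-1) -sn -/(lead_coef f)
  lead_coef_eq0.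
have := neg_part_le0 w y; rewrite -(ler_int rat).
have := neg_part_le0 w (tw_eval q iota f y); rewrite -(ler_int rat).
(* Two coefficients differ in value by at most [2 * m], and [q ^ n - q ^ i] is at least 1 for
   [i < n], so the top term dominates below [- 2 * m]. *)
have [vy|vy] := ltP (rv w y) (- (2 * m%:R)); last first.
  have yge : y \in val_ge (rv w) (- (2 * m%:R)) by rewrite val_geE.
  have := neg_part_ge (_ : - (2 * m%:R) <= 0) yge;
    rewrite oppr_le0 mulr_ge0 // => /(_ isT).
  have : tw_eval q iota f y \in val_ge (rv w) (- (m%:R + 2 * m%:R * D%:R)).
    rewrite evE; apply: val_ge_sum => // i _;
      have lei : (i <= n)%N by rewrite -ltnS.
    have [->|fi0] := eqVneq f`_i 0; first by rewrite rmorph0 mul0r val_ge0.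
    have ifi : iota f`_i != 0 by rewrite fmorph_eq0.
    rewrite val_geE ?mulf_neq0 // rvalM // rvalX //.
    have /ler_normlP[h1 h2] := mP i lei.
    have qi : ((q ^ i)%N%:R : rat) <= D%:R by rewrite ler_nat leq_exp2l.
    have qi0 : (0 : rat) <= (q ^ i)%N%:R by rewrite ler0n.
    by rewrite -mulr_natr; nra.
  move/(neg_part_ge (_ : _ <= 0));
    rewrite oppr_le0 addr_ge0 ?mulr_ge0 // => /(_ isT).
  rewrite !natrD !natrM ler_norml.
  by move: ((neg_part w _)%:~R) ((neg_part w y)%:~R) => a b *; apply/andP;
    split; nra.
have ifn : iota f`_n != 0 by rewrite fmorph_eq0.
pose t (i : 'I_n.+1) := iota f`_i * y ^+ (q ^ i).
have tn0 : t ord_max != 0 by rewrite mulf_neq0.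
have wtn : rv w (t ord_max) = rv w (iota f`_n) + rv w y * D%:R.
  by rewrite /t rvalM // rvalX // mulr_natr.
have [h0 hE] : tw_eval q iota f y != 0 /\
    rv w (tw_eval q iota f y) = rv w (t ord_max).
  rewrite evE (bigD1 ord_max) //=; apply: (rval_dominant wP) => //.
  apply: val_gt_sum => // i ne; have ltin : (i < n)%N.
    by rewrite ltn_neqAle -ltnS ltn_ord andbT; apply: contra ne => /eqP e;
      apply/eqP/val_inj.
  have [->|fi0] := eqVneq f`_i 0; first by rewrite rmorph0 mul0r val_gt0.
  have ifi : iota f`_i != 0 by rewrite fmorph_eq0.
  rewrite val_gtE ?mulf_neq0 // wtn rvalM // rvalX // -mulr_natr.
  have /ler_normlP[h1 h2] := mP i (ltnW ltin).
  have /ler_normlP[h3 h4] := mP n (leqnn n).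
  have qi : ((q ^ i)%N%:R : rat) + 1 <= D%:R by rewrite natr1 ler_nat ltn_exp2l.
  by nra.
have /ler_normlP[h3 h4] := mP n (leqnn n).
move=> _ _; rewrite !neg_part_lt0 //; last 2 first.
- by lra.
- by rewrite hE wtn; nra.
rewrite hE wtn [rv w y * _]mulrC addrK (le_trans (mP n (leqnn n))) //.
by rewrite natrD lerDl ler0n.
Qed.

End TwistedGrowth.

(** * Values of a polynomial and distances to its roots *)

Section ValuationsOfRoots.
Variables (L : fieldType) (w : L -> rat) (rs : seq L).
Hypothesis wP : rval_axiom w.
Let P : {poly L} := \prod_(z <- rs) ('X - z%:P).

Lemma horner_roots y : P.[y] = \prod_(z <- rs) (y - z).
Proof. by rewrite horner_prod; apply: eq_bigr => z _; rewrite hornerXsubC. Qed.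

Lemma rval_prod_seq (s : seq L) (f : L -> L) : (forall z,
  z \in s -> f z != 0) ->
  w (\prod_(z <- s) f z) = \sum_(z <- s) w (f z).
Proof.
elim: s => [|z s IH] H; first by rewrite !big_nil rval1.
have f0 : \prod_(j <- s) f j != 0.
  by rewrite prodf_seq_neq0; apply/allP => j js; apply: H; rewrite inE js orbT.
rewrite !big_cons rvalM ?H ?mem_head // IH // => j js.
by apply: H; rewrite inE js orbT.
Qed.

(** Below all nonzero roots each factor [y - z] has the value of [y]. *)
Lemma rval_horner_dominant y : y != 0 ->
  (forall z, z \in rs -> z != 0 -> w y < w z) ->
  P.[y] != 0 /\ w P.[y] = w y * (size rs)%:R.
Proof.
move=> y0 H; have yz z : z \in rs -> y - z != 0 /\ w (y - z) = w y.
  move=> zrs; apply: rval_dominant => //; rewrite val_gtN //.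
  by have [->|z0] := eqVneq z 0; [apply: val_gt0 | rewrite val_gtE // H].
rewrite horner_roots; split.
  by rewrite prodf_seq_neq0; apply/allP => z /yz[].
rewrite rval_prod_seq; last by move=> z /yz[].
rewrite (eq_big_seq (fun=> w y)); last by move=> z /yz[].
by rewrite big_const_seq count_predT iter_addr_0 mulr_natr.
Qed.

Lemma integral_roots_coef : (forall z, z \in rs -> z \in val_ge w 0) ->
  forall i, P`_i \in val_ge w 0.
Proof.
rewrite /P; elim: rs => [|z s IH] H i.
  by rewrite big_nil coef1; case: eqP => _; [apply: val_ge1 | apply: val_ge0].
rewrite big_cons coefM; apply: val_ge_sum => // j _; apply: val_ge0M => //;
  last first.
  by apply: IH => a as_; apply: H; rewrite inE as_ orbT.
rewrite coefB coefX coefC; apply: val_geD => //.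
  by case: eqP => _; [apply: val_ge1 | apply: val_ge0].
rewrite val_geN //; case: eqP => _; last exact: val_ge0.
by apply: H; rewrite mem_head.
Qed.

Lemma minimal_root z : z \in rs -> z != 0 -> exists z0,
  [/\ z0 \in rs, z0 != 0, w z0 <= w z &
      forall z', z' \in rs -> z' != 0 -> w z0 <= w z'].
Proof.
elim: rs z => [//|a s IH] z; rewrite inE.
have [[b bs b0]|none] := pselect (exists2 b, b \in s & b != 0); last first.
  move=> zs z0; have za : z = a.
    by case/predU1P: zs => // zs; case: none; exists z.
  exists a; rewrite mem_head -za; split=> // z';
    rewrite inE => /predU1P[->|z's z'0].
    by rewrite za.
  by case: none; exists z'.
have [m [ms m0 _ mmin]] := IH b bs b0 => zs z0.
have [a0|an0] := eqVneq a 0.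
  exists m; rewrite inE ms orbT; split=> //.
    by case/predU1P: zs => [za|/mmin -> //]; rewrite za a0 eqxx in z0.
  by move=> z'; rewrite inE => /predU1P[->|/mmin//]; rewrite a0 eqxx.
have [le|lt] := leP (w m) (w a).
  exists m; rewrite inE ms orbT; split=> //.
    by case/predU1P: zs => [-> //|/mmin -> //].
  by move=> z'; rewrite inE => /predU1P[->|/mmin//].
exists a; rewrite mem_head; split=> //.
  by case/predU1P: zs => [-> //|/mmin/(_ z0)]; apply: le_trans; apply: ltW.
move=> z'; rewrite inE => /predU1P[-> //|/mmin h /h]; apply: le_trans;
  exact: ltW.
Qed.

Hypothesis addP : forall a b, P.[a + b] = P.[a] + P.[b].

(* [P.[y] ^+ 2] is the product of the [(y - z) * (y - z - z0)], and both      *)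
(* factors have nonpositive valuation, one of them at most that of [z0].      *)
Lemma close_to_root z0 y : (2 < size rs)%N -> z0 \in rs -> z0 != 0 ->
  w z0 < 0 ->
    (P.[y] != 0 -> w z0 <= w P.[y]) ->
  exists2 z, z \in rs & y - z \in val_gt w 0.
Proof.
move=> srs z0rs z0n wz0 Py; apply: contrapT => nex.
have yz z : z \in rs -> y - z != 0 /\ w (y - z) <= 0.
  move=> zrs; have /negP : ~ (y - z \in val_gt w 0) by move=> yz; apply: nex;
    exists z.
  by rewrite unfold_in /val_gt negb_or -leNgt => /andP.
have root_rs z : P.[z] = 0 -> z \in rs.
  by move=> /rootP; rewrite /P root_prod_XsubC.
have Pz z : z \in rs -> P.[z] = 0 by move=> zrs; apply/rootP;
  rewrite /P root_prod_XsubC.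
have addz z : z \in rs -> z0 + z \in rs.
  by move=> zrs; apply: root_rs; rewrite addP !Pz // addr0.
have Py0 : P.[y] != 0.
  by rewrite horner_roots prodf_seq_neq0; apply/allP => z /yz[].
have PyE : P.[y] = P.[y - z0].
  by rewrite -{1}(subrK z0 y) (addP (y - z0) z0) (Pz z0) // addr0.
have wPy : w P.[y] *+ 2 <= w z0 * (size rs)%:R.
  rewrite mulr2n {2}PyE !horner_roots !rval_prod_seq; last 2 first.
  - by move=> z zrs; rewrite -addrA -opprD; case: (yz _ (addz z zrs)).
  - by move=> z /yz[].
  have -> : w z0 * (size rs)%:R = \sum_(z <- rs) w z0.
    by rewrite big_const_seq count_predT iter_addr_0 mulr_natr.
  rewrite -big_split /= big_seq [leRHS]big_seq; apply: ler_sum => z zrs.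
  have [a0 wa] := yz z zrs; have [b0 wb] := yz _ (addz z zrs).
  have E : y - z0 - z = y - (z0 + z) by rewrite -addrA -opprD.
  rewrite E; have nb0 : - (y - (z0 + z)) != 0 by rewrite oppr_eq0.
  have z0E : z0 = (y - z) + - (y - (z0 + z)) by ring.
  have [_ /(_ _ _ a0 nb0)] := wP; rewrite -z0E => /(_ z0n).
  by rewrite ge_min (rvalN wP) => /orP[]; lra.
have := Py Py0; have s3 : (3 : rat) <= (size rs)%:R by rewrite ler_nat.
by move: wPy; rewrite mulr2n; nra.
Qed.

End ValuationsOfRoots.

Lemma integral_at_in_field (L : fieldType) (Om : fieldType) (iota :
  {rmorphism L -> Om})
    (v : dvaluation L) (c : L) :
      integral_at iota v (iota c) -> c \in val_ge (rv v) 0.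
Proof.
move=> [g [mg gge gc]]; apply: (rval_monic_root (rv_axiom v) mg gge).
by rewrite fmorph_root in gc.
Qed.

(** The inverse of a uniformizer is not integral, so [valuation_extension] applies to it. *)
Lemma extend_to_algebraic (L : fieldType) (Om : fieldType) (iota :
  {rmorphism L -> Om})
    (v : dvaluation L) : (forall z, algebraicOver iota z) ->
  exists w : Om -> rat, rval_axiom w /\ forall c, c != 0 -> w (iota c) = rv v c.
Proof.
move=> algO; have [c c0 vc] := dval_uniformizer v.
have [|w [wP wE _ _]] := @valuation_extension _ _ iota v (iota c^-1) algO.
  move=> /integral_at_in_field; rewrite val_geE ?invr_eq0 //.
  by rewrite (rvalV (rv_axiom v)) // /rv vc oppr_ge0.
by exists w.
Qed.

Lemma coef_tw_poly (K : fieldType) (q : nat) (f : {poly K}) i : (1 < q)%N ->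
  (tw_poly q f)`_(q ^ i) = f`_i.
Proof.
move=> q1; rewrite /tw_poly coef_sum.
under eq_bigr do rewrite coefZ coefXn eqn_exp2l //.
have [lt|le] := ltnP i (size f); last first.
  rewrite nth_default // big1 // => j _.
  by rewrite gtn_eqF ?mulr0 // (leq_trans (ltn_ord j)).
rewrite (bigD1 (Ordinal lt)) //= eqxx mulr1 big1 ?addr0 // => j ne.
by rewrite eq_sym -[(j : nat) == i]/(j == Ordinal lt :> nat) val_eqE (negPf ne)
  mulr0.
Qed.

HB.instance Definition _ (k : fieldType) (oo : dvaluation k) :=
  GRing.RMorphism.copy (@afun k oo) (\val : affine_ring oo -> k).

(** * Drinfeld modules and their local heights *)

Section DrinfeldModule.
Variables (p q : nat) (qp : p.-nat q).
Variables (Fq : finFieldType) (cardFq : #|{: Fq}| = q).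
Variables (k : fieldType) (cst : {rmorphism Fq -> k}) (k_curve :
  function_field cst).
Variables (oo : dvaluation k) (K : fieldType) (charK : p \in [pchar K]).
Local Notation A := (affine_ring oo).
Local Notation twp := (twpoly charK qp).
Variables (i : {rmorphism A -> K}) (phi : {rmorphism A -> twp}).
Hypothesis phi_drinfeld : drinfeld i phi.

Lemma q_gt1 : (1 < q)%N. Proof. by rewrite -cardFq finNzRing_gt1. Qed.

#[local] Hint Resolve q_gt1 : core.

Lemma q_exp : exists2 e, (0 < e)%N & q = (p ^ e)%N.
Proof.
have /p_natP[e qE] := qp; exists e => //.
by case: e qE => // qE; have := q_gt1; rewrite qE.
Qed.

Lemma charFq : p \in [pchar Fq].
Proof.
have [e _ qE] := q_exp; apply: (@card_finPcharP _ _ e);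
  last exact: pcharf_prime charK.
by rewrite cardFq.
Qed.

Lemma chark : p \in [pchar k]. Proof. by rewrite (fmorph_pchar cst) charFq. Qed.

Lemma constantX (c : Fq) : c ^+ q = c. Proof. by rewrite -cardFq expf_card. Qed.

Lemma constant_unit (c : Fq) : c != 0 -> c ^+ q.-1 = 1.
Proof.
move=> c0; apply: (mulfI c0); rewrite -exprS prednK ?mulr1 ?constantX //.
exact: ltnW q_gt1.
Qed.

(** Nonzero constants are roots of unity, so they have value 0 everywhere. *)
Lemma constant_regular (c : Fq) : cst c \in regular_away oo.
Proof.
apply/asboolP => v _; rewrite -rv_ge0; have vP := rv_axiom v.
have [->|c0] := eqVneq c 0; first by rewrite rmorph0 val_ge0.
have ic0 : cst c != 0 by rewrite fmorph_eq0.
rewrite val_geE //; have := rvalX vP q.-1 ic0.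
rewrite -rmorphXn constant_unit // rmorph1 rval1 // => /esym/eqP.
by rewrite mulrn_eq0; case: q q_gt1 => [|[|n]] //= _ /eqP->.
Qed.

Definition constA (c : Fq) : A := AffineRing (constant_regular c).

Lemma constA_zmod : zmod_morphism constA.
Proof. by move=> a b; apply: val_inj; rewrite rmorphB /= rmorphB. Qed.

Lemma constA_monoid : monoid_morphism constA.
Proof.
by split=> [|a b]; apply: val_inj;
  rewrite ?rmorph1 ?rmorphM /= ?rmorph1 ?rmorphM.
Qed.

HB.instance Definition _ := GRing.isZmodMorphism.Build Fq A constA constA_zmod.
HB.instance Definition _ := GRing.isMonoidMorphism.Build Fq A constA
  constA_monoid.

Lemma afun_horner (h : {poly Fq}) (a : A) :
  afun (map_poly constA h).[a] = (map_poly cst h).[afun a].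
Proof.
rewrite !horner_coef !size_map_poly (rmorph_sum (@afun k oo)).
by apply: eq_bigr => j _; rewrite rmorphM rmorphXn /= !coef_map.
Qed.

Lemma algebraic_periodic z : algebraicOver cst z -> frobenius_periodic p z.
Proof.
move=> [f f0 fz]; apply: (root_frobenius_periodic chark _ fz).
  by rewrite map_poly_eq0.
move=> j; have [e e0 qE] := q_exp; exists e => //.
by rewrite coef_map -rmorphXn -qE constantX.
Qed.

Lemma algebraic_torsion (a : A) : a != 0 -> algebraicOver cst (afun a) ->
  exists2 N, (0 < N)%N & a ^+ N = 1.
Proof.
move=> a0 /algebraic_periodic[m m0 am].
have p1 : (1 < p)%N by apply: prime_gt1; apply: pcharf_prime charK.
have pm : (1 < p ^ m)%N by rewrite -{1}(expn0 p) ltn_exp2l.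
have an0 : afun a != 0 by rewrite -(inj_eq val_inj) in a0.
exists (p ^ m).-1; first by case: (p ^ m)%N pm => [|[]].
apply: val_inj; rewrite rmorphXn rmorph1 /=; apply: (mulfI an0).
by rewrite -exprS prednK ?am ?mulr1 // ltnW.
Qed.

Lemma torsion_algebraic (a : A) N : (0 < N)%N -> a ^+ N = 1 ->
  algebraicOver cst (afun a).
Proof.
move=> N0 aN; exists ('X^N - 1); first by rewrite -size_poly_gt0 size_XnsubC.
rewrite rmorphB /= map_polyXn rmorph1 rootE !hornerE.
by rewrite -rmorphXn aN rmorph1 subrr.
Qed.

Lemma torsion_size (a : A) N : (0 < N)%N -> a ^+ N = 1 ->
  size (phi a : {poly K}) = 1%N.
Proof.
move=> N0 aN; have pN : phi a ^+ N = 1 by rewrite -rmorphXn aN rmorph1.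
have p0 : phi a != 0.
  apply: contra_eq_neq pN => ->; rewrite expr0n.
  by case: N N0 {aN} => // N _; rewrite /= eq_sym oner_neq0.
have [] := size_twX q_gt1 N p0; rewrite pN tw_one size_poly1 => -[/esym/eqP].
rewrite muln_eq0 (gtn_eqF N0) orbF => /eqP s1 _.
by rewrite -(prednK (_ : 0 < size _)%N) ?s1 // size_poly_gt0.
Qed.

Lemma constA_size c : c != 0 -> size (phi (constA c) : {poly K}) = 1%N.
Proof.
move=> c0; apply: (@torsion_size _ q.-1).
  by case: q q_gt1 => [|[]].
by rewrite -rmorphXn constant_unit // rmorph1.
Qed.

(* The terms of [h(phi_a)] have distinct degrees in tau. *)
Lemma phi_horner_neq0 (h : {poly Fq}) (a : A) : h != 0 ->
  (1 < size (phi a : {poly K}))%N -> phi (map_poly constA h).[a] != 0.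
Proof.
move=> h0 sa; have pa0 : phi a != 0 by rewrite -size_poly_gt0 ltnW.
set s := size (phi a : {poly K}) in sa *.
have size_term j : h`_j != 0 ->
    size (phi (constA h`_j * a ^+ j) : {poly K}) = (s.-1 * j).+1.
  move=> hj; have [sX nX] := size_twX q_gt1 j pa0.
  rewrite rmorphM rmorphXn size_twM // ?sX ?constA_size //.
  by rewrite -size_poly_gt0 constA_size.
have [n sn] : exists n, size h = n.+1.
  by exists (size h).-1; rewrite prednK // size_poly_gt0.
have hn : h`_n != 0 by rewrite -[n]/(n.+1.-1) -sn -/(lead_coef h) lead_coef_eq0.
rewrite horner_coef size_map_poly sn big_ord_recr /= coef_map /= rmorphD.
set low := phi _; set top := phi _.
have szs : (size (low : {poly K}) < size (top : {poly K}))%N.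
  rewrite /top size_term // ltnS /low rmorph_sum.
  apply: (leq_trans (size_sum _ _ _)); apply/bigmax_leqP => j _.
  rewrite coef_map /=; have [->|hj] := eqVneq h`_j 0.
    by rewrite rmorph0 mul0r rmorph0 size_poly0.
  by rewrite size_term // ltn_mul2l ltn_ord andbT; case: (s) sa => [|[]].
rewrite -size_poly_gt0.
have -> : size (low + top : {poly K}) = size (top : {poly K}).
  by rewrite addrC size_polyDl.
by rewrite /top size_term.
Qed.

(** Injectivity of [phi]. An algebraic [b] is a root of unity. For transcendental [b], take [a] with
    [phi a] of positive degree and a relation between [b] and [a]; reduced modulo [b], it makes a
    nonzero polynomial in [a] a multiple of [b], against [phi_horner_neq0]. *)
Lemma phi_neq0 (b : A) : b != 0 -> phi b != 0.
Proof.
move=> b0; apply/eqP => pb0.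
have [alg|btr] := pselect (algebraicOver cst (afun b)).
  have [N N0 bN] := algebraic_torsion b0 alg.
  by have := torsion_size N0 bN; rewrite pb0 size_poly0.
have [phi0 [a phia]] := phi_drinfeld.
have sa : (1 < size (phi a : {poly K}))%N.
  rewrite ltnNge; apply/negP => /size1_polyC pE; apply: phia.
  by rewrite {1}pE phi0.
have [G G0 GE] := algebraic_dependence k_curve (afun a) btr.
have [n leG] : exists n, forall j, (size (G`_j)%R <= n)%N.
  exists (\max_(j < size G) size (G`_j)%R) => j.
  have [lt|le] := ltnP j (size G); first exact: (leq_bigmax (Ordinal lt)).
  by rewrite nth_default // size_poly0.
elim: n G G0 GE leG => [|n IH] G G0 GE leG.
  case/eqP: G0; apply/polyP => j; rewrite coef0; apply/eqP.
  by rewrite -size_poly_eq0 -leqn0.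
pose h : {poly Fq} := \poly_(j < size G) (G`_j)`_0.
pose G' : {poly {poly Fq}} := \poly_(j < size G) drop_poly 1 G`_j.
have GjE j : G`_j = drop_poly 1 G`_j * 'X + ((G`_j)`_0)%:P.
  apply/polyP => l; rewrite coefD coefMX coefC coef_drop_poly.
  by case: l => [|l] /=; rewrite ?add0r // addn1 addr0.
have G'E j : G'`_j = drop_poly 1 G`_j.
  rewrite coef_poly; case: ltnP => // le.
  by rewrite nth_default // drop_poly0r.
(* [h] is the relation at [b = 0]. If it vanishes, a factor [b] is cancelled and the degree in [b]
   drops. *)
have [h0|h0] := eqVneq h 0.
  have hj j : (G`_j)`_0 = 0.
    have [lt|le] := ltnP j (size G); last by rewrite [G`_j]nth_default // coef0.
    by have := congr1 (fun f : {poly Fq} => f`_j) h0;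
      rewrite coef_poly lt coef0.
  have bn0 : afun b != 0 by rewrite -(inj_eq val_inj) in b0.
  apply: (IH G').
  - apply: contra_neq G0 => G'0; apply/polyP => j.
    by rewrite GjE -G'E G'0 hj !coef0 mul0r add0r polyC0.
  - have sG' : (size G' <= size G)%N by apply: size_poly.
    transitivity (\sum_(j < size G) eval_at cst (afun b) G'`_j * afun a ^+ j).
      rewrite (big_ord_widen _ (fun j => eval_at cst (afun b) G'`_j * afun a ^+
        j) sG') big_mkcond.
      apply: eq_bigr => j _; case: ltnP => // le.
      by rewrite [G'`_j]nth_default // -polyC0 eval_atC rmorph0 !mul0r.
    apply: (mulIf bn0); rewrite mul0r -[RHS]GE mulr_suml; apply: eq_bigr => j _.
    by rewrite [in RHS]GjE hj addr0 eval_atM eval_atX -G'E mulrAC.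
  - by move=> j; rewrite G'E size_drop_poly leq_subLR add1n.
have : phi (map_poly constA h).[a] != 0 by apply: phi_horner_neq0.
pose r := \sum_(j < size G) (map_poly constA (drop_poly 1 G`_j)).[b] * a ^+ j.
have -> : (map_poly constA h).[a] = - (b * r).
  apply: val_inj; apply/eqP; rewrite rmorphN -addr_eq0; apply/eqP.
  transitivity (afun (map_poly constA h).[a] + afun b * afun r).
    by rewrite -(rmorphM (@afun k oo)).
  rewrite afun_horner /r (rmorph_sum (@afun k oo)) -[RHS]GE mulr_sumr.
  have sh : (size (map_poly cst h) <=
    size G)%N by rewrite size_map_poly size_poly.
  rewrite (horner_coef_wide _ sh) -big_split; apply: eq_bigr => j _.
  rewrite (rmorphM (@afun k oo)) (rmorphXn (@afun k oo)) /= afun_horner.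
  rewrite [in RHS]GjE eval_atD eval_atM eval_atX eval_atC /eval_at.
  rewrite coef_map coef_poly ltn_ord.
  by rewrite /= mulrDl addrC mulrA (mulrC (afun b)).
by rewrite rmorphN rmorphM /= pb0 mul0r oppr0 eqxx.
Qed.

Lemma nonconstant_neq0 (a : A) : nonconstant cst a -> a != 0.
Proof. by move=> na; apply/eqP => a0; apply: na; rewrite a0;
  apply: algebraic0. Qed.

Variables (t : A) (t_nonconstant : nonconstant cst t) (r : nat).
Hypotheses (phi_t_size : size (phi t : {poly K}) = r.+1)
  (phi_t_monic : (phi t : {poly K})`_r = 1).

(** For [r = 0] monicity gives [phi t = 1], and injectivity of [phi] makes [t] the constant 1. *)
Lemma rank_gt0 : (0 < r)%N.
Proof.
rewrite lt0n; apply/eqP => r0.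
have : phi (t - 1) = 0.
  rewrite rmorphB rmorph1; apply/eqP; rewrite subr_eq0; apply/eqP.
  have /size1_polyC -> : (size (phi t :
    {poly K}) <= 1)%N by rewrite phi_t_size r0.
  by rewrite -[in X in _`_X]r0 phi_t_monic.
have [/subr0_eq t1|] := eqVneq (t - 1) 0; last by move/phi_neq0/eqP.
by case: t_nonconstant; rewrite t1; apply: algebraic1.
Qed.

#[local] Hint Resolve rank_gt0 : core.

(** If [phi a] were a constant [c], commutation with the monic [phi t] would give c^(q^r) = c. Then
    a power of [phi a] is 1, so by injectivity [a] is a root of unity, hence algebraic over Fq. *)
Lemma nonconstant_size a : nonconstant cst a -> (1 < size (phi a : {poly K}))%N.
Proof.
move=> na; have a0 := nonconstant_neq0 na; have pa0 := phi_neq0 a0.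
rewrite ltnNge; apply/negP => le1.
have sa : size (phi a : {poly K}) = 1%N.
  by apply/eqP; rewrite eqn_leq le1 size_poly_gt0.
set c := lead_coef (phi a : {poly K}).
have c0 : c != 0 by rewrite lead_coef_eq0.
have pt0 : phi t != 0 by rewrite -size_poly_gt0 phi_t_size.
have lt1 : lead_coef (phi t : {poly K}) = 1 by rewrite /lead_coef phi_t_size.
have : lead_coef (phi (a * t) : {poly K}) = lead_coef (phi (t * a) :
  {poly K}) by rewrite mulrC.
rewrite !rmorphM !lead_coef_twM // lt1 phi_t_size expr1n mulr1 mul1r /= -/c =>
  cE.
pose N := (q ^ r).-1.
have qr : (1 < q ^ r)%N by rewrite -{1}(expn0 q) ltn_exp2l // rank_gt0.
have cN : c ^+ N = 1.
  by apply: (mulfI c0); rewrite -exprS prednK ?mulr1 ?(ltnW qr).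
have pX n : phi a ^+ n != 0 /\ size (phi a ^+ n : {poly K}) = 1%N /\
    lead_coef (phi a ^+ n : {poly K}) = c ^+ n.
  elim: n => [|n [n0 [s1 lE]]].
    by rewrite !expr0 oner_neq0 tw_one size_poly1 lead_coef1.
  rewrite !exprS twM_neq0 // size_twM // lead_coef_twM //.
  by rewrite sa s1 lE expn0 expr1.
have [pn0 [s1 lE]] := pX N.
have aN : a ^+ N = 1.
  apply/eqP; rewrite -subr_eq0; apply: contrapT => /negP/phi_neq0/eqP; apply.
  rewrite rmorphB rmorph1 rmorphXn; apply/eqP; rewrite subr_eq0; apply/eqP.
  have /size1_polyC -> : (size (phi a ^+ N : {poly K}) <= 1)%N by rewrite s1.
  by move: lE; rewrite /lead_coef s1 cN /= => ->.
apply: na; apply: torsion_algebraic aN.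
by rewrite /N; case: (q ^ r)%N qr => [|[]].
Qed.

Section LocalHeight.
Variables (L : fieldType) (iota : {rmorphism K -> L}) (w : dvaluation L) (R :
  realType).
Local Notation u := (neg_part w).
Local Notation act := (act iota phi).

Lemma actM a b y : act (a * b) y = act a (act b y).
Proof. by rewrite /Defs.act rmorphM; apply: tw_eval_mul. Qed.

Lemma actD a b y : act (a + b) y = act a y + act b y.
Proof. by rewrite /Defs.act rmorphD; apply: tw_eval_addl. Qed.

Lemma act1 y : act 1 y = y.
Proof. by rewrite /Defs.act rmorph1; apply: tw_eval_1. Qed.

Definition act_deg (b : A) : nat := (q ^ (size (phi b : {poly K})).-1)%N.

Lemma act_growth b : b != 0 -> exists C : nat, forall y,
  `|(u (act b y))%:~R - (act_deg b)%:R * (u y)%:~R| <= C%:R :> R.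
Proof.
move=> /(phi_neq0) pb0.
have [C CP] := tw_eval_growth qp q_gt1 iota w pb0; exists C => y.
have := CP y; rewrite -(ler_int R) intr_norm intrB intrM -!pmulrn.
by [].
Qed.

Lemma act_deg_ge2 a : nonconstant cst a -> 2 <= (act_deg a)%:R :> R.
Proof.
move=> /(nonconstant_size).
rewrite ler_nat /act_deg => sa;
  rewrite (leq_trans q_gt1) // -{1}(expn1 q) leq_exp2l //.
by move: sa; case: (size _) => [|[]].
Qed.

(** The constant is uniform in the point [y]; this is what allows the point to be moved by the
    action afterwards. *)
Lemma local_V_bound a : nonconstant cst a -> exists C : nat, forall y m,
  `|local_V iota R phi w a y - (u (act (a ^+ m) y))%:~R / (act_deg a)%:R ^+ m|
    <= C%:R / (act_deg a)%:R ^+ m.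
Proof.
move=> na; have a0 := nonconstant_neq0 na.
have [C CP] := act_growth a0; exists C => y m.
have D2 := act_deg_ge2 na.
have xP k' : `|(u (act (a ^+ k'.+1) y))%:~R - (act_deg a)%:R * (u (act (a ^+ k')
  y))%:~R| <= C%:R :> R.
  by rewrite exprS actM; apply: CP.
have := tate_limit D2 xP m.
rewrite /local_V; set g1 := (fun m : nat => _ / _);
  set g2 := (fun m : nat => _ / _).
suff -> : g1 = g2 by [].
apply/funext => l; rewrite /g1 /g2 /=; congr (_ / _).
have pa0 := phi_neq0 a0.
have [sX nX] : size (phi (a ^+ l) : {poly K}) = ((size (phi a :
  {poly K})).-1 * l).+1 /\
    phi (a ^+ l) != 0.
  by rewrite rmorphXn; apply: size_twX.
by rewrite tw_degE // sX /act_deg /= -natrX expnM.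
Qed.

(** [b] commutes with the powers of [a], and the bounded error made by applying [phi b] disappears
    after division by the degree of [phi (a ^+ m)]. *)
Lemma local_V_act a b y : nonconstant cst a -> b != 0 ->
  local_V iota R phi w a (act b y) = (act_deg b)%:R * local_V iota R phi w a y.
Proof.
move=> na b0; have [C1 P1] := local_V_bound na; have [C2 P2] := act_growth b0.
have D2 := act_deg_ge2 na.
apply/eqP; rewrite -subr_eq0; apply/eqP.
apply: (@le_div_exp_eq0 R _ (C1%:R + C2%:R + (act_deg b)%:R * C1%:R) _ D2) => m.
have := P2 (act (a ^+ m) y); have := P1 y m; have := P1 (act b y) m.
rewrite -!actM [b * _]mulrC.
have Dm : 0 < (act_deg a)%:R ^+ m :> R by rewrite exprn_gt0 //; lra.
have b1 : 0 <= (act_deg b)%:R :> R by rewrite ler0n.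
set V' := local_V _ _ _ _ _ (act b y); set V := local_V _ _ _ _ _ y.
set x' := ((u (act (a ^+ m * b) y))%:~R : R);
  set x := ((u (act (a ^+ m) y))%:~R : R).
move: ((act_deg a)%:R ^+ m) Dm (C1%:R : R) (C2%:R : R) ((act_deg b)%:R : R) b1.
move: V V' x x' => V V' x x' E E0 c1 c2 B B0.
rewrite !ler_norml => /andP[h1 h2] /andP[h3 h4] /andP[h5 h6].
have i1 : (x' - B * x) / E <= c2 / E by rewrite ler_pM2r ?invr_gt0.
have i2 : - c2 / E <= (x' - B * x) / E by rewrite ler_pM2r ?invr_gt0.
rewrite !mulrDl -!mulrA; move: i1 i2; rewrite mulrBl -mulrA mulNr.
move: (x / E) (x' / E) (c1 / E) (c2 / E) h1 h2 h3 h4 => X X' e1 e2 *.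
by apply/andP; split; nra.
Qed.

Lemma act_exp_deg b n : phi b != 0 -> act_deg (b ^+ n) = (act_deg b ^ n)%N.
Proof.
move=> pb0; have sX : size (phi (b ^+ n) : {poly K}) = ((size (phi b :
  {poly K})).-1 * n).+1.
  by rewrite rmorphXn; have [] := size_twX q_gt1 n pb0.
by rewrite /act_deg sX expnM.
Qed.

(** The difference of [local_V] and the negative part is bounded uniformly in the point, yet it is
    multiplied by [act_deg s] at each application of [phi s]; so it cannot be positive. *)
Lemma local_V_le a y s : nonconstant cst a -> s != 0 -> (1 < act_deg s)%N ->
    (forall m, (u (act (s ^+ m) y))%:~R =
      (act_deg s)%:R ^+ m * (u y)%:~R :> R) ->
  local_V iota R phi w a y <= (u y)%:~R.
Proof.
move=> na s0 Ds sm; have [C CP] := local_V_bound na.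
have ps0 := phi_neq0 s0.
have D2 : 2 <= (act_deg s)%:R :> R by rewrite ler_nat.
rewrite leNgt; apply/negP => lt.
have pos : 0 < local_V iota R phi w a y - (u y)%:~R by rewrite subr_gt0.
suff : local_V iota R phi w a y - (u y)%:~R = 0 by lra.
apply: (@le_div_exp_eq0 R _ C%:R _ D2) => m; rewrite gtr0_norm //.
have sm0 : s ^+ m != 0.
  apply: contraTneq isT => e; have := size_twX q_gt1 m ps0.
  by rewrite -rmorphXn e rmorph0 eqxx => -[].
have := CP (act (s ^+ m) y) 0%N; rewrite !expr0 !divr1 act1 local_V_act // sm.
rewrite act_exp_deg // natrX -mulrBr => /ler_normlP[_].
by rewrite ler_pdivlMr ?exprn_gt0 1?mulrC //; lra.
Qed.

End LocalHeight.

(** * Good reduction is decided by phi_t *)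

Section GoodReduction.
Variables (L : fieldType) (iota : {rmorphism K -> L}) (v : dvaluation L).
Let vP := rv_axiom v.

(** All follows from the commutation of [phi a] with the monic [phi t]. Leading coefficients give
    c^(q^r) = c, so c has value 0. If the coefficients of [phi a] had a negative least value m, then
    [phi t * phi a] would have a coefficient of value m q^r, while those of [phi a * phi t] have
    value at least m. *)
Lemma good_reduction_generator :
  (forall j, iota (phi t : {poly K})`_j \in val_ge (rv v) 0) ->
  good_reduction iota phi v.
Proof.
move=> tint a a0; have pa0 := phi_neq0 a0.
have pt0 : phi t != 0 by rewrite -size_poly_gt0 phi_t_size.
have comm : phi a * phi t = phi t * phi a by rewrite -!rmorphM mulrC.
have lt1 : lead_coef (phi t : {poly K}) = 1 by rewrite /lead_coef phi_t_size.
have qr : (1 < q ^ r)%N by rewrite -{1}(expn0 q) ltn_exp2l.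
split; last first.
  have := congr1 (fun f : {poly K} => lead_coef f) comm.
  rewrite !lead_coef_twM // lt1 phi_t_size expr1n mulr1 mul1r /=.
  have : lead_coef (phi a : {poly K}) != 0 by rewrite lead_coef_eq0.
  move: (lead_coef _) => c c0 cE; have ic0 : iota c != 0 by rewrite fmorph_eq0.
  have := rvalX vP (q ^ r) ic0; rewrite -rmorphXn /= -cE => e.
  have : rv v (iota c) = 0.
    move: e; rewrite -mulr_natr => e.
    have : (1 : rat) < (q ^ r)%N%:R by rewrite ltr1n.
    by move=> h; nra.
  by rewrite (dval_fine v ic0) /rv => /eqP; rewrite intr_eq0 => /eqP->.
suff H j : iota (phi a : {poly K})`_j \in val_ge (rv v) 0 by move=> j;
  rewrite -rv_ge0.
pose f : {poly L} := map_poly iota (phi a : {poly K}).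
have f0 : f != 0 by rewrite map_poly_eq0.
have fE l : f`_l = iota (phi a : {poly K})`_l by rewrite coef_map.
rewrite -fE.
have [l [fl fge _]] := min_valuation_coef (rv v) f0.
suff vl : 0 <= rv v f`_l by apply: val_ge_le vl (fge j).
rewrite leNgt; apply/negP => vl.
(* In degree [r + l] the leading term of [phi t] meets the coefficient of [phi a] of least value and
   raises it to the power [q ^ r]. *)
pose n := (r + l)%N; set m := rv v f`_l in fge vl.
have bn : (phi a : {poly K})`_l != 0 by apply: contraNneq fl => b0;
  rewrite fE b0 rmorph0.
have coefE (g h : twpoly charK qp) : iota ((g * h : twpoly charK qp) :
  {poly K})`_n =
    \sum_(s < n.+1) iota (g : {poly K})`_s * iota (h :
      {poly K})`_(n - s) ^+ (q ^ s).
  by rewrite coef_twM rmorph_sum; apply: eq_bigr => s _;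
    rewrite rmorphM rmorphXn.
have ge_m : iota ((phi a * phi t : twpoly charK qp) :
  {poly K})`_n \in val_ge (rv v) m.
  rewrite coefE; apply: val_ge_sum => // s _; rewrite -[m]addr0.
  by apply: val_geM => //; [rewrite -fE | apply: val_geX].
have ltr : (r < n.+1)%N by rewrite ltnS leq_addr.
pose T (s : 'I_n.+1) := iota (phi t : {poly K})`_s * iota (phi a :
  {poly K})`_(n - s) ^+ (q ^ s).
have TE : T (Ordinal ltr) = f`_l ^+ (q ^ r).
  by rewrite /T /= phi_t_monic rmorph1 mul1r /n addKn fE.
have T0 : T (Ordinal ltr) != 0 by rewrite TE expf_neq0.
have Tv : rv v (T (Ordinal ltr)) = m * (q ^ r)%N%:R.
  by rewrite TE rvalX // mulr_natr.
have qr1 : (1 : rat) < (q ^ r)%N%:R by rewrite ltr1n.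
have others : \sum_(s | s != Ordinal ltr) T s \in val_gt (rv v) (rv v (T
  (Ordinal ltr))).
  apply: val_gt_sum => // s ne.
  have [lts|ges] := ltnP s r; last first.
    have gts : (r < s)%N.
      by rewrite ltn_neqAle ges andbT eq_sym; apply: contra ne => /eqP e;
        apply/eqP/val_inj.
    by rewrite /T [(phi t : {poly K})`_s]nth_default ?phi_t_size // rmorph0
      mul0r val_gt0.
  have h : T s \in val_ge (rv v) (m * (q ^ s)%N%:R).
    rewrite /T -[X in val_ge _ X]add0r; apply: val_geM => //.
    have [b0|b0] := eqVneq (iota (phi a : {poly K})`_(n - s)) 0.
      by rewrite b0 expr0n expn_eq0; case: (q) q_gt1 => [|[|q']] //= _;
        rewrite val_ge0.
    rewrite val_geE ?expf_neq0 // rvalX // -[rv v _ *+ _]mulr_natr.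
    have := fge (n - s)%N; rewrite fE val_geE // => le.
    by apply: ler_wpM2r.
  have [->|Ts0] := eqVneq (T s) 0; first exact: val_gt0.
  rewrite val_gtE // Tv; rewrite val_geE // in h; apply: lt_le_trans h.
  by rewrite ltr_nM2l // ltr_nat ltn_exp2l.
have [n0 e] := rval_dominant vP T0 others.
have sE : T (Ordinal ltr) + \sum_(s | s != Ordinal ltr) T s =
    iota ((phi a * phi t : twpoly charK qp) : {poly K})`_n.
  have -> : (phi a * phi t : twpoly charK qp) = phi t * phi a := comm.
  by rewrite coefE [RHS](bigD1 (Ordinal ltr)).
rewrite sE in n0 e; rewrite Tv in e.
by move: ge_m; rewrite val_geE // e; nra.
Qed.
End GoodReduction.

(** * The pigeonhole argument for points of small height *)

Section MainArgument.
Variable R : realType.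
Variables (L : fieldType) (jx : {rmorphism K -> L}).
Variables (Om : closedFieldType) (sv : {rmorphism L -> Om}).
Hypothesis algO : forall z, algebraicOver sv z.
Variable M : set (dvaluation L).
Hypothesis M_integral : forall y, (forall w, M w -> y \in val_ge (rv w) 0) ->
  frobenius_periodic p y.
Hypothesis M_poles : forall c : K,
  finite_set [set w | M w /\ jx c \notin val_ge (rv w) 0].
Variable x : L.
Hypothesis x_nontorsion : forall a : A, a != 0 -> act jx phi a x != 0.

Local Notation S := [set v | M v /\ ~ good_reduction jx phi v].
Local Notation act := (act jx phi).
Let charL : p \in [pchar L]. Proof. by rewrite (fmorph_pchar jx). Qed.

Lemma bad_coefficient v : S v ->
  exists2 j, (j < r)%N & jx (phi t : {poly K})`_j \notin val_ge (rv v) 0.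
Proof.
move=> [_ nv]; apply: contrapT => nex; apply: nv.
apply: good_reduction_generator => j.
have [lt|] := ltnP j r.
  by apply: contrapT => /negP nj; apply: nex; exists j.
rewrite leq_eqVlt => /predU1P[<-|lt].
  by rewrite phi_t_monic rmorph1; apply: val_ge1 (rv_axiom v).
by rewrite nth_default ?phi_t_size // rmorph0; apply: val_ge0.
Qed.

(** A bad place is a pole of a coefficient of [phi t]. Finiteness also ensures that [fset_set S] has
    the elements of [S] and is not the default empty set. *)
Lemma finite_bad : finite_set S.
Proof.
have : finite_set (\bigcup_(j in `I_r) [set v | M v /\
    jx (phi t : {poly K})`_j \notin val_ge (rv v) 0]).
  by apply: bigcup_finite => [|j _]; [exact: finite_II | exact: M_poles].
apply: sub_finite_set => v Sv; have [j ltj nj] := bad_coefficient Sv.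
by exists j => //; case: Sv.
Qed.

Definition at_t (h : {poly Fq}) : A := (map_poly (constA) h).[t].

Lemma at_tB g h : at_t (g - h) = at_t g - at_t h.
Proof. by rewrite /at_t rmorphB hornerD hornerN. Qed.

Lemma at_tMX (h : {poly Fq}) n : at_t (h * 'X^n) = t ^+ n * at_t h.
Proof. by rewrite /at_t rmorphM /= map_polyXn hornerM hornerXn mulrC. Qed.

Lemma at_t1 : at_t 1%R = 1.
Proof. by rewrite /at_t rmorph1 hornerC. Qed.

Lemma at_t_neq0 (h : {poly Fq}) : h != 0 -> at_t h != 0.
Proof.
move=> h0; apply/eqP => /(congr1 (@afun k oo));
  rewrite afun_horner rmorph0 => ht.
by apply: t_nonconstant; exists h => //; apply/rootP.
Qed.

Lemma size_at_t (h : {poly Fq}) n : (size h <= n.+1)%N ->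
  (size (phi (at_t h) : {poly K}) <= (r * n).+1)%N.
Proof.
move=> sh; have pt0 : phi t != 0 by rewrite -size_poly_gt0 phi_t_size.
have sh' : (size (map_poly (constA) h) <= n.+1)%N.
  by apply: leq_trans (size_poly _ _) sh.
rewrite /at_t (horner_coef_wide _ sh') rmorph_sum.
apply: (leq_trans (size_sum _ _ _)); apply/bigmax_leqP => j _.
rewrite coef_map /=; have [->|hj] := eqVneq h`_j 0.
  by rewrite rmorph0 mul0r rmorph0 size_poly0.
have sX : size (phi (t ^+ j) : {poly K}) = (r * j).+1.
  by rewrite rmorphXn; have [-> _] := size_twX q_gt1 j pt0; rewrite phi_t_size.
have cn0 : constA h`_j != 0 by rewrite fmorph_eq0.
have tX0 : phi (t ^+ j) != 0 by rewrite -size_poly_gt0 sX.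
rewrite rmorphM size_twM // ?phi_neq0 // constA_size // sX /=.
by rewrite ltnS leq_mul2l -ltnS ltn_ord orbT.
Qed.

Definition orbit_point h : L := act (at_t h) x.

Lemma act_opp a y : act (- a) y = - act a y.
Proof.
apply/eqP; rewrite -addr_eq0 -(actD jx) addNr /Defs.act rmorph0.
by rewrite /tw_poly size_poly0 big_ord0 map_poly0 horner0.
Qed.

Lemma orbit_pointB g h : orbit_point (g - h) = orbit_point g - orbit_point h.
Proof. by rewrite /orbit_point at_tB (actD jx) act_opp. Qed.

Lemma orbit_pointMX (h : {poly Fq}) n :
  orbit_point (h * 'X^n) = act (t ^+ n) (orbit_point h).
Proof. by rewrite /orbit_point at_tMX (actM jx). Qed.

Lemma orbit_point_neq0 (h : {poly Fq}) : h != 0 -> orbit_point h != 0.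
Proof. by move=> /at_t_neq0; apply: x_nontorsion. Qed.

Definition action_poly (a : A) :
  {poly Om} := map_poly (sv \o jx) (tw_poly q (phi a)).

Lemma sv_act a y : sv (act a y) = (action_poly a).[sv y].
Proof. by rewrite /Defs.act -horner_map -map_poly_comp. Qed.

Lemma action_polyD a y z : (action_poly a).[y + z] =
  (action_poly a).[y] + (action_poly a).[z].
Proof. exact: (tw_evalD charK qp (sv \o jx) (phi a)). Qed.

Lemma action_poly0 a : (action_poly a).[0] = 0.
Proof. exact: (tw_eval0 qp (sv \o jx)). Qed.

Lemma action_polyM a b y : (action_poly (a * b)).[y] =
  (action_poly a).[(action_poly b).[y]].
Proof. by rewrite /action_poly rmorphM; exact: (tw_eval_mul (sv \o jx)). Qed.

Lemma action_poly_roots a : a != 0 -> lead_coef (phi a : {poly K}) = 1 ->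
  exists rs : seq Om, action_poly a = \prod_(z <- rs) ('X - z%:P) /\
    size rs = act_deg a.
Proof.
move=> /phi_neq0 pa0 l1; have [sP lP] := size_tw_poly q_gt1 pa0.
have [rs E] := closed_field_poly_normal (action_poly a).
have lead1 : lead_coef (action_poly a) =
  1 by rewrite lead_coef_map lP l1 rmorph1.
exists rs; rewrite {1}E lead1 scale1r; split=> //.
have : size (action_poly a) = (act_deg a).+1 by rewrite size_map_poly sP.
by rewrite E lead1 scale1r size_prod_XsubC => -[].
Qed.

Lemma t_neq0 : t != 0. Proof. exact: nonconstant_neq0 t_nonconstant. Qed.

Lemma lead_phi_t : lead_coef (phi t : {poly K}) = 1.
Proof. by rewrite /lead_coef phi_t_size. Qed.

Lemma act_deg_t : act_deg t = (q ^ r)%N.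
Proof. by rewrite /act_deg phi_t_size. Qed.

Section OnePlace.
Variables (v : dvaluation L) (w : Om -> rat).
Hypotheses (wP : rval_axiom w) (wE : forall c, c != 0 -> w (sv c) = rv v c).

(* Below all roots of [phi_t] the valuation is multiplied by [q ^ r] at each  *)
(* application of [phi_t], so it computes the local height.                   *)
Lemma local_V_small a z : nonconstant cst a -> z != 0 -> rv v z < 0 ->
    (forall z', (action_poly t).[z'] = 0 -> z' != 0 -> w (sv z) < w z') ->
  local_V jx R phi v a z <= (neg_part v z)%:~R.
Proof.
move=> na z0 vz H; have [rs [E srs]] := action_poly_roots t_neq0 lead_phi_t.
have D1 : (1 < act_deg t)%N by rewrite act_deg_t -{1}(expn0 q) ltn_exp2l.
have D1' : (1 : rat) < (act_deg t)%:R by rewrite ltr1n.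
have svz0 : sv z != 0 by rewrite fmorph_eq0.
have iter m : act (t ^+ m) z != 0 /\
    rv v (act (t ^+ m) z) = rv v z * (act_deg t)%:R ^+ m.
  elim: m => [|m [zm0 zmE]]; first by rewrite !expr0 mulr1 (act1 jx).
  have szm0 : sv (act (t ^+ m) z) != 0 by rewrite fmorph_eq0.
  have wzm : w (sv (act (t ^+ m) z)) <= w (sv z).
    rewrite !wE // zmE; have : 1 <= (act_deg t)%:R ^+ m :> rat.
      by rewrite exprn_ege1 // ltW.
    by move=> h; nra.
  have [|P0 wPz] := rval_horner_dominant (rs := rs) wP szm0.
    move=> z' z'rs z'0; apply: le_lt_trans wzm (H z' _ z'0).
    by rewrite E; apply/rootP; rewrite root_prod_XsubC.
  rewrite -E -sv_act -(actM jx) -exprS in P0 wPz.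
  have n0 : act (t ^+ m.+1) z != 0 by rewrite fmorph_eq0 in P0.
  split=> //; rewrite -wE // wPz wE // zmE srs exprS.
  by rewrite -mulrA [X in _ * X]mulrC.
apply: (local_V_le na t_neq0) => // m.
have [zm0 zmE] := iter m.
have zmlt : rv v (act (t ^+ m) z) <= 0.
  by rewrite zmE; have : 0 <= (act_deg t)%:R ^+ m :> rat;
    [rewrite exprn_ge0|nra].
apply/eqP; rewrite -natrX pmulrn -intrM eqr_int -(eqr_int rat) intrM -pmulrn
  natrX.
by rewrite !neg_part_lt0 ?(ltW vz) // zmE mulrC.
Qed.

Lemma sv_ge0 c : (sv c \in val_ge w 0) = (c \in val_ge (rv v) 0).
Proof.
have [->|c0] := eqVneq c 0; first by rewrite rmorph0 !val_ge0.
by rewrite !val_geE ?fmorph_eq0 // wE.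
Qed.

Lemma sv_gt0 c : (sv c \in val_gt w 0) = (c \in val_gt (rv v) 0).
Proof.
have [->|c0] := eqVneq c 0; first by rewrite rmorph0 !val_gt0.
by rewrite !val_gtE ?fmorph_eq0 // wE.
Qed.

Lemma integral_root_good z : (forall j,
  jx (phi t : {poly K})`_j \in val_ge (rv v) 0) ->
  (action_poly t).[z] = 0 -> z \in val_ge w 0.
Proof.
move=> tint /rootP Pz; have [sP lP] := size_tw_poly q_gt1 (phi_neq0 t_neq0).
have mP : action_poly t \is monic.
  by rewrite monicE lead_coef_map lP lead_phi_t rmorph1.
apply: (rval_monic_root wP mP _ Pz) => l;
  rewrite coef_map /= sv_ge0 /tw_poly coef_sum.
rewrite rmorph_sum; apply: (val_ge_sum (rv_axiom v)) => j _.
rewrite coefZ coefXn rmorphM; apply: (val_ge0M (rv_axiom v)) => //.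
by case: eqP => _; rewrite ?rmorph1 ?rmorph0;
  [apply: val_ge1 (rv_axiom v) | apply: val_ge0].
Qed.

(** If all roots of [phi t] were integral, so would be its coefficients, which are symmetric
    functions of the roots up to sign. *)
Lemma bad_root : S v -> exists2 z, (action_poly t).[z] = 0 & z != 0 /\ w z < 0.
Proof.
move=> /bad_coefficient[j ltj]; apply: contraNP => nex.
have [rs [E _]] := action_poly_roots t_neq0 lead_phi_t.
rewrite -sv_ge0 -(coef_tw_poly _ j q_gt1) -[sv _]/((sv \o jx) _) -coef_map
  -/(action_poly t) E.
apply: integral_roots_coef => // z zrs; rewrite unfold_in /val_ge.
have [//|z0] := eqVneq z 0; rewrite /= leNgt; apply/negP => wz; apply: nex;
  exists z => //.
by rewrite E; apply/rootP; rewrite root_prod_XsubC.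
Qed.

End OnePlace.

(* The points [phi_t^m(x)] all lie in one finite field, so two of them agree.  *)
Lemma periodic_torsion : (forall j,
  frobenius_periodic p (jx (phi t : {poly K})`_j)) ->
  ~ frobenius_periodic p x.
Proof.
move=> tper xper; pose cs := [seq jx (phi t :
  {poly K})`_j | j <- seq.iota 0 r.+1].
have [|e e0 eP] := @frobenius_periodic_common L p (x :: cs).
  by move=> y; rewrite inE => /predU1P[->//|/mapP[j _ ->]].
pose Q := (p ^ e)%N.
have Q1 : (1 < Q)%N by rewrite -{1}(expn0 p) ltn_exp2l // prime_gt1 //
  (pcharf_prime charK).
pose z m := act (t ^+ m) x.
have zQ m : z m ^+ Q = z m.
  elim: m => [|m IH]; first by rewrite /z expr0 (act1 jx) eP ?mem_head.
  have -> : z m.+1 = tw_eval q jx (phi t : {poly K}) (z m).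
    by rewrite /z exprS (actM jx).
  have st : (size (phi t : {poly K}) <= r.+1)%N by rewrite phi_t_size.
  rewrite (tw_evalE _ _ _ st) (big_morph _ (frobeniusD charL e) (frobenius0
    charL e)).
  apply: eq_bigr => j _; rewrite exprMn -exprM mulnC exprM IH eP //.
  by rewrite inE; apply/orP; right; apply/mapP; exists (j : nat);
    rewrite ?mem_iota /=.
have g0 : 'X^Q - 'X != 0 :> {poly L}.
  by rewrite -size_poly_gt0 size_polyDl ?size_polyN size_polyXn // size_polyX.
have gz k' : root ('X^Q - 'X) (z k').
  by rewrite rootE hornerD hornerN hornerXn hornerX zQ subrr.
have [a [b [ltab zab]]] := roots_repeat g0 gz.
have h0 : ('X^b - 'X^a : {poly Fq}) != 0.
  rewrite -size_poly_gt0 size_polyDl ?size_polyN ?size_polyXn //.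
have := orbit_point_neq0 h0; rewrite orbit_pointB.
have zE m : orbit_point 'X^m = z m.
  by rewrite -['X^m]mul1r orbit_pointMX /orbit_point at_t1 (act1 jx).
by rewrite !zE zab subrr eqxx.
Qed.

Local Notation sS := #|` fset_set S|.
Local Notation N := (2 + (r ^ 2 + r) * sS)%N.
Local Notation C := (q%:R ^- (r * N) : R).
(** The element [a] may depend on the place, since the conclusion to be refuted quantifies over all
    nonconstant [a]. *)
Hypothesis small_heights : forall v, M v ->
  exists2 a, nonconstant cst a & - C <= local_V jx R phi v a x.

Lemma orbit_height v a (h : {poly Fq}) n : nonconstant cst a ->
    - C <= local_V jx R phi v a x -> h != 0 -> (size h <= n.+1)%N ->
  - (q%:R ^+ (r * n) * C) <= local_V jx R phi v a (orbit_point h).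
Proof.
move=> na hV h0 sh; have b0 := at_t_neq0 h0.
rewrite /orbit_point local_V_act //.
have qr0 : 0 < q%:R :> R by rewrite ltr0n ltnW.
have C0 : 0 <= C by rewrite invr_ge0 exprn_ge0 // ltW.
have D0 : 0 <= (act_deg (at_t h))%:R :> R by rewrite ler0n.
have Dle : (act_deg (at_t h))%:R <= q%:R ^+ (r * n) :> R.
  rewrite -natrX ler_nat /act_deg leq_exp2l //.
  by have := size_at_t sh; case: (size _).
by nra.
Qed.

(** The degree of phi_(h(t)) is at most q^(r (N - 1)), which leaves a factor q^(- r) < 1. *)
Lemma orbit_height_gt v a (h : {poly Fq}) : nonconstant cst a ->
    - C <= local_V jx R phi v a x -> h != 0 -> (size h <= N)%N ->
  -1 < local_V jx R phi v a (orbit_point h).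
Proof.
move=> na hV h0 sh; apply: lt_le_trans (orbit_height na hV h0 (n := N.-1) _);
  last by [].
have qr0 : 0 < q%:R :> R by rewrite ltr0n ltnW.
rewrite ltrN2 ltr_pdivrMr ?exprn_gt0 // mul1r.
rewrite ltr_eXn2l ?ltr1n // ltn_mul2l rank_gt0 /=; lia.
Qed.

(** One more coefficient uses up the whole margin and leaves a weak inequality, which serves the
    case [m = 2]. *)
Lemma orbit_height_ge v a (h : {poly Fq}) : nonconstant cst a ->
    - C <= local_V jx R phi v a x -> h != 0 -> (size h <= N.+1)%N ->
  -1 <= local_V jx R phi v a (orbit_point h).
Proof.
move=> na hV h0 sh; apply: le_trans (orbit_height na hV h0 sh).
have qr0 : 0 < q%:R :> R by rewrite ltr0n ltnW.
by rewrite divff // expf_neq0 // gt_eqF.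
Qed.

Lemma neg_part_fine (v : dvaluation L) z : z != 0 -> rv v z < 0 ->
  neg_part v z = fine (v z) /\ fine (v z) <= -1.
Proof.
move=> z0; rewrite /rv ltrz0 => vz; rewrite neg_partE // (min_r (ltW vz)).
by split; [|move: vz; lia].
Qed.

(** The roots of [phi t] are integral at a good place, so a pole lies below all of them and
    [local_V_small] would give a [local_V] of at most -1. *)
Lemma good_orbit_integral v (h : {poly Fq}) : M v -> ~ S v -> (size h <= N)%N ->
  orbit_point h \in val_ge (rv v) 0.
Proof.
move=> Mv nS sh; have [->|h0] := eqVneq h 0.
  by rewrite -(subrr 0) orbit_pointB subrr val_ge0.
have y0 := orbit_point_neq0 h0; rewrite val_geE // leNgt; apply/negP => vy.
have gv : good_reduction jx phi v by apply: contrapT => ng; apply: nS.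
have tint j : jx (phi t : {poly K})`_j \in val_ge (rv v) 0.
  by rewrite rv_ge0; case: (gv t t_neq0).
have [w [wP wE]] := extend_to_algebraic v algO.
have [a na hV] := small_heights Mv.
have := orbit_height_gt na hV h0 sh.
have [nE nle] := neg_part_fine y0 vy.
have := local_V_small wP wE na y0 vy; rewrite nE => lV.
have /lV le : forall z', (action_poly t).[z'] = 0 -> z' != 0 ->
  w (sv (orbit_point h)) < w z'.
  move=> z' Pz z'0; rewrite wE //; apply: lt_le_trans vy _.
  by rewrite -val_geE //; apply: (integral_root_good wP wE tint).
have : (fine (v (orbit_point h)))%:~R <= (-1)%:~R :> R by rewrite ler_int.
by rewrite mulrN1z => le1; lra.
Qed.

(** Without bad places [x] and the coefficients of [phi t] are integral everywhere, hence in a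
    finite field, and [periodic_torsion] applies. *)
Lemma bad_place_exists : S !=set0.
Proof.
apply: contrapT => nS; have good v : M v -> ~ S v by move=> Mv Sv; apply: nS;
  exists v.
have x1 : x = orbit_point 1%R by rewrite /orbit_point at_t1 (act1 jx).
apply: periodic_torsion => [j|]; last first.
  apply: M_integral => v Mv; rewrite x1; apply: good_orbit_integral => //.
    exact: good.
  by rewrite size_poly1.
apply: M_integral => v Mv; rewrite rv_ge0.
have gv : good_reduction jx phi v by apply: contrapT => ng; apply: (good v Mv).
by case: (gv t t_neq0).
Qed.

(* For [q ^ r = 2] the polynomial [phi_t] has too few roots for               *)
(* [close_to_root], so [t ^+ 2] is used in place of [t].                      *)
Let m := if (q ^ r == 2)%N then 2%N else 1%N.

Let lead_tm : lead_coef (phi (t ^+ m) : {poly K}) = 1.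
Proof.
rewrite /m; case: eqP => _; last by rewrite expr1 lead_phi_t.
by rewrite exprS expr1 rmorphM lead_coef_twM ?phi_neq0 ?t_neq0 // lead_phi_t
  expr1n mulr1.
Qed.

Let tm0 : t ^+ m != 0.
Proof.
rewrite -[t ^+ m]mulr1 -at_t1 -at_tMX; apply: at_t_neq0.
by rewrite mul1r -size_poly_gt0 size_polyXn.
Qed.

Lemma rank_one : (q ^ r = 2)%N -> q = 2%N /\ r = 1%N.
Proof.
move: rank_gt0 q_gt1; clear; case: r => [//|r'] _ q_gt1; rewrite expnS => qE.
case: r' => [|r'] in qE *; first by rewrite muln1 in qE.
have : (2 * 2 <= q * q ^ r'.+1)%N.
  by apply: leq_mul => //; apply: (leq_trans q_gt1);
    rewrite -{1}(expn1 q) leq_exp2l.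
by rewrite qE.
Qed.

Lemma act_deg_tm : (act_deg (t ^+ m) = q ^ (r * m))%N.
Proof. by rewrite (act_exp_deg) ?phi_neq0 ?t_neq0 // act_deg_t -expnM. Qed.

Lemma act_deg_tm_gt2 : (2 < act_deg (t ^+ m))%N.
Proof.
rewrite act_deg_tm /m; case: eqP => [/rank_one[-> ->] //|ne].
rewrite muln1 ltn_neqAle eq_sym; apply/andP; split; first exact/eqP.
by rewrite (leq_trans q_gt1) // -{1}(expn1 q) leq_exp2l.
Qed.

Lemma action_root_tm z : (action_poly t).[z] = 0 ->
  (action_poly (t ^+ m)).[z] = 0.
Proof.
move=> tz; rewrite /m; case: eqP => _; last by rewrite expr1.
by rewrite exprS expr1 action_polyM tz action_poly0.
Qed.

(** Here phi_t is c + tau with q = 2, so -c is a root, and the integer value of c is negative at a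
    bad place. This extra unit makes up for the weak bound of [orbit_height_ge]. *)
Lemma rank_one_root v w : rval_axiom w -> (forall c,
  c != 0 -> w (sv c) = rv v c) ->
    S v -> (q ^ r = 2)%N -> exists z,
  [/\ (action_poly t).[z] = 0, z != 0 & w z <= (-1)%:~R].
Proof.
move=> wP wE Sv /rank_one[q2 r1]; have [j ltj nj] := bad_coefficient Sv.
have j0 : j = 0%N by move: ltj; rewrite r1; case: (j).
set c := jx (phi t : {poly K})`_j in nj; have c0 : c != 0.
  by apply: contraNneq nj => ->; rewrite val_ge0.
exists (- sv c); split; last 2 first.
- by rewrite oppr_eq0 fmorph_eq0.
- rewrite rvalN // wE // /rv ler_int.
  by move: nj; rewrite val_geE // /rv ler0z; lia.
have st : (size (phi t : {poly K}) <= 2)%N by rewrite phi_t_size r1.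
transitivity (tw_eval q (sv \o jx) (phi t : {poly K}) (- sv c)) => //.
rewrite (tw_evalE _ _ _ st) 2!big_ord_recl big_ord0 addr0 /= expn0 expr1.
have p1 : (phi t : {poly K})`_1 = 1 by move: phi_t_monic; rewrite r1.
have qE : (- sv c) ^+ q = sv c * sv c by move: (sv c) => d;
  rewrite q2 expr2 mulrNN.
by rewrite -[bump 0 0]/1%N expn1 p1 !rmorph1 mul1r qE -j0 -/c mulrN addNr.
Qed.

(** Let [z0] be a nonzero root of least value. If the image of the point under [t ^+ m] had smaller
    value than [z0], it would lie below all nonzero roots of [phi t], and [local_V_small] would
    contradict the height bounds. So the image is not below [z0], and [close_to_root] applies. *)
Lemma near_root v w (h : {poly Fq}) (rs : seq Om) : rval_axiom w ->
    (forall c, c != 0 -> w (sv c) = rv v c) -> S v -> (size h <= N.-1)%N ->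
    action_poly (t ^+ m) = \prod_(z <- rs) ('X - z%:P) ->
    size rs = act_deg (t ^+ m) ->
  exists2 z, z \in rs & sv (orbit_point h) - z \in val_gt w 0.
Proof.
move=> wP wE Sv sh E srs.
have rsP z : (action_poly (t ^+ m)).[z] = 0 <-> z \in rs.
  by rewrite E -root_prod_XsubC; split=> /rootP.
have [z1 Pz1 [z10 wz1]] := bad_root wP wE Sv.
have [z0 [z0rs z00 le01 minz0]] :=
  minimal_root w ((rsP z1).1 (action_root_tm Pz1)) z10.
have wz0 : w z0 < 0 by apply: le_lt_trans wz1.
apply: (close_to_root wP _ _ z0rs z00 wz0).
- by move=> a b; rewrite -E action_polyD.
- by rewrite srs act_deg_tm_gt2.
rewrite -E -sv_act -orbit_pointMX fmorph_eq0 => y0; rewrite leNgt;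
  apply/negP => lt.
have hX0 : h * 'X^m != 0.
  by apply: contraNneq y0 => ->; rewrite -(subrr 0) orbit_pointB subrr.
have vy : rv v (orbit_point (h * 'X^m)) < 0 by rewrite -wE // (lt_trans lt).
have [a na hV] := small_heights (proj1 Sv).
have [nE nle] := neg_part_fine y0 vy.
have lV : local_V jx R phi v a (orbit_point (h * 'X^m)) <=
  (fine (v (orbit_point (h * 'X^m))))%:~R.
  rewrite -nE; apply: (local_V_small wP wE na y0 vy) => z Pz zn0.
  by apply: lt_le_trans lt _; apply: minz0 => //; apply/rsP/action_root_tm.
have sX : (size (h * 'X^m)%R <= N.-1 + m)%N.
  have h0 : h != 0 by apply: contraNneq hX0 => ->; rewrite mul0r.
  by rewrite size_mulXn // addnC leq_add2r.
(* For [m = 2] the polynomial [h * 'X^m] may have [N + 1] coefficients, so [local_V] is only known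
   to be at least -1. But the least root has value at most -1, so the image has value at most -2. *)
have [q2|ne] := eqVneq (q ^ r)%N 2%N.
  have m2 : m = 2%N by rewrite /m q2 eqxx.
  have [z2 [Pz2 z20 wz2]] := rank_one_root wP wE Sv q2.
  have : rv v (orbit_point (h * 'X^m)) < (-1)%:~R.
    rewrite -wE //; apply: lt_le_trans wz2; apply: (lt_le_trans lt).
    by apply: minz0 => //; apply/rsP/action_root_tm.
  rewrite /rv ltr_int => lt1.
  have le2 : fine (v (orbit_point (h * 'X^m))) <=
    -1 - 1 by rewrite lerBrDr lezD1.
  have sX' : (size (h * 'X^m)%R <= N.+1)%N by apply: (leq_trans sX);
    rewrite m2 addnC.
  have := le_trans (orbit_height_ge na hV hX0 sX') lV.
  by rewrite -(mulrN1z 1) ler_int => /le_trans /(_ le2).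
have m1 : m = 1%N by rewrite /m (negPf ne).
have sX' : (size (h * 'X^m)%R <= N)%N by apply: (leq_trans sX);
  rewrite m1 addn1.
have := lt_le_trans (orbit_height_gt na hV hX0 sX') lV.
by rewrite -(mulrN1z 1) ltr_int ltNge nle.
Qed.

(** The exponents satisfy r m |S| <= (r^2 + r) |S| < N - 1; for [m = 2] one has [r = 1] and the
    first is an equality. *)
Lemma root_count : ((q ^ (r * m)) ^ sS < q ^ N.-1)%N.
Proof.
rewrite -expnM ltn_exp2l // /m; case: eqP => [/rank_one[_ ->]|_]; first by lia.
rewrite muln1 -[N.-1]/((r ^ 2 + r) * sS).+1 ltnS leq_mul2r; apply/orP; right.
exact: leq_addl.
Qed.

Theorem no_small_heights : False.
Proof.
have [rs [E srs]] := action_poly_roots tm0 lead_tm.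
have /choice[w wP] : forall v, exists w : Om -> rat,
    rval_axiom w /\ forall c, c != 0 -> w (sv c) = rv v c.
  by move=> v; apply: extend_to_algebraic.
have memS v : (v \in fset_set S) = (v \in S) := in_fset_set finite_bad v.
pose sl : seq (dvaluation L) := enum_fset (fset_set S).
have slP v : v \in sl -> S v by rewrite -[v \in sl]/(v \in fset_set S) memS =>
  /set_mem.
have [v0 Sv0] := bad_place_exists.
(* Polynomials with at most [N - 1] coefficients are encoded as row vectors so that they can be
   counted. *)
pose pt (c : 'rV[Fq]_N.-1) := orbit_point (rVpoly c).
have sc (c : 'rV[Fq]_N.-1) : (size (rVpoly c) <= N.-1)%N by apply: size_poly.
have /choice[f fP] : forall cl : 'rV[Fq]_N.-1 * 'I_(size sl),
  exists j : 'I_(size rs),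
    sv (pt cl.1) - tnth (in_tuple rs) j \in val_gt (w (tnth (in_tuple sl) cl.2))
      0.
  move=> [c l]; set v := tnth _ _; have Sv : S v by apply: slP; apply: mem_tnth.
  have [z zrs zc] := near_root (wP v).1 (wP v).2 Sv (sc c) E srs.
  by have /tnthP[j zE] : z \in in_tuple rs by []; exists j; rewrite -zE.
pose F (c : 'rV[Fq]_N.-1) : {ffun 'I_(size sl) -> 'I_(size rs)} :=
  [ffun l => f (c, l)].
(* Pigeonhole: by [root_count] two polynomials choose the same root at every bad place. *)
have [c [c' [ne FE]]] : exists c c', c <> c' /\ F c = F c'.
  apply: contrapT => nex; have injF : injective F.
    by move=> c c' FE; apply: contrapT => ne; apply: nex; exists c, c'.
  have := leq_card F injF; rewrite card_ffun !card_ord card_mx mul1n cardFq srs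
    act_deg_tm.
  by rewrite leqNgt root_count.
have h0 : rVpoly (c - c') != 0.
  apply/eqP => h0; apply: ne; apply/eqP; rewrite -subr_eq0; apply/eqP.
  by rewrite -[c - c']rVpolyK h0 linear0.
pose y := orbit_point (rVpoly (c - c')).
have y0 : y != 0 by apply: orbit_point_neq0.
have yE : y = pt c - pt c' by rewrite /y linearB orbit_pointB.
(* Both points are congruent to the same root, which cancels in their difference. *)
have yS v : S v -> 0 < rv v y.
  move=> Sv; have : v \in sl by rewrite -[v \in sl]/(v \in fset_set S) memS;
    apply/mem_set.
  move=> /(@tnthP _ _ (in_tuple sl))[l vE];
    rewrite -val_gtE // -(sv_gt0 (wP v).2).
  have h1 := fP (c, l); have h2 := fP (c', l); rewrite -vE /= in h1 h2.
  have jE : f (c, l) = f (c',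
    l) by have := congr1 (fun G : {ffun _ -> _} => G l) FE; rewrite !ffunE.
  rewrite jE in h1; rewrite -(val_gtN (wP v).1) in h2.
  by have := val_gtD (wP v).1 h1 h2; rewrite opprB addrA subrK -rmorphB -yE.
have [e e0 ye] : frobenius_periodic p y.
  apply: M_integral => v Mv; have [Sv|nS] := pselect (S v).
    by rewrite val_geE // ltW // yS.
  by apply: good_orbit_integral => //; apply: leq_trans (sc _) (leq_pred _).
have Q1 : (1 < p ^ e)%N by rewrite -{1}(expn0 p) ltn_exp2l // prime_gt1 //
  (pcharf_prime charK).
(* [y ^+ (p ^ e) = y] forces the value of [y] at [v0] to be 0, while it is positive at this bad
   place. *)
have := rvalX (rv_axiom v0) (p ^ e) y0; rewrite ye -mulr_natr.
have Q1' : (1 : rat) < (p ^ e)%N%:R by rewrite ltr1n.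
by have := yS v0 Sv0; move: (rv v0 y) ((p ^ e)%N%:R) Q1' => a b; nra.
Qed.

End MainArgument.

End DrinfeldModule.

(** * The field K(x) and the conclusion *)

Lemma generated_adjoin (K Om : fieldType) (iota : {rmorphism K -> Om}) (x : Om)
    (y : adjoin_field iota x) :
  y \in generated (range (@to_adjoin K Om iota x) `|` [set adjoin_gen iota x]).
Proof.
set T := range (@to_adjoin K Om iota x) `|` _.
have : sfval y \in generated (range iota `|` [set x]) by case: y.
move=> /asboolP /(_ [set z | exists2 y', sfval y' = z & y' \in generated T]).
have [g1 gB gV] := generated_divring T.
case.
- split=> [|_ _ [a <- Ta] [b <- Tb]|_ _ [a <- Ta] [b <- Tb]].
  + by exists 1 => //; rewrite rmorph1.
  + by exists (a - b); [rewrite rmorphB|apply: gB].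
  + by exists (a / b); [rewrite fmorph_div|apply: gV].
- move=> z [[c _ <-]|->].
    by exists (to_adjoin iota x c) => //; apply: sub_generated; left; exists c.
  by exists (adjoin_gen iota x) => //; apply: sub_generated; right.
- by move=> y' /val_inj ->.
Qed.

Lemma adjoin_algebraic (K Om : fieldType) (iota : {rmorphism K -> Om}) (x :
  Om) :
    (forall z, algebraicOver iota z) ->
  forall y, algebraicOver (@to_adjoin K Om iota x) y.
Proof.
move=> algO y; have [f f0 fy] := algO (sfval y); exists f => //.
by rewrite -(fmorph_root (@sfval _ _ :
  {rmorphism adjoin_field iota x -> Om})) -map_poly_comp.
Qed.

Lemma algebraic_over_adjoin (K Om : fieldType) (iota : {rmorphism K -> Om}) (x :
  Om) :
    (forall z, algebraicOver iota z) ->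
  forall z, algebraicOver (@sfval _ _ :
    {rmorphism adjoin_field iota x -> Om}) z.
Proof.
move=> algO z; have [f f0 fz] := algO z.
exists (map_poly (@to_adjoin K Om iota x) f); first by rewrite map_poly_eq0.
by rewrite -map_poly_comp.
Qed.

Theorem mainTheorem2 (R : realType)
    (p q : nat) (qp : p.-nat q)
    (Fq : finFieldType) (cardFq : #|{: Fq}| = q)
    (k : fieldType) (cst : {rmorphism Fq -> k}) (k_curve : function_field cst)
    (oo : dvaluation k)
    (K : fieldType) (charK : p \in [pchar K]) (K_fg : fin_generated (@set0 K))
    (F : fieldType) (jF : {rmorphism F -> K}) (F_closure : is_alg_closure_Fp p jF)
    (n : nat) (n_gt0 : (0 < n)%N) (X : 'I_n -> K)
    (X_basis : transcendence_basis jF X)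
    (i : {rmorphism affine_ring oo -> K})
    (phi : {rmorphism affine_ring oo -> twpoly charK qp})
    (phi_drinfeld : drinfeld i phi)
    (t : affine_ring oo) (t_nonconstant : nonconstant cst t)
    (r : nat) (phi_t_size : size (phi t : {poly K}) = r.+1)
    (phi_t_monic : (phi t : {poly K})`_r = 1)
    (Kalg : closedFieldType) (iota : {rmorphism K -> Kalg})
    (Kalg_algebraic : forall y, algebraicOver iota y)
    (x : Kalg) (x_nontorsion : ~ torsion iota phi x) :
  let jx : {rmorphism K -> adjoin_field iota x} := @to_adjoin K Kalg iota x in
  let M : set (dvaluation (adjoin_field iota x)) :=
    places_over jx (places_KF jF X) in
  let d : dvaluation (adjoin_field iota x) -> rat :=
    degree_over jx (places_KF jF X) (degree_KF jF X) in
  let S : set (dvaluation (adjoin_field iota x)) :=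
    [set v | M v /\ ~ good_reduction jx phi v] in
  exists2 v, M v & forall a : affine_ring oo, nonconstant cst a ->
    local_height jx R phi d v a (adjoin_gen iota x) >
      q%:R ^- (r * (2 + (r ^ 2 + r) * #|` fset_set S|)) * ratr (d v).
Proof.
move=> jx M d S; have [sK genK] := K_fg.
have genL := @generated_adjoin K Kalg iota x.
have algL := adjoin_algebraic (x := x) Kalg_algebraic.
apply: contrapT => none.
apply: (no_small_heights (R := R) cardFq k_curve phi_drinfeld t_nonconstant
  phi_t_size phi_t_monic (algebraic_over_adjoin x Kalg_algebraic)
  (jx := jx) (M := M) _ _ (x := adjoin_gen iota x)).
- by move=> y yM; have := everywhere_integral_periodic charK F_closure n_gt0
    X_basis genK genL algL yM.
- by have := finite_poles X_basis genK genL algL.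
- move=> a a0; apply/eqP => ax; apply: x_nontorsion; exists a => //.
  have := congr1 (@sfval _ _ : {rmorphism adjoin_field iota x -> Kalg}) ax.
  by rewrite rmorph0 /act -horner_map -map_poly_comp.
move=> v Mv; apply: contrapT => nosmall; apply: none; exists v => // a na.
(* Positivity of the degree lets it be cancelled, which turns a bound on the local height into one
   on [local_V]. *)
have dv : 0 < ratr (d v) :> R.
  by rewrite ltr0q; have := degree_gt0 X_basis genK genL algL Mv.
rewrite /local_height ltNge; apply/negP => le; apply: nosmall; exists a => //.
by rewrite -(ler_pM2l dv) mulrN lerNl -mulNr [ratr _ * q%:R ^- _]mulrC.
Qed.
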